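(* Let $G=\bigcup_{i=1}^\infty K_i$ be a locally elliptic group and let $\mu$ denote a left Haar measure on $G$. Suppose that $\mathbf{a}:=(a_i)_{i=1}^\infty\subset\mathbb{R}_{\ge1}$ is a non-decreasing sequence such that there exists $p\in(0,\infty)$ with $$\frac{\mu(K_1)}{a_1^p}+\sum_{i=2}^\infty\frac{\mu(K_i\setminus K_{i-1})}{a_i^p}<\infty.$$ Then $L^1(G,\omega_{\mathbf{a}})$ is Hermitian, where $\omega_{\mathbf{a}}:=a_1\chi_{K_1}+\sum_{i=2}^\infty a_i\chi_{K_i\setminus K_{i-1}}$.
   Context: Writing ''$G=\bigcup_{i=1}^\infty K_i$ is a locally elliptic group'' means that $G$ is a non-compact locally compact group, the $K_i$ are compact open subgroups, $K_i\le K_{i+1}$ for all $i$, and $G=\bigcup_iK_i$. Such groups are unimodular. $\chi_U$ is the characteristic function of $U$. A weight on $G$ is a measurable function $\omega:G\to[1,\infty)$ that is bounded on compact sets, satisfies $\omega(xy)\le\omega(x)\omega(y)$ and $\omega(x)=\omega(x^{-1})$; $\omega_{\mathbf{a}}$ is a weight on $G$. $L^1(G,\omega)=\{f\in L^1(G):f\omega\in L^1(G)\}$ with norm $\|f\omega\|_{L^1(G)}$, convolution product and involution $f^*(x)=\overline{f(x^{-1})}$, is a Banach $*$-algebra. A Banach $*$-algebra is Hermitian if every self-adjoint element has real spectrum. *)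

(* Defs.v *)
From HB Require Import structures.
From mathcomp Require Import all_boot all_order all_algebra.
From mathcomp Require Import complex.
From mathcomp Require Import all_classical all_reals all_analysis.

Set Implicit Arguments.
Unset Strict Implicit.
Unset Printing Implicit Defensive.

Import Order.TTheory GRing.Theory Num.Theory.
Import numFieldNormedType.Exports.

Local Open Scope classical_set_scope.
Local Open Scope ring_scope.

(* The distinguished point carries no information: it is there only because
   the measurable types of MathComp-Analysis are pointed. *)
HB.mixin Record isTopologicalGroup G of Group G & PointedTopological G := {
  mulg_continuous : continuous (fun xy : G * G => (xy.1 * xy.2)%g) ;
  invg_continuous : continuous (fun x : G => (x^-1)%g)
}.

#[short(type="topologicalGroupType")]
HB.structure Definition TopologicalGroup :=
  {G of isTopologicalGroup G & Group G & PointedTopological G}.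

Notation borel G := (g_sigma_algebraType (@open G)).

(* K i stands for K_{i+1} of the usual 1-based indexing.  Locally compact
   groups are Hausdorff by convention. *)
Record locally_elliptic (G : topologicalGroupType) (K : nat -> set G) : Prop := {
  le_hausdorff : hausdorff_space G ;
  le_locally_compact : locally_compact [set: G] ;
  le_noncompact : ~ compact [set: G] ;
  le_subgroup : forall i, group_closed (mem (K i)) ;
  le_compact : forall i, compact (K i) ;
  le_open : forall i, open (K i) ;
  le_nested : forall i, K i `<=` K i.+1 ;
  le_cover : \bigcup_i K i = [set: G]
}.

(* Nonzero left-invariant Radon measure on the Borel sigma-algebra.  G is not
   assumed second countable, so that regularity has to be required. *)
Record left_haar (R : realType) (G : topologicalGroupType)
    (mu : {measure set (borel G) -> \bar R}) : Prop := {
  haar_neq0 : mu [set: G] <> 0%E ;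
  haar_compact_fin : forall C : set G, compact C -> (mu C < +oo)%E ;
  haar_outer_regular : forall A : set (borel G), measurable A ->
    mu A = ereal_inf [set mu U | U in [set U : set G | open U /\ A `<=` U]] ;
  haar_inner_regular : forall U : set G, open U ->
    mu U = ereal_sup [set mu C | C in [set C : set G | compact C /\ C `<=` U]] ;
  haar_left_invariant : forall (x : G) (A : set (borel G)), measurable A ->
    mu [set (x * y)%g | y in (A : set G)] = mu A
}.

(* The operations of an algebra with involution whose elements are the classes,
   modulo [same], of the vectors in [dom]. *)
Record star_algebra (C : numClosedFieldType) := StarAlgebra {
  vec :> lmodType C ;
  dom : set vec ;
  same : vec -> vec -> Prop ;
  mul : vec -> vec -> vec ;
  star : vec -> vec
}.
Arguments dom {C} s.
Arguments same {C s}.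
Arguments mul {C s}.
Arguments star {C s}.

Section Hermitian.
Variable C : numClosedFieldType.
Implicit Type A : star_algebra C.

(* (c, f) stands for c 1 + f *)
Definition unitization A : star_algebra C := @StarAlgebra C (C^o * A)%type
  [set u | dom A u.2]
  (fun u v => u.1 = v.1 /\ same u.2 v.2)
  (fun u v => (u.1 * v.1, u.1 *: v.2 + v.1 *: u.2 + mul u.2 v.2))
  (fun u => (u.1^*, star u.2)).

Definition is_unit A (e : A) : Prop :=
  dom A e /\
  forall f, dom A f -> same (mul e f) f /\ same (mul f e) f.

Definition invertible A (e f : A) : Prop :=
  exists g, [/\ dom A g, same (mul f g) e & same (mul g f) e].

(* The spectrum is computed in A if A is unital, and in its unitization
   otherwise. *)
Definition spectrum A (f : A) : set C := [set l |
  (exists e, is_unit e /\ ~ invertible e (l *: e - f)) \/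
  (~ (exists e : A, is_unit e)) /\
  ~ @invertible (unitization A) (1, 0) (l *: (1, 0) - (0, f))].

Definition hermitian_algebra A : Prop :=
  forall f, dom A f -> same (star f) f -> spectrum f `<=` [set l | l \is Num.real].

End Hermitian.

Section WeightedL1.
Variables (R : realType) (G : topologicalGroupType).
Variable mu : {measure set (borel G) -> \bar R}.
Local Notation C := R[i].

Definition cintegrable (f : G -> C) : Prop :=
  mu.-integrable [set: borel G] (fun x => (complex.Re (f x))%:E) /\
  mu.-integrable [set: borel G] (fun x => (complex.Im (f x))%:E).

Definition cintegral (f : G -> C) : C :=
  Complex (\int[mu]_(x in [set: borel G]) complex.Re (f x))
          (\int[mu]_(x in [set: borel G]) complex.Im (f x)).

(* For integrable f and g the integrand is integrable for almost every x only;
   the values at the other points do not affect the class of f * g. *)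
Definition convolution (f g : G -> C) : G -> C :=
  fun x => cintegral (fun y => f y * g (y^-1 * x)%g).

Definition involution (f : G -> C) : G -> C := fun x => (f (x^-1)%g)^*.

Definition weightedL1 (w : G -> R) : star_algebra C :=
  @StarAlgebra C (G -> C^o)
    [set f | cintegrable f /\ cintegrable (fun x => f x * (w x)%:C%C)]
    (fun f g => {ae mu, forall x, f x = g x})
    convolution involution.

End WeightedL1.

(* At each point at most one term of the series is nonzero, so the limit that
   defines its sum exists. *)
Definition omega (R : realType) (G : topologicalGroupType) (K : nat -> set G)
    (a : nat -> R) : G -> R := fun x =>
  a 0%N * \1_(K 0%N) x +
  limn (fun n => \sum_(1 <= i < n) a i * \1_(K i `\` K i.-1) x).

(* Main.v *)
Require Import Defs.
From HB Require Import structures.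
From mathcomp Require Import all_boot all_order all_algebra.
From mathcomp Require Import complex ring lra finmap.
From mathcomp Require Import all_classical all_reals all_analysis measurable_realfun.

Set Implicit Arguments.
Unset Strict Implicit.
Unset Printing Implicit Defensive.

Import Order.TTheory GRing.Theory Num.Theory.
Import numFieldNormedType.Exports.

Local Open Scope classical_set_scope.
Local Open Scope ring_scope.

(** The proof rests on two properties of the weight w = omega K a. As the levels
    K n are subgroups and a is non-decreasing, w (x y) <= w x + w y. As the series
    converges for some exponent p, the set where w <= s has measure at most
    C0 * s ^+ P (omega_growth). It remains to see that a weight with these two
    properties gives a Hermitian algebra (weightedL1_hermitian).

    Let f be self-adjoint and l = alpha + i beta with beta <> 0. Put X = f - alpha
    and T = X^2 + beta^2 = (X - i beta) (X + i beta). Convolution by f is a bounded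
    self-adjoint operator on L2, hence for a small m > 0 the element S = 1 - m T
    acts on L2 as a contraction of norm q < 1. The Neumann series of S would invert
    m T, and with it f - l; so the powers of S have to be summable in the weighted
    norm, whereas the spectral information is about L2. The two are related by an
    interpolation inequality for a bounded function b,

      norm1 b <= th * C0 * s ^+ P + norm2 b ^+ 2 / th + normw b / s,

    obtained by cutting the integral of |b| at the level w = s (JU_interpolation). Suppose
    that the weighted norm of S ^+ N is O(t ^+ N) with t >= 1. By interpolation,
    for a fixed bounded b the L1 norm of S ^+ N b is O((u t) ^+ N) with some u < 1,
    and the same holds for S ^+ N with another u < 1, because S is at distance less
    than 1 from a bounded function in L1. Subadditivity of w gives

      normw (x * y) <= normw x * norm1 y + norm1 x * normw y,

    which for x = y = S ^+ N improves the rate t of the weighted norm by a factor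
    e < 1 that does not depend on t (rate_improvement). Repeating this brings the
    rate below 1 (powers_decay), and S has a convergent Neumann series (resolvent).

    That argument is carried out in an abstract ring with two norms, a left
    ideal and an inner product on it. It is applied to the complexification of the
    unitization of the algebra of real functions, which is a ring of classes
    modulo null sets; the result is then read on complex functions, in the unital
    and in the non-unital case.

    The convolution algebra itself needs care, because G need not be second
    countable: Borel sets of the square of G may not belong to the product
    sigma-algebra, and (x, y) |-> g (x^-1 y) may not be measurable for it.
    However G is sigma-compact and mu is regular, so that every Borel set agrees up
    to a null set with one whose preimage under (x, y) |-> x^-1 y is
    product-measurable (compact_open_twist, measurable_twistable). This gives
    Tonelli's and Fubini's theorems for convolution kernels, and also the
    invariance of mu under inversion (haar_invg), by which self-adjoint functions
    act as self-adjoint operators (conv_adjoint). *)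

(** * Topological groups *)

Section TopGroup.
Variable G : topologicalGroupType.
Implicit Types (x y z : G) (A B U V C : set G).
Local Open Scope group_scope.

Lemma continuous_mulgl x : continuous (fun y : G => x * y).
Proof.
move=> y; apply: (@cvg_comp _ _ _ (fun y : G => (x, y)) (fun p : G * G => p.1 * p.2)).
  by apply: (@cvg_pair _ _ _ (nbhs y) (nbhs x) (nbhs y)); [exact: cvg_cst|exact: cvg_id].
exact: (@mulg_continuous G (x, y)).
Qed.

Lemma continuous_mulgr x : continuous (fun y : G => y * x).
Proof.
move=> y; apply: (@cvg_comp _ _ _ (fun y : G => (y, x)) (fun p : G * G => p.1 * p.2)).
  by apply: (@cvg_pair _ _ _ (nbhs y) (nbhs y) (nbhs x)); [exact: cvg_id|exact: cvg_cst].
exact: (@mulg_continuous G (y, x)).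
Qed.

Lemma image_mulgl x A : [set x * y | y in A] = (fun y => x^-1 * y) @^-1` A.
Proof.
apply/seteqP; split=> [_ [y Ay <-]|y Ay] /=; first by rewrite mulKg.
by exists (x^-1 * y) => //; rewrite mulVKg.
Qed.

Lemma open_mulgl x U : open U -> open [set x * y | y in U].
Proof.
move=> oU; rewrite image_mulgl; apply: open_comp => // y _.
exact: continuous_mulgl.
Qed.

Lemma image_invg A : [set y^-1 | y in A] = (fun y => y^-1) @^-1` A.
Proof.
apply/seteqP; split=> [_ [y Ay <-]|y Ay] /=; first by rewrite invgK.
by exists y^-1 => //; rewrite invgK.
Qed.

Lemma open_invg U : open U -> open [set y^-1 | y in U].
Proof.
move=> oU; rewrite image_invg; apply: open_comp => // y _.
exact: invg_continuous.
Qed.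

Lemma open_measurable_borel U : open U -> measurable (U : set (borel G)).
Proof. by move=> oU; apply: sub_sigma_algebra. Qed.

Lemma measurable_continuous (f : G -> G) : continuous f ->
  measurable_fun setT (f : borel G -> borel G).
Proof.
move=> cf; apply: (@measurability _ _ (borel G) (borel G) setT f (@open G)) => //.
move=> _ [U oU <-]; rewrite setTI; apply: open_measurable_borel.
by apply: open_comp => // y _; exact: cf.
Qed.

Definition mulset A B : set G := [set p.1 * p.2 | p in A `*` B].

Lemma mulsetE A B z : mulset A B z <-> exists2 x, A x & exists2 y, B y & x * y = z.
Proof.
split=> [[[x y] [/= Ax By] <-]|[x Ax [y By <-]]]; first by exists x => //; exists y.
by exists (x, y).
Qed.

Lemma open_mulsetl A B : open A -> open (mulset A B).
Proof.
move=> oA; have -> : mulset A B = \bigcup_(y in B) ((fun x => x * y^-1) @^-1` A).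
  apply/seteqP; split=> z => [/mulsetE[x Ax [y By <-]]|[y By Ay]].
    by exists y => //=; rewrite mulgK.
  by apply/mulsetE; exists (z * y^-1) => //; exists y => //; rewrite mulgVK.
apply: bigcup_open => x _; apply: open_comp => // y _.
exact: continuous_mulgr.
Qed.

(** Multiplication is continuous at (1, 1); intersecting with the inverse makes
    the neighborhood symmetric. *)
Lemma nbhs1_sqrt U : open U -> U 1 -> exists V, [/\ open V, V 1,
  (forall x, V x -> V x^-1) & (forall x y, V x -> V y -> U (x * y))].
Proof.
move=> oU U1.
have : nbhs ((1, 1) : G * G) ((fun p => p.1 * p.2) @^-1` U).
  apply: (@mulg_continuous G (1, 1)).
  by apply: open_nbhs_nbhs; split => //=; rewrite mulg1.
case=> -[P Q] /= [P1 Q1] PQ.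
have : nbhs (1 : G) (P `&` Q) by exact: filterI.
rewrite nbhsE => -[W [oW W1] WPQ].
exists (W `&` [set y^-1 | y in W]); split.
- by apply: openI => //; exact: open_invg.
- by split=> //; rewrite image_invg /= invg1.
- by move=> x; rewrite image_invg => -[Wx /= Wx'] ; split => //=; rewrite invgK.
- move=> x y [Wx _] [Wy _]; apply: (PQ (x, y)); split.
    by have [] := WPQ _ Wx.
  by have [] := WPQ _ Wy.
Qed.

(** The condition that v c stays in U for c' near c is open around v = 1;
    compactness of C makes it uniform in c. *)
Lemma compact_nbhs1 C U : compact C -> open U -> C `<=` U ->
  exists V, [/\ open V, V 1 & mulset V C `<=` U].
Proof.
move=> /compact_near_coveringP cC oU CU.
have : nbhs (1 : G) [set v | C `<=` (fun x => U (v * x))].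
  apply: cC => x Cx.
  have : nbhs ((1, x) : G * G) ((fun p => p.1 * p.2) @^-1` U).
    apply: (@mulg_continuous G (1, x)).
    by apply: open_nbhs_nbhs; split => //=; rewrite mul1g; exact: CU.
  case=> -[P Q] /= [P1 Q1] PQ.
  exists (Q, P) => // -[a b] [/= Qa Pb]; exact: (PQ (b, a)).
rewrite nbhsE => -[V [oV V1] VU]; exists V; split => //.
by move=> z /mulsetE [v Vv [c Cc <-]]; exact: VU.
Qed.

End TopGroup.

(** * Sets with a measurable twist *)

Section Twist.
Variable G : topologicalGroupType.
Implicit Types (x y z : G) (A B U V C : set G).
Local Open Scope group_scope.

Definition sigma_compact := exists2 K : nat -> set G,
  (forall i, compact (K i)) & \bigcup_i K i = [set: G].

(** Finitely many translates of V cover each of the countably many compact sets. *)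
Lemma countable_translates V : sigma_compact -> open V -> V 1 ->
  exists y : nat -> nat -> G, forall x, exists i j, V ((y i j)^-1 * x).
Proof.
move=> [K cK KT] oV V1.
have /choice[s sP] i : exists s : seq G, K i `<=`
    \bigcup_(y in [set` s]) [set y * v | v in V].
  have := cK i; rewrite compact_cover => /(_ G setT (fun y => [set y * v | v in V])).
  case=> [y _|y _|D _ DP]; first exact: open_mulgl.
    by exists y => //; exists 1 => //; rewrite mulg1.
  by exists D => y /DP [z zD yz]; exists z.
exists (fun i j => nth 1 (s i) j) => x.
have [i _ Kx] : (\bigcup_i K i) x by rewrite KT.
have [z /= zs [v Vv <-]] := sP _ _ Kx.
exists i, (index z (s i)); rewrite nth_index//.
by rewrite mulKg.
Qed.

(** The preimage of A under (x, y) |-> x^-1 y. When G is not second countable, the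
    Borel sets of the square of G need not belong to the product sigma-algebra, so
    that the twist of a Borel set may fail to be measurable; the theorems on
    iterated integrals need it to be. *)
Definition twist A : set (borel G * borel G) := [set p | A ((p.1 : G)^-1 * (p.2 : G))].

(** W is the intersection of the sets V_n C for a sequence of neighborhoods V_n of 1
    with V_(n+1) V_(n+1) inside V_n. If x lies in a V_(n+2) and x^-1 y in
    V_(n+2) C, then y lies in a V_(n+1) C; and these two memberships of x and y put
    x^-1 y in V_n C. As countably many translates a V_(n+2) cover G, the twist of W
    is a countable intersection of countable unions of rectangles. *)
Lemma compact_open_twist C U : sigma_compact -> compact C -> open U -> C `<=` U ->
  exists W : set G, [/\ measurable (W : set (borel G)), measurable (twist W),
    C `<=` W & W `<=` U].
Proof.
move=> sK cC oU CU.
have [V0 [oV0 V01 V0U]] := compact_nbhs1 cC oU CU.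
pose T := {V : set G | open V /\ V 1}.
have /choice[f fP] : forall t : T, exists u : T,
    (forall x, sval u x -> sval u x^-1) /\
    (forall x y, sval u x -> sval u y -> sval t (x * y)).
  move=> -[V [oV V1]] /=; have [W [oW W1 WV WW]] := nbhs1_sqrt oV V1.
  by exists (exist _ W (conj oW W1)).
pose t0 : T := exist _ V0 (conj oV0 V01).
pose V n := sval (iter n.+1 f t0).
have oV n : open (V n) by rewrite /V; case: (iter _ _ _) => ? [].
have V1 n : V n 1 by rewrite /V; case: (iter _ _ _) => ? [].
have VV n x : V n x -> V n x^-1 by have := (fP (iter n f t0)).1 x.
have VM n x y : V n.+1 x -> V n.+1 y -> V n (x * y).
  by have := (fP (iter n.+1 f t0)).2 x y.
have V0V x : V 0%N x -> V0 x.
  by move=> Vx; have := (fP t0).2 x 1 Vx (V1 0%N); rewrite mulg1.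
pose W n := mulset (V n) C.
have oW n : open (W n) by exact: open_mulsetl.
have WS n x z : V n.+1 x -> W n.+1 z -> W n (x * z).
  move=> Vx /mulsetE[v Vv [c Cc <-]]; apply/mulsetE.
  by exists (x * v); [exact: VM|exists c => //; rewrite mulgA].
have /choice[y yP] n : exists y : nat -> nat -> G,
    forall x, exists i j, V n ((y i j)^-1 * x) by exact: countable_translates.
(* the pairs (x, y) with x in a V_n and y in a V_(n-1) C for some point a of a countable set *)
pose E n : set (borel G * borel G) := \bigcup_i \bigcup_j
  ([set y n i j * v | v in V n] `*` [set y n i j * w | w in W n.-1]).
have mE n : measurable (E n).
  apply: bigcup_measurable => i _; apply: bigcup_measurable => j _.
  by apply: measurableX; apply: open_measurable_borel; exact: open_mulgl.
exists (\bigcap_n W n); split.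
- by apply: bigcap_measurable => // n _; exact: open_measurable_borel.
- suff -> : twist (\bigcap_n W n) = \bigcap_n E n.+2.
    by apply: bigcap_measurable.
  apply/seteqP; split=> [[a b] /= ab n _|[a b] /= ab n _].
    have [i [j Va]] := yP n.+2 a.
    exists i => //; exists j => //; split => /=.
      by exists ((y n.+2 i j)^-1 * a) => //; rewrite mulVKg.
    exists ((y n.+2 i j)^-1 * b); last by rewrite mulVKg.
    have /(WS n.+1 _ _ Va) := ab n.+2 I.
    by rewrite -mulgA mulVKg.
  have [i _ [j _ /= [[v Vv av] [w Ww bw]]]] := ab n I.
  rewrite /= -av -bw invgM -mulgA mulKg; apply: WS => //.
  rewrite -[v^-1]mulg1; apply: VM => //; exact: VV.
- move=> c Cc n _; apply/mulsetE; exists 1 => //; exists c => //.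
  by rewrite mul1g.
- move=> x /(_ 0%N I) /mulsetE [v Vv [c Cc <-]]; apply: V0U.
  by apply/mulsetE; exists v; [exact: V0V|exists c].
Qed.

End Twist.

(** * Invariance of the Haar measure under inversion *)

Section Haar.
Variables (R : realType) (G : topologicalGroupType) (K : nat -> set G).
Variable mu : {sigma_finite_measure set (borel G) -> \bar R}.
Hypotheses (hK : locally_elliptic K) (hmu : left_haar mu).
Implicit Types (x y z : G) (A B U V C : set (borel G)).

Let measurableK n : measurable (K n : set (borel G)).
Proof. by apply: open_measurable_borel; exact: le_open hK n. Qed.

Let sigma_compactG : sigma_compact G.
Proof. by exists K; [exact: le_compact hK|exact: le_cover hK]. Qed.

Let compact_measurable (C : set G) : compact C -> measurable (C : set (borel G)).
Proof.
move=> /(compact_closed (le_hausdorff hK)) cC.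
rewrite -[C]setCK; apply: measurableC; apply: open_measurable_borel.
by rewrite openC.
Qed.

Lemma level_one n : K n 1%g.
Proof. by have [+ _] := le_subgroup hK n; rewrite inE. Qed.

Lemma level_div n x y : K n x -> K n y -> K n (x / y)%g.
Proof.
move=> Kx Ky; have [_ /(_ x y)] := le_subgroup hK n.
by rewrite !inE; exact.
Qed.

Lemma level_inv n x : K n x -> K n x^-1%g.
Proof. by move=> Kx; rewrite -div1g; exact: level_div (level_one n) Kx. Qed.

Lemma level_mul n x y : K n x -> K n y -> K n (x * y)%g.
Proof. by move=> Kx /level_inv Ky; rewrite -[y]invgK; exact: level_div. Qed.

Lemma level_mono m n : (m <= n)%N -> K m `<=` K n.
Proof.
by move=> /subnK <-; elim: (n - m)%N => [//|k IH] x Kx; apply: (le_nested hK); exact: IH.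
Qed.

Lemma level_fin n : (mu (K n) < +oo)%E.
Proof. by apply: (haar_compact_fin hmu); exact: le_compact hK n. Qed.

Lemma measurable_mulgl x : measurable_fun setT ((fun y => x * y)%g : borel G -> borel G).
Proof. by apply: measurable_continuous; exact: continuous_mulgl. Qed.

Lemma measurable_invg : measurable_fun setT ((fun y => y^-1)%g : borel G -> borel G).
Proof. by apply: measurable_continuous; exact: invg_continuous. Qed.

Lemma measurable_preimage_invg A : measurable A ->
  measurable ((fun y => y^-1)%g @^-1` (A : set G) : set (borel G)).
Proof. by move=> mA; rewrite -[X in measurable X]setTI; exact: measurable_invg. Qed.

Lemma haar_mulgl x A : measurable A ->
  mu ((fun y => x * y)%g @^-1` (A : set G)) = mu A.
Proof.
move=> mA; rewrite -(haar_left_invariant hmu x^-1%g mA) image_mulgl.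
by rewrite invgK.
Qed.

(** Tonelli's theorem for the set of pairs (x, y) in K n with x^-1 y in A: by left
    invariance its measure is mu (K n) mu A when y is integrated first and
    mu (K n) mu (A^-1) when x is. *)
Lemma haar_invg_twist n A : measurable A -> measurable (twist A) -> A `<=` K n ->
  mu ((fun y => y^-1)%g @^-1` (A : set G)) = mu A.
Proof.
move=> mA mtA AK.
set A' := _ @^-1` _.
have mA' : measurable (A' : set (borel G)) by exact: measurable_preimage_invg.
have A'K : A' `<=` K n.
  by move=> y /= /AK /level_inv; rewrite invgK.
pose S : set (borel G * borel G) := twist A `&` (K n `*` K n).
have mS : measurable S by apply: measurableI => //; exact: measurableX.
have := @indic_fubini_tonelli _ _ _ _ _ mu mu _ mS.
rewrite indic_fubini_tonelli_FE// indic_fubini_tonelli_GE//.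
have -> : mu \o xsection S = (fun=> mu A) \_ (K n).
  apply/funext => y; rewrite /= patchE; case: ifPn => [|]; rewrite ?inE ?notin_setE => Ky.
    rewrite -(haar_mulgl y^-1%g mA); congr (mu _); apply/seteqP; split=> x.
      by rewrite /xsection /= inE => -[].
    rewrite /xsection /= inE => Ayx; split => //; split => //=.
    have := level_mul Ky (AK _ Ayx); by rewrite mulVKg.
  rewrite -[RHS]/0%E -(measure0 mu); congr (mu _); apply/seteqP; split=> x //.
  by rewrite /xsection /= inE => -[_ []].
have -> : mu \o ysection S = (fun=> mu A') \_ (K n).
  apply/funext => x; rewrite /= patchE; case: ifPn => [|]; rewrite ?inE ?notin_setE => Kx.
    rewrite -(haar_mulgl x^-1%g mA'); congr (mu _); apply/seteqP; split=> y.
      by rewrite /ysection /= inE => -[]; rewrite /twist /A' /= invgM invgK.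
    rewrite /ysection /= inE /A'/= invgM invgK => Ayx; split => //; split => //=.
    have /level_inv := level_mul (AK _ Ayx) (level_inv Kx).
    by rewrite mulgK invgK.
  rewrite -[RHS]/0%E -(measure0 mu); congr (mu _); apply/seteqP; split=> y //.
  by rewrite /ysection /= inE => -[_ []].
rewrite -!integral_mkcond !integral_cst//.
have [K0|K0] := eqVneq (mu (K n)) 0%E.
  move=> _.
  have -> : mu A = 0%E by apply/eqP; rewrite -measure_le0 -K0 le_measure ?inE.
  by apply/eqP; rewrite -measure_le0 -K0 le_measure ?inE.
have Kf : mu (K n) \is a fin_num by rewrite ge0_fin_numE ?level_fin.
have Kp : (0 < mu (K n))%E by rewrite measure_gt0.
move=> E; apply/eqP; rewrite eq_le !leNgt.
by rewrite -(lte_pmul2r Kf Kp) E ltxx -(lte_pmul2r Kf Kp) E ltxx.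
Qed.

(** Between a compact set and an open set there is a set to which the Tonelli
    computation applies, and inner regularity approximates by compact sets. *)
Lemma haar_invg_open n (U : set G) : open U -> U `<=` K n ->
  (mu ((fun y => y^-1)%g @^-1` U) <= mu U)%E.
Proof.
move=> oU UK.
rewrite (haar_inner_regular hmu); last by rewrite -image_invg; exact: open_invg.
apply: ge_ereal_sup => _ [C [cC CU] <-].
pose C' : set G := [set y^-1%g | y in C].
have cC' : compact C'.
  apply: continuous_compact => //; apply: continuous_subspaceT.
  exact: invg_continuous.
have C'U : C' `<=` U by move=> _ [y /CU Cy <-].
have [W [mW mtW CW WU]] := compact_open_twist sigma_compactG cC' oU C'U.
apply: (@le_trans _ _ (mu W)); last first.
  by apply: le_measure; rewrite ?inE//; exact: open_measurable_borel.
rewrite -(haar_invg_twist mW mtW (subset_trans WU UK)).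
apply: le_measure; rewrite ?inE; first exact: compact_measurable.
  exact: measurable_preimage_invg.
by move=> x Cx /=; apply: CW; exists x.
Qed.

Lemma haar_invg_le n A : measurable A -> A `<=` K n ->
  (mu ((fun y => y^-1)%g @^-1` (A : set G)) <= mu A)%E.
Proof.
move=> mA AK; rewrite [leRHS](haar_outer_regular hmu)//.
apply: le_ereal_inf_tmp => _ [U [oU AU] <-].
have oUK : open (U `&` K n) by apply: openI => //; exact: le_open hK n.
apply: le_trans (_ : _ <= mu (U `&` K n))%E _.
  apply: le_trans (haar_invg_open oUK (@subIsetr _ _ _)).
  apply: le_measure; rewrite ?inE.
  - exact: measurable_preimage_invg.
  - by apply: measurable_preimage_invg; exact: open_measurable_borel.
  - by move=> x /= Ax; split; [exact: AU|exact: AK].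
by apply: le_measure; rewrite ?inE//; exact: open_measurable_borel.
Qed.

(** On each K n, the inequality holds for A and for its inverse, hence equality;
    the measures of the sections by K n then increase to the measure of A. *)
Lemma haar_invg A : measurable A ->
  mu ((fun y => y^-1)%g @^-1` (A : set G)) = mu A.
Proof.
move=> mA.
have EK n : mu ((fun y => y^-1)%g @^-1` (A `&` K n : set G)) = mu (A `&` K n).
  apply/eqP; rewrite eq_le (haar_invg_le (n := n)) ?andbT//=; last first.
    exact: measurableI.
  rewrite -[X in (mu X <= _)%E](_ : (fun y => y^-1)%g @^-1` ((fun y => y^-1)%g @^-1` (A `&` K n : set G)) = _).
    apply: (haar_invg_le (n := n)).
      by apply: measurable_preimage_invg; exact: measurableI.
    by move=> x [_ /level_inv]; rewrite invgK.
  by apply/seteqP; split=> x /=; rewrite invgK.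
have cov (B : set (borel G)) : \bigcup_n (B `&` K n) = B.
  by rewrite -setI_bigcupr (le_cover hK) setIT.
have cvg (B : set (borel G)) : measurable B -> mu (B `&` K n) @[n --> \oo] --> mu B.
  move=> mB; rewrite -[in X in _ --> X](cov B).
  apply: nondecreasing_cvg_mu.
  - by move=> i; exact: measurableI.
  - by apply: bigcup_measurable => i _; exact: measurableI.
  - by move=> i j ij; apply/subsetPset; apply: setIS; exact: level_mono.
apply: (@cvg_unique _ _ (mu ((fun y => y^-1)%g @^-1` (A : set G) `&` K n) @[n --> \oo])) => //.
  by apply: cvg; exact: measurable_preimage_invg.
rewrite (_ : (fun n => _) = (fun n => mu (A `&` K n))); first exact: cvg.
apply/funext => n; rewrite -EK; congr (mu _); apply/seteqP; split=> x /= [Ax Kx].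
  by split => //; exact: level_inv.
by split => //; rewrite -[x]invgK; exact: level_inv.
Qed.

(** The property is stable under countable unions and intersections, and by
    regularity every Borel set has it; this is how functions on G enter Tonelli's
    theorem through x^-1 y. *)
Definition twistable A := exists B : set (borel G),
  [/\ measurable B, measurable (twist B) & {ae mu, forall x, A x <-> B x}].

Lemma twistable_bigcup (A : nat -> set (borel G)) :
  (forall i, twistable (A i)) -> twistable (\bigcup_i A i).
Proof.
move=> /choice[B BP]; exists (\bigcup_i B i); split.
- by apply: bigcup_measurable => i _; have [] := BP i.
- rewrite (_ : twist _ = \bigcup_i twist (B i))//.
  by apply: bigcup_measurable => i _; have [] := BP i.
- have : {ae mu, forall x, forall i, A i x <-> B i x}.
    by apply: ae_foralln => i; have [] := BP i.
  by apply: (@filterS _ _ (ae_filter_ringOfSetsType mu)) => x AB; split=> -[i _ /AB ?]; exists i.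
Qed.

Lemma twistable_bigcap (A : nat -> set (borel G)) :
  (forall i, twistable (A i)) -> twistable (\bigcap_i A i).
Proof.
move=> /choice[B BP]; exists (\bigcap_i B i); split.
- by apply: bigcap_measurable => // i _; have [] := BP i.
- rewrite (_ : twist _ = \bigcap_i twist (B i))//.
  by apply: bigcap_measurable => // i _; have [] := BP i.
- have : {ae mu, forall x, forall i, A i x <-> B i x}.
    by apply: ae_foralln => i; have [] := BP i.
  by apply: (@filterS _ _ (ae_filter_ringOfSetsType mu)) => x AB; split=> ABx i _; apply/AB; exact: ABx.
Qed.

Lemma ae_eq_set A B : measurable A -> measurable B -> B `<=` A ->
  (mu A < +oo)%E -> (mu A <= mu B)%E -> {ae mu, forall x, A x <-> B x}.
Proof.
move=> mA mB BA Afin AB; exists (A `\` B); split.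
- exact: measurableD.
- have E : mu A = mu B by apply/eqP; rewrite eq_le AB/= le_measure ?inE.
  have := measureD mA mB Afin; rewrite (setIidr BA) => ->.
  by rewrite -[X in (X - _)%E]/(mu A) E subee// -E ge0_fin_numE.
- move=> x /= nAB; split; first by apply: contrapT => nA; apply: nAB; split => // /BA.
  by move=> Bx; apply: nAB; split => // _; exact: BA.
Qed.

(** Inner regularity exhausts U, up to 1/(k+1), by sets with a measurable twist. *)
Lemma twistable_open n (U : set G) : open U -> U `<=` K n -> twistable U.
Proof.
move=> oU UK.
have mU : measurable (U : set (borel G)) by exact: open_measurable_borel.
have Ufin : (mu U < +oo)%E.
  by rewrite (le_lt_trans _ (level_fin n))// le_measure ?inE.
have Unum : mu U \is a fin_num by rewrite ge0_fin_numE.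
have /choice[W WP] k : exists W : set (borel G), [/\ measurable W, measurable (twist W),
    W `<=` U & (mu U - (k.+1%:R^-1)%:E < mu W)%E].
  have k0 : 0 < k.+1%:R^-1 :> R by rewrite invr_gt0.
  have := @ub_ereal_sup_adherent _ [set mu C | C in [set C : set G | compact C /\ C `<=` U]] _ k0.
  rewrite -(haar_inner_regular hmu)// => /(_ Unum)[_ [C [cC CU] <-] ltC].
  have [W [mW mtW CW WU]] := compact_open_twist sigma_compactG cC oU CU.
  exists W; split => //; apply: lt_le_trans ltC _.
  by apply: le_measure; rewrite ?inE//; exact: compact_measurable.
exists (\bigcup_k W k); split.
- by apply: bigcup_measurable => k _; have [] := WP k.
- rewrite (_ : twist _ = \bigcup_k twist (W k))//.
  by apply: bigcup_measurable => k _; have [] := WP k.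
- have mW : measurable (\bigcup_k W k) by apply: bigcup_measurable => k _; have [] := WP k.
  apply: ae_eq_set => //; first by move=> x [k _]; have [_ _ + _] := WP k; apply.
  apply/lee_addgt0Pr => e e0.
  have [k _ /(_ _ (leqnn k))/= ke] := near_infty_natSinv_lt (PosNum e0).
  rewrite -leeBlDr//; apply: le_trans (_ : _ <= mu (W k))%E _.
    have [_ _ _ /ltW] := WP k; apply: le_trans; apply: leeB => //.
    by rewrite lee_fin ltW.
  by apply: le_measure; rewrite ?inE//; [have [] := WP k|exact: bigcup_sup].
Qed.

(** By outer regularity, A is a countable intersection of open sets up to a null
    set. *)
Lemma twistable_level n A : measurable A -> A `<=` K n -> twistable A.
Proof.
move=> mA AK.
have Afin : (mu A < +oo)%E.
  by rewrite (le_lt_trans _ (level_fin n))// le_measure ?inE.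
have Anum : mu A \is a fin_num by rewrite ge0_fin_numE.
have /choice[U UP] k : exists U : set G, [/\ open U, A `<=` U, U `<=` K n &
    (mu U < mu A + (k.+1%:R^-1)%:E)%E].
  have k0 : 0 < k.+1%:R^-1 :> R by rewrite invr_gt0.
  have := @lb_ereal_inf_adherent _ [set mu U | U in [set U : set G | open U /\ A `<=` U]] _ k0.
  rewrite -(haar_outer_regular hmu)// => /(_ Anum)[_ [U [oU AU] <-] ltU].
  exists (U `&` K n); split => //.
  - by apply: openI => //; exact: le_open hK n.
  - by move=> x Ax; split; [exact: AU|exact: AK].
  - apply: le_lt_trans ltU; apply: le_measure; rewrite ?inE//.
      by apply: measurableI => //; exact: open_measurable_borel.
    exact: open_measurable_borel.
have [B [mB mtB HB]] : twistable (\bigcap_k U k).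
  by apply: twistable_bigcap => k; have [? _ ? _] := UP k; exact: (@twistable_open n).
exists B; split => //.
have mU : measurable (\bigcap_k U k : set (borel G)).
  by apply: bigcap_measurable => // k _; apply: open_measurable_borel; have [] := UP k.
have UA : {ae mu, forall x, (\bigcap_k U k : set (borel G)) x <-> A x}.
  have leUk k : (mu (\bigcap_k U k) <= mu (U k))%E.
    apply: le_measure; rewrite ?inE//; last by move=> x; exact.
    by apply: open_measurable_borel; have [] := UP k.
  have leU : (mu (\bigcap_k U k) <= mu A)%E.
    apply/lee_addgt0Pr => e e0.
    have [k _ /(_ _ (leqnn k))/= ke] := near_infty_natSinv_lt (PosNum e0).
    apply: le_trans (leUk k) _; have [_ _ _ /ltW] := UP k; move=> h; apply: (le_trans h).
    by apply: leeD => //; rewrite lee_fin ltW.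
  apply: ae_eq_set => //; last exact: le_lt_trans Afin.
  by move=> x Ax k _; have [_ + _ _] := UP k; apply.
by move: UA HB; apply: (@filterS2 _ _ (ae_filter_ringOfSetsType mu)) => x h1 h2; rewrite -h1.
Qed.

Lemma measurable_twistable A : measurable A -> twistable A.
Proof.
move=> mA; have -> : A = \bigcup_n (A `&` K n).
  by rewrite -setI_bigcupr (le_cover hK) setIT.
by apply: twistable_bigcup => n; apply: (@twistable_level n) => //; exact: measurableI.
Qed.

End Haar.

(** * Measure-preserving maps and jointly measurable versions *)

Section MeasurePreserving.
Context d (T : measurableType d) (R : realType).
Variable mu : {measure set T -> \bar R}.

Definition measure_preserving (phi : T -> T) :=
  measurable_fun setT phi /\ forall A, measurable A -> mu (phi @^-1` A) = mu A.

Lemma measure_preserving_comp phi psi : measure_preserving phi ->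
  measure_preserving psi -> measure_preserving (phi \o psi).
Proof.
move=> [mphi phiE] [mpsi psiE]; split; first exact: measurableT_comp.
move=> A mA; rewrite comp_preimage psiE ?phiE//.
by rewrite -[X in measurable X]setTI; exact: mphi.
Qed.

Lemma measure_preserving_ae phi (P : T -> Prop) : measure_preserving phi ->
  {ae mu, forall x, P x} -> {ae mu, forall x, P (phi x)}.
Proof.
move=> [mphi phiE] [N [mN N0 PN]]; exists (phi @^-1` N); split.
- by rewrite -[X in measurable X]setTI; exact: mphi.
- by rewrite phiE.
- by move=> x /= Px; exact: PN.
Qed.

Lemma measure_preserving_integral phi (f : T -> \bar R) : measure_preserving phi ->
  measurable_fun setT f -> (\int[mu]_x f (phi x) = \int[mu]_x f x)%E.
Proof.
move=> [mphi phiE] mf.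
have ge0 (g : T -> \bar R) : measurable_fun setT g -> (forall x, 0 <= g x)%E ->
    (\int[mu]_x g (phi x) = \int[mu]_x g x)%E.
  move=> mg g0; have := @ge0_integral_pushforward _ _ _ _ _ _ mphi mu _ g measurableT mg (fun x _ => g0 x).
  rewrite preimage_setT => <-; apply: eq_measure_integral => A mA _.
  exact: (phiE _ mA).
rewrite -[fun x => f (phi x)]/(f \o phi) [LHS]integralE [RHS]integralE.
rewrite funepos_comp funeneg_comp; congr (_ - _)%E.
  exact: (ge0 f^\+%E (measurable_funepos mf)).
exact: (ge0 f^\-%E (measurable_funeneg mf)).
Qed.

Lemma measure_preserving_Rintegral phi (f : T -> R) : measure_preserving phi ->
  measurable_fun setT f -> \int[mu]_x f (phi x) = \int[mu]_x f x.
Proof.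
move=> mp mf; rewrite /Rintegral; congr fine.
by apply: (measure_preserving_integral (f := EFin \o f)) => //; exact/measurable_EFinP.
Qed.

Lemma measure_preserving_integrable phi (f : T -> \bar R) : measure_preserving phi ->
  mu.-integrable setT f -> mu.-integrable setT (f \o phi).
Proof.
move=> mp /integrableP[mf ifin]; apply/integrableP; split.
  by apply: measurableT_comp => //; exact: mp.1.
rewrite /=.
by rewrite (measure_preserving_integral (f := abse \o f)) //; exact: measurableT_comp.
Qed.

End MeasurePreserving.

Section Version.
Variable R : realType.

Definition nth_rat (n : nat) : R := if choice.unpickle n is Some q then ratr (q : rat) else 0.

Lemma nth_rat_dense (x y : R) : x < y -> exists n, x < nth_rat n < y.
Proof.
move=> /rat_in_itvoo[q]; rewrite in_itv/= => xqy.
by exists (choice.pickle q); rewrite /nth_rat choice.pickleK.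
Qed.

(** Carries statements about sets that are stable under countable operations over
    to functions: S n is meant to be the superlevel set above nth_rat n. *)
Definition of_levels T (S : nat -> set T) (t : T) : \bar R :=
  esups (fun n => if t \in S n then (nth_rat n)%:E else -oo%E) 0%N.

Lemma measurable_of_levels d (T : measurableType d) (S : nat -> set T) :
  (forall n, measurable (S n)) -> measurable_fun setT (of_levels S).
Proof.
move=> mS; apply: (measurable_fun_esups (f := fun n t => if t \in S n then _ else _)) => n.
apply: measurable_fun_ifT => //; apply: (measurable_fun_bool true).
rewrite setTI (_ : _ @^-1` _ = S n)//; apply/seteqP; split=> t /=.
  by move/set_mem.
by move/mem_set.
Qed.

Lemma of_levelsE T (S : nat -> set T) (t : T) (r : R) :
  (forall n, S n t <-> nth_rat n < r) -> of_levels S t = r%:E.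
Proof.
move=> Sr; apply/eqP; rewrite eq_le; apply/andP; split.
  apply: ge_ereal_sup => _ [n _ <-]; case: ifPn => [|_]; last exact: leNye.
  by rewrite inE => /Sr /ltW; rewrite lee_fin.
rewrite leNgt; apply/negP => lt.
have [n] : exists n, (of_levels S t < (nth_rat n)%:E)%E /\ nth_rat n < r.
  move: lt; case: (of_levels S t) => [x| |] //.
    rewrite lte_fin => /nth_rat_dense[n /andP[xn nr]]; exists n; split => //.
  move=> _; have /nth_rat_dense[n /andP[_ nr]] : r - 1 < r by rewrite ltrBlDr ltrDl.
  by exists n; rewrite ltNyr.
case=> + nr; apply/negP; rewrite -leNgt; apply: ereal_sup_ubound.
by exists n => //=; rewrite mem_set//; exact/Sr.
Qed.

End Version.

Section TwistVersion.
Variables (R : realType) (G : topologicalGroupType) (K : nat -> set G).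
Variable mu : {sigma_finite_measure set (borel G) -> \bar R}.
Hypotheses (hK : locally_elliptic K) (hmu : left_haar mu).

Lemma measure_preserving_mulgl (x : G) :
  measure_preserving mu ((fun y => x * y)%g : borel G -> borel G).
Proof.
split; first exact: measurable_mulgl.
by move=> A mA; exact: haar_mulgl.
Qed.

Lemma measure_preserving_invg :
  measure_preserving mu ((fun y => y^-1)%g : borel G -> borel G).
Proof.
split; first exact: measurable_invg.
by move=> A mA; exact: (haar_invg hK).
Qed.

Lemma measure_preserving_divgl (x : G) :
  measure_preserving mu ((fun y => y^-1 * x)%g : borel G -> borel G).
Proof.
rewrite (_ : (fun y => _) = (fun y : G => y^-1)%g \o (fun y : G => x^-1 * y)%g).
  apply: measure_preserving_comp; first exact: measure_preserving_invg.
  exact: measure_preserving_mulgl.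
by apply/funext => y /=; rewrite invgM invgK.
Qed.

(** Replace each superlevel set of g above a rational by an almost equal set with
    a measurable twist. *)
Lemma twist_version (g : borel G -> R) : measurable_fun setT g ->
  exists h : borel G -> R, [/\ measurable_fun setT h,
    measurable_fun setT (fun p : borel G * borel G => h ((p.1 : G)^-1 * p.2)%g) &
    {ae mu, forall x, g x = h x}].
Proof.
move=> mg.
have /choice[B BP] n : twistable mu (g @^-1` [set r | nth_rat R n < r]).
  apply: (measurable_twistable hK hmu).
  rewrite -[X in measurable X]setTI; apply: mg => //.
  by rewrite -set_itvoy; exact: measurable_itv.
exists (fun x => fine (of_levels R B x)); split.
- apply: measurableT_comp => //; apply: measurable_of_levels => n.
  by have [] := BP n.
- have E : (fun p : borel G * borel G => fine (of_levels R B ((p.1 : G)^-1 * p.2)%g)) =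
      (fun p => fine (of_levels R (fun n => twist (B n)) p)).
    by [].
  rewrite E; apply: measurableT_comp => //; apply: measurable_of_levels => n.
  by have [] := BP n.
- have : {ae mu, forall x, forall n, nth_rat R n < g x <-> B n x}.
    by apply: ae_foralln => n; have [] := BP n.
  apply: (@filterS _ _ (ae_filter_ringOfSetsType mu)) => x gB.
  by rewrite (of_levelsE (r := g x))// => n; split=> /gB.
Qed.

End TwistVersion.

(** * Iterated integrals of convolution kernels *)

Section AlmostEverywhere.
Context d (T : measurableType d) (R : realType).
Variable mu : {measure set T -> \bar R}.

Lemma ae_mono (P Q : T -> Prop) : (forall x, P x -> Q x) ->
  {ae mu, forall x, P x} -> {ae mu, forall x, Q x}.
Proof. by move=> PQ; apply: (@filterS _ _ (ae_filter_ringOfSetsType mu)) => x /PQ. Qed.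

Lemma ae_mono2 (P Q S : T -> Prop) : (forall x, P x -> Q x -> S x) ->
  {ae mu, forall x, P x} -> {ae mu, forall x, Q x} -> {ae mu, forall x, S x}.
Proof. by move=> PQ; apply: (@filterS2 _ _ (ae_filter_ringOfSetsType mu)) => x /PQ. Qed.

Lemma ae_eq_integralT (f g : T -> \bar R) : measurable_fun setT f ->
  measurable_fun setT g -> {ae mu, forall x, f x = g x} ->
  (\int[mu]_x f x = \int[mu]_x g x)%E.
Proof.
move=> mf mg fg; apply: ae_eq_integral => //.
by apply: ae_mono fg => x ->.
Qed.

Lemma ae_eq_RintegralT (f g : T -> R) : measurable_fun setT f ->
  measurable_fun setT g -> {ae mu, forall x, f x = g x} ->
  \int[mu]_x f x = \int[mu]_x g x.
Proof.
move=> mf mg fg; congr fine; apply: ae_eq_integralT; first exact/measurable_EFinP.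
  exact/measurable_EFinP.
by apply: ae_mono fg => x ->.
Qed.

Lemma ae_eq_integrableT (f g : T -> \bar R) : measurable_fun setT g ->
  {ae mu, forall x, f x = g x} -> mu.-integrable setT f -> mu.-integrable setT g.
Proof.
move=> mg fg /integrableP[mf ffin]; apply/integrableP; split => //.
rewrite (_ : (\int[mu]_x _ = \int[mu]_x `|f x|)%E)//.
apply: ae_eq_integralT; try exact: measurableT_comp.
by apply: ae_mono fg => x ->.
Qed.

Lemma abse_fine_le (x : \bar R) : (`|(fine x)%:E| <= `|x|)%E.
Proof. by case: x => [r| |] //=; rewrite normr0 leey. Qed.

End AlmostEverywhere.

Section Kernel.
Variables (R : realType) (G : topologicalGroupType) (K : nat -> set G).
Variable mu : {sigma_finite_measure set (borel G) -> \bar R}.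
Hypotheses (hK : locally_elliptic K) (hmu : left_haar mu).
Implicit Types f g k : borel G -> R.

(** With k = 1 the integral over y is the convolution of f and g at x; in general
    k is a weight or a bounded test function. *)
Definition kernel f g k (y x : G) : R := f y * g (y^-1 * x)%g * k x.

Lemma measurable_translate g (y : G) : measurable_fun setT g ->
  measurable_fun setT (fun x : borel G => g (y * x)%g).
Proof. by move=> mg; apply: (measurableT_comp mg (measurable_mulgl y)). Qed.

Lemma measurable_reflect g (x : G) : measurable_fun setT g ->
  measurable_fun setT (fun y : borel G => g (y^-1 * x)%g).
Proof. by move=> mg; apply: (measurableT_comp mg); case: (measure_preserving_divgl hK hmu x). Qed.

Lemma measurable_kernelr f g k y : measurable_fun setT g ->
  measurable_fun setT k -> measurable_fun setT (kernel f g k y : borel G -> R).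
Proof.
move=> mg mk; apply: measurable_funM => //; apply: measurable_funM => //.
exact: (measurable_translate (g := g)).
Qed.

Lemma measurable_kernell f g k x : measurable_fun setT f ->
  measurable_fun setT g -> measurable_fun setT (fun y : borel G => kernel f g k y x).
Proof.
move=> mf mg; apply: measurable_funM => //; apply: measurable_funM => //.
exact: measurable_reflect.
Qed.

(** The version of g with a measurable twist gives a jointly measurable kernel. It
    changes each section on a null set only, because left translations and
    y |-> y^-1 x preserve null sets; so the iterated integrals stay the same. *)
Lemma kernel_version f g k : measurable_fun setT f -> measurable_fun setT g ->
    measurable_fun setT k ->
  exists F : borel G * borel G -> R, [/\ measurable_fun setT F,
    (forall y, {ae mu, forall x, kernel f g k y x = F (y, x)}) &
    (forall x, {ae mu, forall y, kernel f g k y x = F (y, x)})].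
Proof.
move=> mf mg mk.
have [h [mh mth gh]] := twist_version hK hmu mg.
exists (fun p => f p.1 * h ((p.1 : G)^-1 * p.2)%g * k p.2); split.
- apply: measurable_funM; last exact: (measurableT_comp mk measurable_snd).
  by apply: measurable_funM => //; exact: (measurableT_comp mf measurable_fst).
- move=> y; have := measure_preserving_ae (measure_preserving_mulgl hmu y^-1%g) gh.
  by apply: ae_mono => x; rewrite /kernel => ->.
- move=> x; have := measure_preserving_ae (measure_preserving_divgl hK hmu x) gh.
  by apply: ae_mono => y; rewrite /kernel => ->.
Qed.

Section KernelIntegrals.
Variables (f g k : borel G -> R).
Hypotheses (mf : measurable_fun setT f) (mg : measurable_fun setT g).
Hypothesis mk : measurable_fun setT k.
Local Open Scope ereal_scope.

Let mEr y : measurable_fun setT (fun x : borel G => (kernel f g k y x)%:E).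
Proof. by apply/measurable_EFinP; exact: measurable_kernelr. Qed.

Let mEl x : measurable_fun setT (fun y : borel G => (kernel f g k y x)%:E).
Proof. by apply/measurable_EFinP; exact: measurable_kernell. Qed.

Let sec (F : borel G * borel G -> R) (mF : measurable_fun setT F) :
  (forall y, measurable_fun setT (fun x => (F (y, x))%:E)) *
  (forall x, measurable_fun setT (fun y => (F (y, x))%:E)).
Proof.
by split=> z; apply/measurable_EFinP; apply: (measurableT_comp mF);
  [exact: measurable_pair1|exact: measurable_pair2].
Qed.

(** Both iterated integrals are those of the jointly measurable version. *)
Lemma kernel_tonelli :
  \int[mu]_x \int[mu]_y `|(kernel f g k y x)%:E| =
  \int[mu]_y \int[mu]_x `|(kernel f g k y x)%:E|.
Proof.
have [F [mF Fy Fx]] := kernel_version mf mg mk; have [m1 m2] := sec mF.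
transitivity (\int[mu]_x \int[mu]_y `|(F (y, x))%:E|).
  apply: eq_integral => x _; apply: ae_eq_integralT; try exact: measurableT_comp.
  by apply: ae_mono (Fx x) => y ->.
transitivity (\int[mu]_y \int[mu]_x `|(F (y, x))%:E|).
  rewrite (fubini_tonelli (m1 := mu) (m2 := mu) (fun p => `|(F p)%:E|))//.
  by apply: measurableT_comp => //; exact/measurable_EFinP.
apply: eq_integral => y _; apply: ae_eq_integralT; try exact: measurableT_comp.
by apply: ae_mono (Fy y) => x ->.
Qed.

Lemma measurable_kernel_integral_abs :
  measurable_fun setT (fun x : borel G => \int[mu]_y `|(kernel f g k y x)%:E|).
Proof.
have [F [mF Fy Fx]] := kernel_version mf mg mk; have [m1 m2] := sec mF.
rewrite (_ : (fun x => _) = fun x : borel G => \int[mu]_y `|(F (y, x))%:E|).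
  apply: (measurable_fun_fubini_tonelli_G (m1 := mu) (fun p => `|(F p)%:E|)) => //.
  by apply: measurableT_comp => //; exact/measurable_EFinP.
apply/funext => x; apply: ae_eq_integralT; try exact: measurableT_comp.
by apply: ae_mono (Fx x) => y ->.
Qed.

Lemma measurable_kernel_integral_absr :
  measurable_fun setT (fun y : borel G => \int[mu]_x `|(kernel f g k y x)%:E|).
Proof.
have [F [mF Fy Fx]] := kernel_version mf mg mk; have [m1 m2] := sec mF.
rewrite (_ : (fun y => _) = fun y : borel G => \int[mu]_x `|(F (y, x))%:E|).
  apply: (measurable_fun_fubini_tonelli_F (m2 := mu) (fun p => `|(F p)%:E|)) => //.
  by apply: measurableT_comp => //; exact/measurable_EFinP.
apply/funext => y; apply: ae_eq_integralT; try exact: measurableT_comp.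
by apply: ae_mono (Fy y) => x ->.
Qed.

Lemma measurable_kernel_integral :
  measurable_fun setT (fun x : borel G => \int[mu]_y (kernel f g k y x)%:E).
Proof.
have [F [mF Fy Fx]] := kernel_version mf mg mk; have [m1 m2] := sec mF.
rewrite (_ : (fun x => _) = fun x : borel G => \int[mu]_y (F (y, x))%:E).
  rewrite (_ : (fun x => _) = (fun x => \int[mu]_y (EFin \o F)^\+ (y, x)) \-
      (fun x => \int[mu]_y (EFin \o F)^\- (y, x))).
    apply: emeasurable_funB.
      apply: (measurable_fun_fubini_tonelli_G (m1 := mu) (EFin \o F)^\+) => //.
      by apply: measurable_funepos; exact/measurable_EFinP.
    apply: (measurable_fun_fubini_tonelli_G (m1 := mu) (EFin \o F)^\-) => //.
    by apply: measurable_funeneg; exact/measurable_EFinP.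
  apply/funext => x; rewrite [LHS]integralE; congr (_ - _); apply: eq_integral => y _;
    by rewrite ?funeposE ?funenegE.
apply/funext => x; apply: ae_eq_integralT => //.
by apply: ae_mono (Fx x) => y ->.
Qed.

Hypothesis fin : \int[mu]_y \int[mu]_x `|(kernel f g k y x)%:E| < +oo.

Lemma ae_integrable_kernel :
  {ae mu, forall x, mu.-integrable setT (fun y => (kernel f g k y x)%:E)}.
Proof.
have i : mu.-integrable setT (fun x => \int[mu]_y `|(kernel f g k y x)%:E|).
  apply/integrableP; split; first exact: measurable_kernel_integral_abs.
  under eq_integral do rewrite gee0_abs ?integral_ge0//.
  by rewrite kernel_tonelli.
have := integrable_ae measurableT i; apply: ae_mono => x /(_ I).
rewrite ge0_fin_numE ?integral_ge0// => lt; apply/integrableP; split => //.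
Qed.

Lemma kernel_fubini :
  \int[mu]_x \int[mu]_y (kernel f g k y x)%:E =
  \int[mu]_y \int[mu]_x (kernel f g k y x)%:E.
Proof.
have [F [mF Fy Fx]] := kernel_version mf mg mk; have [m1 m2] := sec mF.
transitivity (\int[mu]_x \int[mu]_y (F (y, x))%:E).
  apply: eq_integral => x _; apply: ae_eq_integralT => //.
  by apply: ae_mono (Fx x) => y ->.
transitivity (\int[mu]_y \int[mu]_x (F (y, x))%:E).
  rewrite -(Fubini (m1 := mu) (m2 := mu) (f := EFin \o F))//.
  apply/integrable12ltyP; first exact/measurable_EFinP.
  rewrite (_ : (\int[mu]_x _) = \int[mu]_y \int[mu]_x `|(kernel f g k y x)%:E|)//.
  apply: eq_integral => y _; apply: ae_eq_integralT; try exact: measurableT_comp.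
    exact: (measurableT_comp _ (m1 y)).
  by apply: ae_mono (Fy y) => x ->.
apply: eq_integral => y _; apply: ae_eq_integralT => //.
by apply: ae_mono (Fy y) => x ->.
Qed.

End KernelIntegrals.

End Kernel.

(** * Integrable functions and their convolution *)

Section Conv.
Variables (R : realType) (G : topologicalGroupType) (K : nat -> set G).
Variable mu : {sigma_finite_measure set (borel G) -> \bar R}.
Hypotheses (hK : locally_elliptic K) (hmu : left_haar mu).
Implicit Types f g h k : borel G -> R.

Definition L1 f := mu.-integrable setT (EFin \o f).
Definition norm1 f : R := \int[mu]_x `|f x|.
Definition conv f g : borel G -> R :=
  fun x => \int[mu]_y (f y * g ((y : G)^-1 * x)%g).

Lemma conv0l f : conv (fun=> 0) f = fun=> 0.
Proof.
apply/funext => x; rewrite /conv; under eq_Rintegral do rewrite mul0r.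
by rewrite /Rintegral integral0.
Qed.

Lemma conv0r f : conv f (fun=> 0) = fun=> 0.
Proof.
apply/funext => x; rewrite /conv; under eq_Rintegral do rewrite mulr0.
by rewrite /Rintegral integral0.
Qed.

Lemma norm1_0 : norm1 (fun=> 0) = 0.
Proof.
by rewrite /norm1; under eq_Rintegral do rewrite normr0; rewrite /Rintegral integral0.
Qed.

Lemma L1_measurable f : L1 f -> measurable_fun setT f.
Proof. by move=> /integrableP[/measurable_EFinP]. Qed.

Lemma L1P f : measurable_fun setT f -> (\int[mu]_x `|(f x)%:E| < +oo)%E -> L1 f.
Proof. by move=> mf ffin; apply/integrableP; split => //; exact/measurable_EFinP. Qed.

Lemma L1_fin f : L1 f -> (\int[mu]_x `|(f x)%:E| < +oo)%E.
Proof. by move=> /integrableP[]. Qed.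

Lemma norm1E f : L1 f -> ((norm1 f)%:E = \int[mu]_x `|(f x)%:E|)%E.
Proof.
move=> Lf; rewrite /norm1 /Rintegral fineK//.
by rewrite ge0_fin_numE ?L1_fin// integral_ge0.
Qed.

Lemma norm1_ge0 f : 0 <= norm1 f.
Proof. exact: Rintegral_ge0. Qed.

Lemma RintegralE f : L1 f -> ((\int[mu]_x f x)%:E = \int[mu]_x (f x)%:E)%E.
Proof. by move=> Lf; rewrite fineK//; exact: integrable_fin_num. Qed.

Lemma L1D f g : L1 f -> L1 g -> L1 (fun x => f x + g x).
Proof. by move=> Lf Lg; exact: (integrableD measurableT Lf Lg). Qed.

Lemma L1B f g : L1 f -> L1 g -> L1 (fun x => f x - g x).
Proof. by move=> Lf Lg; exact: (integrableB measurableT Lf Lg). Qed.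

Lemma L1Z (c : R) f : L1 f -> L1 (fun x => c * f x).
Proof. by move=> Lf; exact: (integrableZl measurableT c Lf). Qed.

Lemma L1_dominated f g : measurable_fun setT f -> (forall x, `|f x| <= g x) -> L1 g -> L1 f.
Proof.
move=> mf fg; apply: le_integrable => //; first exact/measurable_EFinP.
by move=> x _ /=; rewrite lee_fin (le_trans (fg x))// ler_norm.
Qed.

Lemma L1_abs f : L1 f -> L1 (fun x => `|f x|).
Proof.
move=> Lf; apply: L1P; last by move: (L1_fin Lf); under eq_integral do rewrite -abse_id.
exact: measurableT_comp (L1_measurable Lf).
Qed.

Lemma L1_bounded b f k : L1 f -> measurable_fun setT k -> (forall x, `|k x| <= b) ->
  L1 (fun x => f x * k x).
Proof.
move=> Lf mk kb; apply: (L1_dominated (g := fun x => b * `|f x|)).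
- by apply: measurable_funM => //; exact: L1_measurable.
- by move=> x; rewrite normrM mulrC ler_wpM2r.
- by apply: L1Z; exact: L1_abs.
Qed.

Lemma L1_ae f g : measurable_fun setT g -> {ae mu, forall x, f x = g x} -> L1 f -> L1 g.
Proof.
move=> mg fg; apply: ae_eq_integrableT; first exact/measurable_EFinP.
by apply: ae_mono fg => x /= ->.
Qed.

Lemma norm1_eq0 f : L1 f -> norm1 f = 0 -> {ae mu, forall x, f x = 0}.
Proof.
move=> Lf f0; have := norm1E Lf; rewrite f0 => /esym i0.
have /measurable_EFinP mf := L1_measurable Lf.
have /(_ i0) := (ae_eq_integral_abs mu measurableT mf).1.
by apply: ae_mono => x /(_ I) /= [].
Qed.

Lemma measurable_conv f g : measurable_fun setT f -> measurable_fun setT g ->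
  measurable_fun setT (conv f g).
Proof.
move=> mf mg; apply: (measurableT_comp (f := fine)) => //.
have := measurable_kernel_integral hK hmu mf mg (measurable_cst (1 : R)).
rewrite (_ : (fun x : borel G => _) = (fun x : borel G => (\int[mu]_y (f y * g ((y : G)^-1 * x)%g)%:E)%E))//.
by apply/funext => x; apply: eq_integral => y _; rewrite /kernel mulr1.
Qed.

Lemma conv_ae f f' g g' : measurable_fun setT f -> measurable_fun setT g ->
  measurable_fun setT f' -> measurable_fun setT g' ->
  {ae mu, forall x, f x = f' x} -> {ae mu, forall x, g x = g' x} ->
  conv f g = conv f' g'.
Proof.
move=> mf mg mf' mg' ff' gg'; apply/funext => x; apply: ae_eq_RintegralT.
- by apply: measurable_funM => //; exact: (measurable_reflect hK hmu).
- by apply: measurable_funM => //; exact: (measurable_reflect hK hmu).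
- apply: ae_mono2 ff' (measure_preserving_ae (measure_preserving_divgl hK hmu x) gg').
  by move=> y -> ->.
Qed.

Section WeightBound.
Variables (f g k c : borel G -> R).
Hypotheses (mf : measurable_fun setT f) (mg : measurable_fun setT g).
Hypothesis mk : measurable_fun setT k.
Hypothesis gkc : forall y : G, (\int[mu]_x `|(g x * k (y * x)%g)%:E| <= (c y)%:E)%E.
Hypothesis fc : L1 (fun y => f y * c y).

Lemma weight_bound_ge0 y : 0 <= c y.
Proof. by rewrite -lee_fin; apply: le_trans (gkc y); exact: integral_ge0. Qed.

Lemma kernel_weight_le : (\int[mu]_y \int[mu]_x `|(kernel f g k y x)%:E| <=
  (norm1 (fun y => f y * c y)%R)%:E)%E.
Proof.
rewrite norm1E//; apply: ge0_le_integral => //.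
- by move=> y _; exact: integral_ge0.
- exact: (measurable_kernel_integral_absr hK hmu).
- by apply: measurableT_comp => //; exact: (measurable_int mu fc).
move=> y _; rewrite (_ : (\int[mu]_x _ = `|(f y)%:E| * \int[mu]_x `|(g x * k (y * x)%g)%:E|)%E).
  rewrite EFinM abseM [X in (_ <= _ * X)%E]gee0_abs ?lee_fin ?weight_bound_ge0//.
  exact: lee_wpmul2l.
have mgk : measurable_fun setT (fun x : borel G => `|(g x * k (y * x)%g)%:E|%E).
  apply: measurableT_comp => //; apply/measurable_EFinP; apply: measurable_funM => //.
  exact: measurable_translate.
rewrite -(measure_preserving_integral (measure_preserving_mulgl hmu y^-1%g) mgk).
rewrite -ge0_integralZl//.
- apply: eq_integral => x _; rewrite /kernel mulVKg -abseM -EFinM; congr (`|_%:E|)%E.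
  by rewrite mulrA.
- exact: (measurableT_comp mgk (measurable_mulgl y^-1%g)).
Qed.

Lemma kernel_weight_fin : (\int[mu]_y \int[mu]_x `|(kernel f g k y x)%:E| < +oo)%E.
Proof. by apply: le_lt_trans kernel_weight_le _; rewrite ltry. Qed.

(** Tonelli's theorem and the substitution of y x for x. With k = 1 this gives the
    submultiplicativity of the L1 norm; with k a weight it is where the growth of
    k along products enters, through c. *)
Lemma conv_weight : L1 (fun x => conv f g x * k x) /\
  norm1 (fun x => conv f g x * k x) <= norm1 (fun y => f y * c y).
Proof.
have mc : measurable_fun setT (fun x => conv f g x * k x).
  by apply: measurable_funM => //; exact: measurable_conv.
have le : (\int[mu]_x `|(conv f g x * k x)%:E| <= (norm1 (fun y => f y * c y)%R)%:E)%E.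
  apply: le_trans kernel_weight_le; rewrite -(kernel_tonelli hK hmu)//.
  apply: ge0_le_integral => //.
  - by apply: measurableT_comp => //; exact/measurable_EFinP.
  - exact: (measurable_kernel_integral_abs hK hmu).
  move=> x _.
  have mfg : measurable_fun setT (fun y : borel G => (f y * g ((y : G)^-1 * x)%g)%:E).
    apply/measurable_EFinP; apply: measurable_funM => //.
    exact: (measurable_reflect hK hmu).
  rewrite (_ : (\int[mu]_y _ = (\int[mu]_y `|(f y * g ((y : G)^-1 * x)%g)%:E|) * `|(k x)%:E|)%E).
    rewrite EFinM abseM lee_wpmul2r//.
    apply: le_trans (abse_fine_le _) _.
    exact: le_abse_integral.
  rewrite -ge0_integralZr//; last exact: measurableT_comp.
  by apply: eq_integral => y _; rewrite /kernel EFinM abseM.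
have Lc : L1 (fun x => conv f g x * k x).
  by apply: L1P => //; apply: le_lt_trans le _; rewrite ltry.
by split => //; rewrite -lee_fin norm1E.
Qed.

End WeightBound.

Lemma conv_L1 f g : L1 f -> L1 g -> L1 (conv f g) /\ norm1 (conv f g) <= norm1 f * norm1 g.
Proof.
move=> Lf Lg; have [mf mg] := (L1_measurable Lf, L1_measurable Lg).
have m1 : measurable_fun setT (cst 1 : borel G -> R) by exact: measurable_cst.
have H (y : G) : (\int[mu]_x `|(g x * cst 1 (y * x)%g)%:E| <= (cst (norm1 g) y)%:E)%E.
  by rewrite norm1E//; under eq_integral do rewrite mulr1.
have Lfc : L1 (fun y => f y * cst (norm1 g) y).
  by apply: (L1_bounded (b := `|norm1 g|)).
have [] := conv_weight mf mg m1 H Lfc.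
rewrite (_ : (fun x => conv f g x * cst 1 x) = conv f g); last first.
  by apply/funext => x; rewrite mulr1.
move=> Lfg le; split => //; apply: (le_trans le).
rewrite [in leLHS]/norm1.
under eq_Rintegral do rewrite normrM /= (ger0_norm (norm1_ge0 g))//.
by rewrite RintegralZr//; exact: L1_abs.
Qed.

(** The transpose of f |-> conv f g. Identities between convolutions hold almost
    everywhere and are checked by pairing with bounded functions k, on which the
    transposes compose without exceptional points. *)
Definition dual g k : borel G -> R := fun y => \int[mu]_x (g ((y : G)^-1 * x)%g * k x).

Lemma dualE g k : dual g k = conv k (fun x : G => g x^-1%g).
Proof.
apply/funext => y; apply: eq_Rintegral => x _.
by rewrite invgM invgK mulrC.
Qed.

Lemma measurable_dual g k : measurable_fun setT g -> measurable_fun setT k ->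
  measurable_fun setT (dual g k).
Proof.
move=> mg mk; rewrite dualE; apply: measurable_conv => //.
exact: (measurableT_comp mg (@measurable_invg G)).
Qed.

Lemma L1_translate g (y : G) : L1 g -> L1 (fun x : G => g (y * x)%g).
Proof. exact: measure_preserving_integrable (measure_preserving_mulgl hmu y). Qed.

Lemma L1_dual g k (b : R) y : L1 g -> measurable_fun setT k -> (forall x, `|k x| <= b) ->
  L1 (fun x : G => g (y^-1 * x)%g * k x).
Proof. by move=> Lg mk kb; apply: (L1_bounded (b := b)) => //; exact: L1_translate. Qed.

Lemma norm1_translate g (y : G) : measurable_fun setT g ->
  norm1 (fun x : G => g (y * x)%g) = norm1 g.
Proof.
move=> mg; apply: (measure_preserving_Rintegral (f := fun x => `|g x|) (measure_preserving_mulgl hmu y)).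
exact: measurableT_comp.
Qed.

Lemma Rintegral_le_norm1 f : L1 f -> `|\int[mu]_x f x| <= norm1 f.
Proof. by move=> Lf; exact: le_normr_Rintegral. Qed.

Lemma norm1_le f g : L1 f -> L1 g -> (forall x, `|f x| <= g x) -> norm1 f <= \int[mu]_x g x.
Proof. by move=> Lf Lg fg; apply: le_Rintegral => //; exact: L1_abs. Qed.

Lemma dual_le g k (b : R) y : L1 g -> measurable_fun setT k -> (forall x, `|k x| <= b) ->
  `|dual g k y| <= b * norm1 g.
Proof.
move=> Lg mk kb; apply: (le_trans (Rintegral_le_norm1 (L1_dual y Lg mk kb))).
rewrite -(norm1_translate y^-1%g (L1_measurable Lg)) /norm1 -RintegralZl//; last first.
  by apply: L1_abs; exact: L1_translate.
apply: norm1_le; first exact: L1_dual Lg mk kb.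
  by apply: L1Z; apply: L1_abs; exact: L1_translate.
by move=> x; rewrite normrM mulrC ler_wpM2r.
Qed.

Lemma kernel_bounded_fin f g k (b : R) : L1 f -> L1 g -> measurable_fun setT k ->
  (forall x, `|k x| <= b) ->
  (\int[mu]_y \int[mu]_x `|(kernel f g k y x)%:E| < +oo)%E.
Proof.
move=> Lf Lg mk kb; have [mf mg] := (L1_measurable Lf, L1_measurable Lg).
have b0 : 0 <= b by apply: le_trans (kb 1%g).
apply: (kernel_weight_fin (c := cst (b * norm1 g))) => //.
  move=> y; have Lk : L1 (fun x => b * `|g x|) by apply: L1Z; exact: L1_abs.
  have -> : (cst (b * norm1 g) y)%:E = (\int[mu]_x (b * `|g x|)%:E)%E.
    by rewrite -RintegralE// RintegralZl//; exact: L1_abs.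
  apply: ge0_le_integral => //.
  - apply: measurableT_comp => //; apply/measurable_EFinP; apply: measurable_funM => //.
    exact: measurable_translate.
  - exact: (measurable_int mu Lk).
  - move=> x _; rewrite abse_EFin lee_fin normrM mulrC.
    by rewrite ler_wpM2r.
by apply: (L1_bounded (b := b * norm1 g)) => // x; rewrite ger0_norm// mulr_ge0// norm1_ge0.
Qed.

Lemma ae_L1_kernel f g : L1 f -> L1 g ->
  {ae mu, forall x, L1 (fun y => f y * g ((y : G)^-1 * x)%g)}.
Proof.
move=> Lf Lg; have [mf mg] := (L1_measurable Lf, L1_measurable Lg).
have m1 : measurable_fun setT (cst 1 : borel G -> R) by exact: measurable_cst.
have := ae_integrable_kernel hK hmu mf mg m1.
have fin : (\int[mu]_y \int[mu]_x `|(kernel f g (cst 1) y x)%:E| < +oo)%E.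
  by apply: (kernel_bounded_fin (b := 1)) => // x; rewrite normr1.
move=> /(_ fin); apply: ae_mono => x; apply: eq_integrable => // y _.
by rewrite /kernel /= mulr1.
Qed.

Lemma conv_dual f g k (b : R) : L1 f -> L1 g -> measurable_fun setT k ->
  (forall x, `|k x| <= b) ->
  \int[mu]_x (conv f g x * k x) = \int[mu]_y (f y * dual g k y).
Proof.
move=> Lf Lg mk kb; have [mf mg] := (L1_measurable Lf, L1_measurable Lg).
rewrite /Rintegral; congr fine.
transitivity (\int[mu]_x \int[mu]_y (kernel f g k y x)%:E)%E.
  apply: ae_eq_integralT.
  - apply/measurable_EFinP; apply: measurable_funM => //; exact: measurable_conv.
  - exact: (measurable_kernel_integral hK hmu).
  - apply: ae_mono (ae_L1_kernel Lf Lg) => x Lx.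
    by rewrite EFinM /conv RintegralE// -integralZr.
rewrite (kernel_fubini hK hmu)//; last exact: kernel_bounded_fin Lf Lg mk kb.
apply: eq_integral => y _; rewrite EFinM /dual RintegralE//; last exact: L1_dual Lg mk kb.
rewrite -integralZl//; last exact: L1_dual Lg mk kb.
by apply: eq_integral => x _; rewrite /kernel -mulrA.
Qed.

End Conv.

(** * The convolution algebra and its action on square-integrable functions *)

Section ConvAlgebra.
Variables (R : realType) (G : topologicalGroupType) (K : nat -> set G).
Variable mu : {sigma_finite_measure set (borel G) -> \bar R}.
Hypotheses (hK : locally_elliptic K) (hmu : left_haar mu).
Implicit Types f g h k : borel G -> R.
Local Notation L1 := (L1 mu).
Local Notation norm1 := (norm1 mu).
Local Notation conv := (conv mu).
Local Notation dual := (dual mu).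

(** Indicator functions of measurable sets are among the test functions. *)
Lemma ae_eq_dual f g : L1 f -> L1 g ->
  (forall k, measurable_fun setT k -> (forall x, `|k x| <= 1) ->
    \int[mu]_x (f x * k x) = \int[mu]_x (g x * k x)) ->
  {ae mu, forall x, f x = g x}.
Proof.
move=> Lf Lg fg.
have : ae_eq mu setT (EFin \o f) (EFin \o g).
  apply: integral_ae_eq => //; first exact: (measurable_int mu Lg).
  move=> E _ mE.
  have mE1 : measurable_fun setT (\1_E : borel G -> R) by exact: measurable_indic.
  have E1 x : `|\1_E x| <= 1 :> R.
    by rewrite indicE ger0_norm// lern1; case: (_ \in _).
  have eqE f' : L1 f' -> (\int[mu]_(x in E) (EFin \o f') x = (\int[mu]_x (f' x * \1_E x))%:E)%E.
    move=> Lf'; rewrite RintegralE; last exact: (L1_bounded (b := 1)).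
    rewrite integral_mkcond; apply: eq_integral => x _.
    by rewrite patchE indicE; case: ifPn => _; rewrite ?mulr1 ?mulr0.
  by rewrite !eqE// fg.
by apply: ae_mono => x /(_ I) [].
Qed.

Lemma conv_dual1 f g k : L1 f -> L1 g -> measurable_fun setT k -> (forall x, `|k x| <= 1) ->
  \int[mu]_x (conv f g x * k x) = \int[mu]_y (f y * dual g k y).
Proof. exact: (conv_dual hK hmu). Qed.

Lemma L1_conv f g : L1 f -> L1 g -> L1 (conv f g).
Proof. by move=> Lf Lg; have [] := conv_L1 hK hmu Lf Lg. Qed.

Lemma norm1_conv f g : L1 f -> L1 g -> norm1 (conv f g) <= norm1 f * norm1 g.
Proof. by move=> Lf Lg; have [] := conv_L1 hK hmu Lf Lg. Qed.

Lemma L1_mul_dual f g k (b : R) : L1 f -> L1 g -> measurable_fun setT k ->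
  (forall x, `|k x| <= b) -> L1 (fun y => f y * dual g k y).
Proof.
move=> Lf Lg mk kb; apply: (L1_bounded (b := b * norm1 g)) => //.
  by apply: (measurable_dual hK hmu) => //; exact: L1_measurable Lg.
by move=> x; exact: dual_le.
Qed.

Lemma dual_conv g h k (b : R) : L1 g -> L1 h -> measurable_fun setT k ->
  (forall x, `|k x| <= b) -> dual (conv g h) k = dual g (dual h k).
Proof.
move=> Lg Lh mk kb; apply/funext => y; rewrite /dual.
have mgh := L1_measurable (L1_conv Lg Lh).
have mky : measurable_fun setT (fun x : borel G => k (y * x)%g) by exact: measurable_translate.
have mdk : measurable_fun setT (dual h k).
  by apply: (measurable_dual hK hmu) => //; exact: L1_measurable Lh.
transitivity (\int[mu]_x (conv g h x * k (y * x)%g)).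
  rewrite -(measure_preserving_Rintegral (f := fun x : borel G => conv g h x * k (y * x)%g) (measure_preserving_mulgl hmu y^-1%g)).
    by apply: eq_Rintegral => x _; rewrite mulVKg.
  exact: measurable_funM.
rewrite (conv_dual hK hmu (b := b))//.
transitivity (\int[mu]_z (g z * dual h k (y * z)%g)).
  apply: eq_Rintegral => z _; congr (_ * _); rewrite /dual.
  rewrite -(measure_preserving_Rintegral (f := fun x : borel G => h ((z : G)^-1 * x)%g * k (y * x)%g) (measure_preserving_mulgl hmu y^-1%g)).
    by apply: eq_Rintegral => x _; rewrite mulVKg invgM mulgA.
  apply: measurable_funM => //.
  by apply: (measurable_translate (g := h)); exact: L1_measurable Lh.
rewrite -(measure_preserving_Rintegral (f := fun z : borel G => g z * dual h k (y * z)%g) (measure_preserving_mulgl hmu y^-1%g)).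
  by apply: eq_Rintegral => x _; rewrite mulVKg.
apply: measurable_funM; first exact: L1_measurable Lg.
exact: (measurable_translate (g := dual h k)).
Qed.

(** Both sides pair with k to the integral of f times dual g (dual h k). *)
Lemma convA f g h : L1 f -> L1 g -> L1 h ->
  {ae mu, forall x, conv (conv f g) h x = conv f (conv g h) x}.
Proof.
move=> Lf Lg Lh; have Lfg := L1_conv Lf Lg; have Lgh := L1_conv Lg Lh.
apply: ae_eq_dual; [exact: L1_conv|exact: L1_conv|] => k mk k1.
rewrite [LHS]conv_dual1// [RHS]conv_dual1// (conv_dual hK hmu (b := 1 * norm1 h))//.
- by apply: eq_Rintegral => y _; rewrite (dual_conv (b := 1)).
- by apply: (measurable_dual hK hmu) => //; exact: L1_measurable Lh.
- by move=> x; exact: dual_le.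
Qed.

Lemma convDl f f' g : L1 f -> L1 f' -> L1 g ->
  {ae mu, forall x, conv (fun y => f y + f' y) g x = conv f g x + conv f' g x}.
Proof.
move=> Lf Lf' Lg; have LD := L1D Lf Lf'.
have LDc : L1 (fun x => conv f g x + conv f' g x) by apply: L1D; exact: L1_conv.
apply: ae_eq_dual => //; first exact: L1_conv.
move=> k mk k1; rewrite conv_dual1//.
under eq_Rintegral do rewrite mulrDl.
under [RHS]eq_Rintegral do rewrite mulrDl.
rewrite !RintegralD//; first by rewrite !conv_dual1.
all: try exact: (L1_mul_dual (b := 1)).
all: by apply: (L1_bounded (b := 1)) => //; exact: L1_conv.
Qed.

Lemma convDr f g g' : L1 f -> L1 g -> L1 g' ->
  {ae mu, forall x, conv f (fun y => g y + g' y) x = conv f g x + conv f g' x}.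
Proof.
move=> Lf Lg Lg'; have LD := L1D Lg Lg'.
have LDc : L1 (fun x => conv f g x + conv f g' x) by apply: L1D; exact: L1_conv.
apply: ae_eq_dual => //; first exact: L1_conv.
move=> k mk k1; rewrite conv_dual1//.
have E y : f y * dual (fun y => g y + g' y) k y = f y * dual g k y + f y * dual g' k y.
  rewrite -mulrDr /dual -RintegralD//; try exact: (L1_dual hmu (b := 1)).
  by congr (_ * _); apply: eq_Rintegral => x _; rewrite mulrDl.
under eq_Rintegral do rewrite E.
under [RHS]eq_Rintegral do rewrite mulrDl.
rewrite !RintegralD//; first by rewrite !conv_dual1.
all: try exact: (L1_mul_dual (b := 1)).
all: by apply: (L1_bounded (b := 1)) => //; exact: L1_conv.
Qed.

Lemma convZl (c : R) f g : L1 f -> L1 g ->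
  {ae mu, forall x, conv (fun y => c * f y) g x = c * conv f g x}.
Proof.
move=> Lf Lg; apply: ae_mono (ae_L1_kernel hK hmu Lf Lg) => x Lx.
by rewrite /conv -RintegralZl//; apply: eq_Rintegral => y _; rewrite mulrA.
Qed.

Lemma convZr (c : R) f g : L1 f -> L1 g ->
  {ae mu, forall x, conv f (fun y => c * g y) x = c * conv f g x}.
Proof.
move=> Lf Lg; apply: ae_mono (ae_L1_kernel hK hmu Lf Lg) => x Lx.
by rewrite /conv -RintegralZl//; apply: eq_Rintegral => y _; rewrite mulrCA.
Qed.

Lemma conv_bounded f g (b : R) x : L1 f -> measurable_fun setT g ->
  (forall y, `|g y| <= b) -> `|conv f g x| <= b * norm1 f.
Proof.
move=> Lf mg gb.
have L : L1 (fun y => f y * g ((y : G)^-1 * x)%g).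
  by apply: (L1_bounded (b := b)) => //; exact: (measurable_reflect hK hmu).
apply: (le_trans (Rintegral_le_norm1 L)).
rewrite /norm1 -RintegralZl//; last exact: L1_abs.
apply: norm1_le => //; first by apply: L1Z; exact: L1_abs.
by move=> y; rewrite normrM mulrC ler_wpM2r.
Qed.

Definition reflect f : borel G -> R := fun x : G => f x^-1%g.

Lemma L1_reflect f : L1 f -> L1 (reflect f).
Proof. exact: measure_preserving_integrable (measure_preserving_invg hK hmu). Qed.

Lemma Rintegral_reflect f : measurable_fun setT f ->
  \int[mu]_x reflect f x = \int[mu]_x f x.
Proof. exact: measure_preserving_Rintegral (measure_preserving_invg hK hmu). Qed.

(** Because the measure is invariant under inversion, the transpose of convolution
    by f is convolution by its reflection. This is what makes self-adjoint functions
    act as self-adjoint operators on square-integrable ones. *)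
Lemma conv_adjoint f b c (B : R) : L1 f -> L1 b -> L1 c ->
  (forall x, `|b x| <= B) -> (forall x, `|c x| <= B) ->
  \int[mu]_x (conv f b x * c x) = \int[mu]_x (b x * conv (reflect f) c x).
Proof.
move=> Lf Lb Lc bB cB; have [mb mc] := (L1_measurable Lb, L1_measurable Lc).
rewrite (conv_dual hK hmu (b := B))//.
under [RHS]eq_Rintegral do rewrite mulrC.
rewrite (conv_dual hK hmu (b := B))//; last exact: L1_reflect.
rewrite -[RHS]Rintegral_reflect; last first.
  apply: measurable_funM; first exact: L1_measurable (L1_reflect Lf).
  by apply: (measurable_dual hK hmu).
apply: eq_Rintegral => y _; rewrite /reflect invgK; congr (_ * _).
rewrite /dual -(measure_preserving_Rintegral (f := fun x : borel G => c (((y : G)^-1)^-1 * x)%g * b x) (measure_preserving_mulgl hmu y^-1%g)).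
  by apply: eq_Rintegral => x _; rewrite invgK mulVKg mulrC.
by apply: measurable_funM => //; exact: measurable_translate.
Qed.

Lemma L1_sq b (B : R) : L1 b -> (forall x, `|b x| <= B) -> L1 (fun x => b x ^+ 2).
Proof.
move=> Lb bB; have := L1_bounded (b := B) Lb (L1_measurable Lb) bB.
by apply: eq_integrable => // x _; rewrite /= expr2.
Qed.

(** Young's inequality for an integrable and a square-integrable function, in a
    bilinear form without square roots: it follows from 2 p q <= p^2 + q^2 under
    the integral that defines dual b c. *)
Lemma conv_young f b c (B : R) : L1 f -> L1 b -> L1 c ->
  (forall x, `|b x| <= B) -> (forall x, `|c x| <= B) ->
  2 * \int[mu]_x (conv f b x * c x) <=
  norm1 f * (\int[mu]_x (b x ^+ 2) + \int[mu]_x (c x ^+ 2)).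
Proof.
move=> Lf Lb Lc bB cB; have [mb mc] := (L1_measurable Lb, L1_measurable Lc).
have [Lb2 Lc2] := (L1_sq Lb bB, L1_sq Lc cB).
rewrite (conv_dual hK hmu (b := B))//.
set S := _ + _.
have dS y : 2 * `|dual b c y| <= S.
  have L := L1_dual hmu y Lb mc cB.
  have Ly : L1 (fun x : G => b (y^-1 * x)%g ^+ 2).
    exact: (L1_translate hmu y^-1%g Lb2).
  have -> : S = \int[mu]_x (b ((y : G)^-1 * x)%g ^+ 2 + c x ^+ 2).
    rewrite RintegralD// /S; congr (_ + _).
    rewrite -(measure_preserving_Rintegral (f := fun x => b x ^+ 2) (measure_preserving_mulgl hmu y^-1%g))//.
    exact: L1_measurable Lb2.
  rewrite -[2](normr_nat R 2) -normrM /dual -RintegralZl//.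
  apply: (le_trans (Rintegral_le_norm1 (L1Z 2 L))).
  apply: norm1_le; [exact: L1Z|exact: L1D|] => x.
  set p := b _; set q := c x.
  rewrite ler_norml; apply/andP; split; rewrite -subr_ge0.
    have := sqr_ge0 (p + q); nra.
  have := sqr_ge0 (p - q); nra.
rewrite -RintegralZl//; last exact: L1_mul_dual mc cB.
rewrite mulrC /norm1 -RintegralZl//; last exact: L1_abs.
apply: le_Rintegral => //.
- by apply: L1Z; exact: L1_mul_dual mc cB.
- by apply: L1Z; exact: L1_abs.
move=> y _; apply: (le_trans (ler_norm _)).
rewrite !normrM normr_nat mulrCA mulrC; exact: ler_wpM2r.
Qed.

End ConvAlgebra.

(** * Decay of the powers of an L2 contraction *)

(** Here n1 and nw stand for the L1 norm and the weighted norm, J for the ideal of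
    bounded functions and E for the square of the L2 norm. The interpolation
    hypothesis is obtained by cutting the integral of |b| at the level s of the
    weight; S acts on J as a strict contraction for the L2 norm, and differs from an
    element of J by less than 1. *)
Section GrowthRate.
Variables (R : realType) (A : pzRingType) (n1 nw : A -> R).
Hypothesis n1_ge0 : forall x, 0 <= n1 x.
Hypothesis n1D : forall x y, n1 (x + y) <= n1 x + n1 y.
Hypothesis n1M : forall x y, n1 (x * y) <= n1 x * n1 y.
Hypothesis n1_le_nw : forall x, n1 x <= nw x.
Hypothesis nwM : forall x y, nw (x * y) <= nw x * n1 y + n1 x * nw y.

Variables (J : A -> Prop) (E : A -> R) (C0 : R) (P : nat).
Hypothesis E_ge0 : forall b, 0 <= E b.
Hypothesis C0_ge0 : 0 <= C0.
Hypothesis interpolation : forall b th s, J b -> 0 < th -> 1 <= s ->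
  n1 b <= th * C0 * s ^+ P + E b / th + nw b / s.

Variables (S g : A) (q : R).
Hypotheses (q_gt0 : 0 < q) (q_lt1 : q < 1).
Hypothesis SJ : forall b, J b -> J (S * b) /\ E (S * b) <= q ^+ 2 * E b.
Hypotheses (Jg : J g) (n1Sg : n1 (S - g) < 1).

Let nw_ge0 x : 0 <= nw x. Proof. exact: le_trans (n1_le_nw x). Qed.

Lemma nwM2 x y : nw (x * y) <= 2 * nw x * nw y.
Proof.
apply: (le_trans (nwM x y)).
rewrite (_ : 2 * nw x * nw y = nw x * nw y + nw x * nw y); last by ring.
by apply: lerD; [apply: ler_wpM2l|apply: ler_wpM2r].
Qed.

Lemma J_expr N : J (S ^+ N * g) /\ E (S ^+ N * g) <= (q ^+ N) ^+ 2 * E g.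
Proof.
elim: N => [|N [JN EN]]; first by rewrite !expr0 mul1r expr1n mul1r.
rewrite exprS -mulrA; have [J' E'] := SJ JN; split => //.
apply: (le_trans E'); rewrite [q ^+ N.+1]exprS exprMn -[leRHS]mulrA.
by apply: ler_wpM2l => //; exact: sqr_ge0.
Qed.

Lemma bernoulli_le (h : R) n : 0 <= h -> h <= 1 -> 1 - n%:R * h <= (1 - h) ^+ n.
Proof.
move=> h0 h1; elim: n => [|n IH]; first by rewrite expr0 mul0r subr0.
rewrite exprS; apply: (@le_trans _ _ ((1 - h) * (1 - n%:R * h))).
  have : 0 <= n%:R * h * h by rewrite !mulr_ge0.
  by rewrite -natr1; nra.
by apply: ler_wpM2l => //; rewrite subr_ge0.
Qed.

Lemma contraction_root : exists u, [/\ 0 < u, u < 1 & q <= u ^+ P.+1].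
Proof.
pose h := (1 - q) / P.+1%:R.
have p0 : 0 < P.+1%:R :> R by rewrite ltr0n.
have h0 : 0 < h by rewrite divr_gt0// subr_gt0.
have h1 : h < 1.
  rewrite ltr_pdivrMr// mul1r; apply: (@lt_le_trans _ _ 1); first by rewrite ltrBlDr ltrDl.
  by rewrite ler1n.
exists (1 - h); split; [by lra|by lra|].
apply: le_trans (bernoulli_le _ (ltW h0) (ltW h1)).
by rewrite /h mulrC divfK ?gt_eqF//; lra.
Qed.

(** With th = q ^+ N and s = (u ^+ N)^-1, where q <= u ^+ P.+1, interpolation bounds
    n1 (S ^+ N * g) by a multiple of (u t) ^+ N: the contraction beats the polynomial
    growth. Since n1 (S - g) < 1, n1 (S ^+ N) then has rate e^2 t for some e < 1, and
    splitting S ^+ N.*2 in two halves, one estimated by n1 and the other by nw, gives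
    nw the rate (e^2 t t)^(1/2) = e t. *)
Lemma rate_improvement : exists e, [/\ 0 < e, e < 1 &
  forall t B, 1 <= t -> 0 <= B -> (forall N, nw (S ^+ N) <= B * t ^+ N) ->
  exists2 B', 0 <= B' & forall N, nw (S ^+ N) <= B' * (e * t) ^+ N].
Proof.
have [u [u0 u1 qu]] := contraction_root.
set d := n1 (S - g).
have d0 : 0 <= d by exact: n1_ge0.
pose m := Num.max u d.
have m1 : m < 1 by rewrite gt_max u1.
have m0 : 0 < m by rewrite lt_max u0.
have um : u <= m by rewrite le_max lexx.
have dm : d <= m by rewrite le_max lexx orbT.
pose e := (1 + m) / 2.
have e0 : 0 < e by rewrite /e; lra.
have e1 : e < 1 by rewrite /e; lra.
have em : m < e ^+ 2.
  by rewrite /e expr2; have : 0 < (1 - m) ^+ 2 by [rewrite exprn_gt0// subr_gt0]; rewrite expr2; nra.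
exists e; split => // t B t1 B0 yB.
have t0 : 0 < t by lra.
pose C := C0 + E g + 2 * nw g * B.
have C_ge0 : 0 <= C.
  by rewrite /C !addr_ge0// !mulr_ge0.
have zC N : n1 (S ^+ N * g) <= C * (u * t) ^+ N.
  have [JN EN] := J_expr N.
  have q0 : 0 < q ^+ N by rewrite exprn_gt0.
  have uN0 : 0 < u ^+ N by rewrite exprn_gt0.
  have uN1 : 1 <= (u ^+ N)^-1 by rewrite invf_ge1// exprn_ile1// ltW.
  have tN1 : 1 <= t ^+ N by rewrite exprn_ege1.
  have := interpolation JN q0 uN1; rewrite invrK => /le_trans; apply.
  have qP : q ^+ N * (u ^+ N)^-1 ^+ P <= u ^+ N.
    rewrite -exprVn -exprM mulnC exprM -exprMn.
    have uPq : q * u^-1 ^+ P <= u.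
      by rewrite exprVn ler_pdivrMr ?exprn_gt0// -exprS.
    apply: lerXn2r => //; rewrite nnegrE; last exact: ltW.
    by rewrite mulr_ge0 ?exprn_ge0 ?invr_ge0// ltW.
  have qN : q ^+ N <= u ^+ N.
    apply: lerXn2r; rewrite ?nnegrE ?(ltW q_gt0) ?(ltW u0)//; apply: (le_trans qu).
    by rewrite exprS ler_piMr ?exprn_ile1// ltW.
  have h1 : q ^+ N * C0 * (u ^+ N)^-1 ^+ P <= C0 * u ^+ N.
    by rewrite mulrAC mulrC ler_wpM2l.
  have h2 : E (S ^+ N * g) / q ^+ N <= E g * u ^+ N.
    rewrite ler_pdivrMr//; apply: (le_trans EN).
    rewrite expr2 mulrC !mulrA; apply: ler_wpM2r; first exact: ltW.
    exact: ler_wpM2l.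
  have h3 : nw (S ^+ N * g) * u ^+ N <= 2 * nw g * B * (u * t) ^+ N.
    rewrite exprMn (_ : 2 * nw g * B * _ = 2 * (nw g * (B * t ^+ N)) * u ^+ N); last by ring.
    apply: ler_wpM2r; first exact: ltW.
    apply: (le_trans (nwM2 _ _)); rewrite -mulrA [X in 2 * X]mulrC ler_wpM2l//.
    exact: ler_wpM2l.
  have ut : u ^+ N <= (u * t) ^+ N by rewrite exprMn ler_peMr// ltW.
  have := ler_wpM2l C0_ge0 ut; have := ler_wpM2l (E_ge0 g) ut.
  rewrite /C; lra.
pose c := e ^+ 2.
have ce : d < c by rewrite /c (le_lt_trans dm).
have c0 : 0 < c by rewrite /c exprn_gt0.
pose C' := n1 1 + C / (c - d).
have C'0 : 0 <= C' by rewrite /C' addr_ge0// divr_ge0// subr_ge0 ltW.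
(* S ^+ N.+1 = S ^+ N * g + S ^+ N * (S - g), where n1 (S - g) < c *)
have xC N : n1 (S ^+ N) <= C' * (c * t) ^+ N.
  elim: N => [|N IH].
    by rewrite !expr0 mulr1 /C' lerDl divr_ge0// subr_ge0 ltW.
  have -> : S ^+ N.+1 = S ^+ N * g + S ^+ N * (S - g) by rewrite -mulrDr addrC subrK exprSr.
  apply: (le_trans (n1D _ _)).
  have hz : n1 (S ^+ N * g) <= C * (c * t) ^+ N.
    apply: (le_trans (zC N)); apply: ler_wpM2l => //.
    apply: lerXn2r; rewrite ?nnegrE ?(mulr_ge0 (ltW u0) (ltW t0)) ?(mulr_ge0 (ltW c0) (ltW t0))//.
    apply: ler_wpM2r; first exact: ltW.
    by apply: ltW; apply: (le_lt_trans um).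
  have hx : n1 (S ^+ N * (S - g)) <= C' * (c * t) ^+ N * d.
    by apply: (le_trans (n1M _ _)); apply: ler_wpM2r.
  have p0 : 0 <= (c * t) ^+ N by rewrite exprn_ge0// mulr_ge0// ltW.
  apply: (le_trans (lerD hz hx)).
  rewrite exprS.
  have CC : C + C' * d <= C' * (c * t).
    have : C <= C' * (c - d).
      by rewrite /C' mulrDl divfK ?subr_eq0 ?gt_eqF// lerDr mulr_ge0// subr_ge0 ltW.
    have : C' * c <= C' * (c * t) by rewrite ler_wpM2l// ler_peMr// ltW.
    lra.
  by have := ler_wpM2r p0 CC; lra.
pose B1 := 2 * C' * B.
have B10 : 0 <= B1 by rewrite !mulr_ge0.
have et0 : 0 < e * t by rewrite mulr_gt0.
have even N : nw (S ^+ N.*2) <= B1 * (e * t) ^+ N.*2.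
  rewrite -addnn exprD; apply: (le_trans (nwM _ _)).
  have h : n1 (S ^+ N) * nw (S ^+ N) <= C' * B * (e * t) ^+ (N + N).
    rewrite (_ : C' * B * _ = (C' * (c * t) ^+ N) * (B * t ^+ N)); last first.
      have ec : c ^+ N = e ^+ N * e ^+ N by rewrite /c -exprM mulnC exprM expr2.
      by rewrite exprD [(e * t) ^+ N]exprMn [(c * t) ^+ N]exprMn ec; ring.
    by apply: ler_pM.
  rewrite [X in X + _]mulrC /B1; lra.
pose B2 := 2 * nw S * B1 / (e * t).
have B20 : 0 <= B2 by apply: divr_ge0; [rewrite !mulr_ge0|exact: ltW].
exists (B1 + B2); first exact: addr_ge0.
move=> N; rewrite -[N]odd_double_half; case: (odd N) => /=.
  rewrite add1n exprSr; apply: (le_trans (nwM2 _ _)).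
  have p0 : 0 <= (e * t) ^+ (N./2).*2.+1 by rewrite exprn_ge0// ltW.
  rewrite [leRHS]mulrDl -[leLHS]add0r; apply: lerD; first exact: mulr_ge0.
  rewrite (_ : B2 * _ = 2 * nw S * (B1 * (e * t) ^+ (N./2).*2)); last first.
    by rewrite exprS /B2; field; rewrite !gt_eqF.
  by rewrite mulrAC; apply: ler_wpM2l; [rewrite mulr_ge0|].
rewrite add0n; apply: (le_trans (even _)); rewrite mulrDl lerDl.
by rewrite mulr_ge0// exprn_ge0// ltW.
Qed.

(** Improve the rate of an arbitrary exponential bound until it is below 1. *)
Lemma powers_decay : exists B r, [/\ 0 <= B, 0 < r, r < 1 & forall N, nw (S ^+ N) <= B * r ^+ N].
Proof.
have [e [e0 e1 step]] := rate_improvement.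
pose t := 1 + 2 * nw S.
have t1 : 1 <= t by rewrite lerDl mulr_ge0.
have t0 : 0 < t by lra.
suff H k : (exists B r, [/\ 0 <= B, 0 < r, r < 1 & forall N, nw (S ^+ N) <= B * r ^+ N]) \/
    (exists2 B, 0 <= B & forall N, nw (S ^+ N) <= B * (e ^+ k * t) ^+ N).
  have [k kt] : exists k, e ^+ k * t < 1.
    have ti0 : 0 < t^-1 by rewrite invr_gt0.
    have := @cvg_expr R e; rewrite ger0_norm ?ltW// => /(_ e1) /cvgr0_norm_lt /(_ _ ti0)[k _ /(_ k (leqnn k)) /=].
    rewrite ger0_norm ?exprn_ge0 ?ltW// => kt; exists k.
    by rewrite -ltr_pdivlMr// mul1r.
  have [//|[B B0 yB]] := H k.
  by exists B, (e ^+ k * t); split => //; rewrite mulr_gt0// exprn_gt0.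
elim: k => [|k [H|[B B0 yB]]]; [right|by left|].
  exists (nw 1) => // N; rewrite expr0 mul1r; elim: N => [|N IH]; first by rewrite !expr0 mulr1.
  rewrite exprSr; apply: (le_trans (nwM2 _ _)).
  have p : 0 <= nw 1 * t ^+ N by rewrite mulr_ge0// exprn_ge0// ltW.
  rewrite [t ^+ N.+1]exprSr mulrA; move: p (ler_wpM2r (nw_ge0 S) IH).
  by rewrite {4}/t; move: (nw 1 * t ^+ N) => p; lra.
have [t'1|t'1] := leP 1 (e ^+ k * t).
  right; have [B' B'0 yB'] := step _ _ t'1 B0 yB.
  by exists B' => // N; rewrite exprS -mulrA.
left; exists B, (e ^+ k * t); split => //.
by rewrite mulr_gt0// exprn_gt0.
Qed.

End GrowthRate.

(** * Resolvents of self-adjoint elements *)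

Section Resolvent.
Variables (R : realType) (A : pzRingType) (n1 nw : A -> R).
Hypothesis n1_ge0 : forall x, 0 <= n1 x.
Hypothesis n1D : forall x y, n1 (x + y) <= n1 x + n1 y.
Hypothesis n1M : forall x y, n1 (x * y) <= n1 x * n1 y.
Hypothesis n1_eq0 : forall x, n1 x = 0 -> x = 0.
Hypothesis n1_le_nw : forall x, n1 x <= nw x.
Hypothesis nwM : forall x y, nw (x * y) <= nw x * n1 y + n1 x * nw y.
Hypothesis complete : forall (u : nat -> A) (B r : R), 0 <= B -> 0 < r -> r < 1 ->
  (forall N, nw (u N.+1 - u N) <= B * r ^+ N) ->
  exists V, forall e, 0 < e -> exists N0, forall N, (N0 <= N)%N -> n1 (V - u N) <= e.

(** The limit of the partial sums is taken for n1, which is enough to identify the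
    two products, since multiplication is continuous for n1. *)
Lemma neumann_series (S : A) (B r : R) : 0 <= B -> 0 < r -> r < 1 ->
  (forall N, nw (S ^+ N) <= B * r ^+ N) -> exists V, (1 - S) * V = 1 /\ V * (1 - S) = 1.
Proof.
move=> B0 r0 r1 SB.
pose u N := \sum_(i < N) S ^+ i.
have uS N : u N.+1 - u N = S ^+ N by rewrite /u big_ord_recr /= -/(u N) addrAC subrr add0r.
have [V VP] : exists V, forall e, 0 < e -> exists N0, forall N, (N0 <= N)%N -> n1 (V - u N) <= e.
  by apply: (complete B0 r0 r1) => N; rewrite uS.
have su N : (1 - S) * u N = 1 - S ^+ N.
  elim: N => [|N IH]; first by rewrite /u big_ord0 mulr0 expr0 subrr.
  rewrite /u big_ord_recr /= mulrDr -/(u N) IH mulrBl mul1r exprS.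
  by rewrite addrA subrK.
have us N : u N * (1 - S) = 1 - S ^+ N.
  elim: N => [|N IH]; first by rewrite /u big_ord0 mul0r expr0 subrr.
  rewrite /u big_ord_recr /= mulrDl -/(u N) IH mulrBr mulr1 exprSr.
  by rewrite addrA subrK.
have small e : 0 < e -> exists N, n1 (V - u N) <= e /\ n1 (S ^+ N) <= e.
  move=> e0; have [N0 N0P] := VP e e0.
  have B1 : 0 < B + 1 by rewrite ltr_wpDl.
  have eB : 0 < e / (B + 1) by rewrite divr_gt0.
  have := @cvg_expr R r; rewrite ger0_norm ?ltW// => /(_ r1) /cvgr0_norm_lt /(_ _ eB)[k _ kP].
  exists (maxn N0 k); split; first by apply: N0P; rewrite leq_maxl.
  apply: le_trans (n1_le_nw _) _; apply: (le_trans (SB _)).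
  have := kP (maxn N0 k) (leq_maxr _ _); rewrite /= ger0_norm ?(exprn_ge0 _ (ltW r0))//.
  rewrite ltr_pdivlMr// => h.
  have : 0 <= r ^+ maxn N0 k by rewrite exprn_ge0 ?ltW.
  by nra.
have eq1 (Z : A) (c : R) : 0 <= c ->
    (forall N, n1 (Z - 1) <= c * n1 (V - u N) + c * n1 (S ^+ N)) -> Z = 1.
  move=> c0 H; apply/eqP; rewrite -subr_eq0; apply/eqP; apply: n1_eq0.
  apply/eqP; rewrite eq_le n1_ge0 andbT; apply/ler_addgt0Pr => e e0; rewrite add0r.
  have c1 : 0 < c + 1 by rewrite ltr_wpDl.
  have [|N [h1 h2]] := small (e / (2 * (c + 1))); first by rewrite divr_gt0// mulr_gt0.
  apply: (le_trans (H N)).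
  have : (c + 1) * (e / (2 * (c + 1))) = e / 2 by field; rewrite gt_eqF.
  have := ler_wpM2l c0 h1; have := ler_wpM2l c0 h2.
  have : 0 < e / (2 * (c + 1)) by rewrite divr_gt0// mulr_gt0.
  move: (e / (2 * (c + 1))) => d; nra.
have c0 : 0 <= n1 (1 - S) + n1 (-1) + 0 by rewrite addr0 addr_ge0.
have bound Z Y : n1 Y <= n1 (1 - S) * n1 Z -> forall N, n1 (Y - S ^+ N) <=
    (n1 (1 - S) + n1 (-1) + 0) * n1 Z + (n1 (1 - S) + n1 (-1) + 0) * n1 (S ^+ N).
  move=> YZ N; apply: (le_trans (n1D _ _)).
  have : n1 (- S ^+ N) <= n1 (-1) * n1 (S ^+ N) by rewrite -mulN1r.
  have := n1_ge0 (1 - S); have := n1_ge0 (-1); have := n1_ge0 Z; have := n1_ge0 (S ^+ N).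
  by nra.
exists V; split; apply: (eq1 _ _ c0) => N.
  rewrite (_ : _ - 1 = (1 - S) * (V - u N) - S ^+ N); first exact/bound/n1M.
  by rewrite mulrBr su opprB addrA [X in _ = X - _]addrAC addrK.
rewrite (_ : _ - 1 = (V - u N) * (1 - S) - S ^+ N).
  by apply/bound; rewrite mulrC; exact: n1M.
by rewrite mulrBl us opprB addrA [X in _ = X - _]addrAC addrK.
Qed.

Variable sc : {rmorphism R -> A}.
Hypothesis sc_central : forall c x, sc c * x = x * sc c.
Hypothesis n1_sc : forall c, n1 (sc c) <= `|c|.

Variables (J : A -> Prop) (ip : A -> A -> R).
Hypothesis JD : forall b c, J b -> J c -> J (b + c).
Hypothesis JM : forall x b, J b -> J (x * b).
Hypothesis ipC : forall b c, ip b c = ip c b.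
Hypothesis ipD : forall b b' c, J b -> J b' -> J c -> ip (b + b') c = ip b c + ip b' c.
Hypothesis ipZ : forall a b c, J b -> J c -> ip (sc a * b) c = a * ip b c.
Hypothesis ip_ge0 : forall b, 0 <= ip b b.

Variables (C0 : R) (P : nat).
Hypothesis C0_ge0 : 0 <= C0.
Hypothesis interpolation : forall b th s, J b -> 0 < th -> 1 <= s ->
  n1 b <= th * C0 * s ^+ P + ip b b / th + nw b / s.

Variables (F : A) (L : R).
Hypothesis L_ge0 : 0 <= L.
Hypothesis F_sym : forall b c, J b -> J c -> ip (F * b) c = ip b (F * c).
Hypothesis F_young : forall b c, J b -> J c -> 2 * ip (F * b) c <= L * (ip b b + ip c c).
Hypothesis F_approx : forall e, 0 < e -> exists2 g, J g & n1 (F - g) <= e.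

Variables (im : A).
Hypotheses (im_sqr : im * im = -1) (imF : im * F = F * im).

Lemma ipDr b c c' : J b -> J c -> J c' -> ip b (c + c') = ip b c + ip b c'.
Proof. by move=> Jb Jc Jc'; rewrite ![ip b _]ipC ipD. Qed.

Lemma ipZr a b c : J b -> J c -> ip b (sc a * c) = a * ip b c.
Proof. by move=> Jb Jc; rewrite ![ip b _]ipC ipZ. Qed.

Lemma ip_am_gm (a : R) b c : J b -> J c -> 2 * (a * ip b c) <= `|a| * (ip b b + ip c c).
Proof.
move=> Jb Jc.
have Jbc (s : R) : J (b + sc s * c) by apply: JD => //; exact: JM.
have H (s : R) : 0 <= ip b b + 2 * s * ip b c + s ^+ 2 * ip c c.
  have := ip_ge0 (b + sc s * c); rewrite ipD//; last exact: JM.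
  rewrite !ipDr//; try exact: JM.
  rewrite !ipZ//; try exact: JM.
  by rewrite !ipZr// [ip c b]ipC; congr (_ <= _); ring.
have h1 : 2 * ip b c <= ip b b + ip c c by have := H (-1); rewrite sqrrN expr1n; lra.
have h2 : - (2 * ip b c) <= ip b b + ip c c by have := H 1; rewrite expr1n; lra.
have [a0|a0] := ger0P a.
  by have := ler_wpM2l a0 h1; lra.
by have a1 : 0 <= - a; [lra|have := ler_wpM2l a1 h2; lra].
Qed.

(** Put X = F - alpha and T = X^2 + beta^2 = (X - beta im)(X + beta im); it suffices
    to invert T. On the pre-Hilbert space J, X is self-adjoint of norm at most L', so
    that S = 1 - m T with m = (L'^2 + beta^2)^-1 is a positive operator of norm at most
    q = 1 - m beta^2 < 1. Being a polynomial in F, which J approximates, S is close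
    to an element of J up to the scalar 1 - m (alpha^2 + beta^2) < 1. So the powers of S
    decay, and the Neumann series inverts 1 - S = m T. *)
Theorem resolvent (alpha beta : R) : beta != 0 ->
  exists V, (F - sc alpha - sc beta * im) * V = 1 /\ V * (F - sc alpha - sc beta * im) = 1.
Proof.
move=> beta0.
have [X XE] : exists X, X = F - sc alpha by exists (F - sc alpha).
rewrite -XE.
pose L' := L + `|alpha| + 1.
have L'1 : 1 <= L' by rewrite /L'; have := normr_ge0 alpha; have := L_ge0; lra.
have b2 : 0 < beta ^+ 2 by rewrite exprn_even_gt0.
have M0 : 0 < L' ^+ 2 + beta ^+ 2 by rewrite addr_gt0// exprn_gt0//; lra.
pose m := (L' ^+ 2 + beta ^+ 2)^-1.
have m0 : 0 < m by rewrite invr_gt0.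
have mM : m * (L' ^+ 2 + beta ^+ 2) = 1 by rewrite mulVf// gt_eqF.
pose q := 1 - m * beta ^+ 2.
have q0 : 0 < q.
  rewrite /q -mM -mulrBr addrK mulr_gt0// exprn_gt0//; lra.
have q1 : q < 1 by rewrite /q ltrBlDr ltrDl mulr_gt0.
pose T := X * X + sc (beta ^+ 2).
pose S := 1 - sc m * T.
have JX b : J b -> J (X * b) by exact: JM.
have X_sym b c : J b -> J c -> ip (X * b) c = ip b (X * c).
  move=> Jb Jc; rewrite XE !mulrBl -!mulNr -!rmorphN.
  by rewrite ipD ?ipDr ?ipZ ?ipZr ?F_sym//; exact: JM.
(* Young's inequality for v and X v / L' *)
have X_bound v : J v -> ip (X * v) (X * v) <= L' ^+ 2 * ip v v.
  move=> Jv.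
  have Jw : J (sc L'^-1 * (X * v)) by apply: JM; exact: JX.
  have : 2 * ip (X * v) (sc L'^-1 * (X * v)) <=
      L' * (ip v v + ip (sc L'^-1 * (X * v)) (sc L'^-1 * (X * v))).
    move: (sc L'^-1 * (X * v)) Jw => w Jw.
    rewrite XE mulrBl -mulNr -rmorphN ipD//; try exact: JM.
    rewrite ipZ// mulrDr.
    have := F_young Jv Jw; have := ip_am_gm (- alpha) Jv Jw; rewrite normrN.
    rewrite /L'; have := ip_ge0 v; have := ip_ge0 w; lra.
  rewrite ipZ ?ipZr//; try exact: JX.
  have L'0 : 0 < L' by lra.
  move=> h; have := ler_wpM2l (ltW L'0) h.
  rewrite (_ : L' * (2 * _) = 2 * ip (X * v) (X * v)); last by field; rewrite gt_eqF.
  rewrite (_ : L' * (L' * _) = L' ^+ 2 * ip v v + ip (X * v) (X * v)); last by field; rewrite gt_eqF.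
  lra.
(* S = q - m X^2, and m X^2 <= q by the choice of m *)
have SJ b : J b -> J (S * b) /\ ip (S * b) (S * b) <= q ^+ 2 * ip b b.
  move=> Jb; split; first exact: JM.
  have JXb := JX _ Jb; have JXXb := JX _ JXb.
  have -> : S * b = sc q * b + sc (- m) * (X * (X * b)).
    rewrite /S /q rmorphB rmorph1 rmorphN rmorphM mulNr !mulrBl mul1r.
    by rewrite /T mulrDr mulrDl !mulrA opprD addrA addrAC.
  have Jq : J (sc q * b) by exact: JM.
  have Jm : J (sc (- m) * (X * (X * b))) by exact: JM.
  have Jqm := JD Jq Jm; rewrite ipD// !ipDr// !ipZ// !ipZr//.
  rewrite [ip (X * (X * b)) b]ipC -![ip b (X * _)]X_sym//.
  have := X_bound _ JXb.
  have := ip_ge0 (X * b).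
  move: (ip (X * b) (X * b)) (ip (X * (X * b)) (X * (X * b))) (ip b b) => e1 e2 e0 e10 he.
  have mq : m * L' ^+ 2 = q by rewrite /q; lra.
  have : m * (m * e2) <= m * (q * e1).
    by rewrite -mq; apply: ler_wpM2l; [exact: ltW|rewrite -mulrA ler_wpM2l// ltW].
  have : 0 <= m * (q * e1) by apply: mulr_ge0; [exact: ltW|apply: mulr_ge0 => //; exact: ltW].
  lra.
(* S - k, for a scalar k < 1, is a left multiple of F, and F can be replaced by an element of J *)
have [g Jg gS] : exists2 g, J g & n1 (S - g) < 1.
  pose k := 1 - m * (alpha ^+ 2 + beta ^+ 2).
  have k1 : k < 1 by rewrite /k ltrBlDr ltrDl mulr_gt0// ltr_wpDl// sqr_ge0.
  have k0 : 0 <= k.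
    rewrite /k -mM -mulrBr opprD addrACA subrr addr0.
    apply: mulr_ge0; [exact: ltW|rewrite subr_ge0].
    rewrite -[alpha ^+ 2]real_normK ?num_real//.
    by apply: lerXn2r; rewrite ?nnegrE//; rewrite /L'; have := normr_ge0 alpha; have := L_ge0; lra.
  pose Y := sc (2 * alpha) - F.
  pose c := n1 (sc m * Y) + 1.
  have c0 : 0 < c by rewrite ltr_wpDl.
  have e0 : 0 < (1 - k) / c by rewrite divr_gt0// subr_gt0.
  have [g Jg gF] := F_approx (divr_gt0 e0 (ltr0n _ 2)).
  exists (sc m * Y * g); first exact: JM.
  have -> : S - sc m * Y * g = sc k + sc m * Y * (F - g).
    rewrite mulrBr addrA; congr (_ - _).
    have scE : sc k = 1 - sc m * (sc alpha * sc alpha + sc (beta ^+ 2)).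
      by rewrite /k rmorphB rmorph1 rmorphM rmorphD expr2 rmorphM.
    have aF : sc (2 * alpha) * F = sc alpha * F + F * sc alpha.
      by rewrite -[F * _]sc_central -mulrDl -rmorphD; congr (sc _ * _); ring.
    have TE0 : T = sc alpha * sc alpha + sc (beta ^+ 2) - Y * F.
      rewrite /T XE /Y !mulrBl !mulrBr aF !opprB opprD !addrA.
      by rewrite [LHS](ACl (3*5*1*4*2)).
    by rewrite scE /S TE0 mulrBr opprB mulrA addrA addrAC.
  apply: (le_lt_trans (n1D _ _)).
  have := n1_sc k; rewrite ger0_norm// => hk.
  have := n1M (sc m * Y) (F - g) => hY.
  have hc : c * ((1 - k) / c / 2) = (1 - k) / 2 by field; rewrite gt_eqF.
  have := ler_wpM2l (n1_ge0 (sc m * Y)) gF.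
  have : 0 < (1 - k) / c / 2 by rewrite divr_gt0.
  move: hc; rewrite /c; move: ((1 - k) / _ / 2) => d; lra.
have [B [r [B0 r0 r1 SB]]] := powers_decay n1_ge0 n1D n1M n1_le_nw nwM ip_ge0 C0_ge0 interpolation q0 q1 SJ Jg gS.
have [V [V1 V2]] := neumann_series B0 r0 r1 SB.
have S1 : 1 - S = sc m * T by rewrite /S opprB addrC subrK.
have imX : im * X = X * im by rewrite XE mulrBr mulrBl imF sc_central.
have bim : sc beta * im * (sc beta * im) = - sc (beta ^+ 2).
  by rewrite -mulrA [im * _]mulrA -sc_central -[sc beta * im * im]mulrA im_sqr mulrN1 mulrN -rmorphM expr2.
have Xb : X * (sc beta * im) = sc beta * im * X by rewrite mulrA -sc_central -!mulrA imX.
have TE : T = (X - sc beta * im) * (X + sc beta * im).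
  by rewrite mulrDr !mulrBl bim opprK Xb addrA subrK.
have TE' : T = (X + sc beta * im) * (X - sc beta * im).
  by rewrite mulrBr !mulrDl bim Xb opprD opprK addrA addrK.
have unique Z a b : a * Z = 1 -> Z * b = 1 -> a = b :> A.
  by move=> aZ Zb; rewrite -[b]mul1r -aZ -mulrA Zb mulr1.
have r' : (X - sc beta * im) * ((X + sc beta * im) * sc m * V) = 1.
  rewrite -V1 S1 TE -[_ * sc m]sc_central -!mulrA [LHS]mulrA -[_ * sc m]sc_central.
  by rewrite -!mulrA.
have l' : V * sc m * (X + sc beta * im) * (X - sc beta * im) = 1.
  by rewrite -mulrA -TE' -mulrA -S1.
exists ((X + sc beta * im) * sc m * V); split => //.
by rewrite -{1}(unique _ _ _ l' r').
Qed.

End Resolvent.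

(** * Complexification of a ring *)

(** Analysis is done on real functions; complex scalars enter only through this
    construction, applied to the unitization of the real algebra. *)
Record cplx (U : Type) := Cplx { cre : U ; cim : U }.

HB.instance Definition _ U := gen_eqMixin (cplx U).
HB.instance Definition _ U := gen_choiceMixin (cplx U).

Lemma cplx_eq U (x y : cplx U) : cre x = cre y -> cim x = cim y -> x = y.
Proof. by case: x y => [a b] [c d] /= -> ->. Qed.

Section ComplexificationZmod.
Variable U : zmodType.
Implicit Types x y z : cplx U.

Definition cplx_zero : cplx U := Cplx 0 0.
Definition cplx_opp x := Cplx (- cre x) (- cim x).
Definition cplx_add x y := Cplx (cre x + cre y) (cim x + cim y).

Fact cplx_addA : associative cplx_add.
Proof. by move=> x y z; rewrite /cplx_add /= !addrA. Qed.
Fact cplx_addC : commutative cplx_add.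
Proof. by move=> x y; apply: cplx_eq; exact: addrC. Qed.
Fact cplx_add0 : left_id cplx_zero cplx_add.
Proof. by move=> x; apply: cplx_eq; exact: add0r. Qed.
Fact cplx_addN : left_inverse cplx_zero cplx_opp cplx_add.
Proof. by move=> x; apply: cplx_eq; exact: addNr. Qed.

HB.instance Definition _ :=
  GRing.isZmodule.Build (cplx U) cplx_addA cplx_addC cplx_add0 cplx_addN.

End ComplexificationZmod.

Section ComplexificationRing.
Variable U : pzRingType.
Implicit Types x y z : cplx U.

Definition cplx_one : cplx U := Cplx 1 0.
Definition cplx_mul x y :=
  Cplx (cre x * cre y - cim x * cim y) (cre x * cim y + cim x * cre y).

Fact cplx_mulA : associative cplx_mul.
Proof.
move=> x y z; apply: cplx_eq => /=; rewrite !(mulrBr, mulrBl, mulrDr, mulrDl) !mulrA.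
  by rewrite !opprD !addrA [LHS](ACl (1*4*2*3)).
by rewrite !addrA [LHS](ACl (1*4*2*3)).
Qed.
Fact cplx_mul1 : left_id cplx_one cplx_mul.
Proof. by move=> x; apply: cplx_eq; rewrite /= mul1r mul0r ?subr0 ?addr0. Qed.
Fact cplx_mulr1 : right_id cplx_one cplx_mul.
Proof. by move=> x; apply: cplx_eq; rewrite /= mulr1 mulr0 ?subr0 ?add0r. Qed.
Fact cplx_mulDl : left_distributive cplx_mul (@GRing.add (cplx U)).
Proof.
move=> x y z; apply: cplx_eq => /=; rewrite !mulrDl ?opprD addrACA //.
Qed.
Fact cplx_mulDr : right_distributive cplx_mul (@GRing.add (cplx U)).
Proof.
move=> x y z; apply: cplx_eq => /=; rewrite !mulrDr ?opprD addrACA //.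
Qed.

HB.instance Definition _ := GRing.Zmodule_isPzRing.Build (cplx U)
  cplx_mulA cplx_mul1 cplx_mulr1 cplx_mulDl cplx_mulDr.

Lemma creM x y : cre (x * y) = cre x * cre y - cim x * cim y. Proof. by []. Qed.
Lemma cimM x y : cim (x * y) = cre x * cim y + cim x * cre y. Proof. by []. Qed.
Lemma creD x y : cre (x + y) = cre x + cre y. Proof. by []. Qed.
Lemma cimD x y : cim (x + y) = cim x + cim y. Proof. by []. Qed.
Lemma creB x y : cre (x - y) = cre x - cre y. Proof. by []. Qed.
Lemma cimB x y : cim (x - y) = cim x - cim y. Proof. by []. Qed.

Definition cplx_i : cplx U := Cplx 0 1.

Lemma cplx_i_sqr : cplx_i * cplx_i = -1.
Proof.
apply: cplx_eq; rewrite ?creM ?cimM /= ?(mul0r, mulr0, mulr1) ?sub0r ?addr0 //.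
by rewrite oppr0.
Qed.

Lemma cplx_i_central x : cplx_i * x = x * cplx_i.
Proof.
by apply: cplx_eq; rewrite ?creM ?cimM /= ?(mul0r, mulr0, mulr1, mul1r) ?sub0r ?addr0 ?add0r.
Qed.

End ComplexificationRing.

Section ComplexificationNorm.
Variables (R : realType) (U : pzRingType) (n1 nw : U -> R).
Hypothesis n1_ge0 : forall x, 0 <= n1 x.
Hypothesis n1D : forall x y, n1 (x + y) <= n1 x + n1 y.
Hypothesis n1N : forall x, n1 (- x) = n1 x.
Hypothesis n1M : forall x y, n1 (x * y) <= n1 x * n1 y.
Hypothesis n1_eq0 : forall x, n1 x = 0 -> x = 0.
Hypothesis nwD : forall x y, nw (x + y) <= nw x + nw y.
Hypothesis nwN : forall x, nw (- x) = nw x.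
Hypothesis n1_le_nw : forall x, n1 x <= nw x.
Hypothesis nwM : forall x y, nw (x * y) <= nw x * n1 y + n1 x * nw y.
Hypothesis complete : forall (u : nat -> U) (B r : R), 0 <= B -> 0 < r -> r < 1 ->
  (forall N, nw (u N.+1 - u N) <= B * r ^+ N) ->
  exists V, forall e, 0 < e -> exists N0, forall N, (N0 <= N)%N -> n1 (V - u N) <= e.

(** The sum of the norms of the two parts, rather than a Euclidean combination,
    keeps the inequalities for products free of square roots. *)
Definition cplx_norm (n : U -> R) (x : cplx U) := n (cre x) + n (cim x).

Let nw_ge0 x : 0 <= nw x. Proof. exact: le_trans (n1_le_nw x). Qed.

Lemma cplx_norm_ge0 x : 0 <= cplx_norm n1 x. Proof. exact: addr_ge0. Qed.

Lemma cplx_norm_eq0 x : cplx_norm n1 x = 0 -> x = 0.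
Proof.
move/eqP; rewrite paddr_eq0// => /andP[/eqP h1 /eqP h2].
by apply: cplx_eq; exact: n1_eq0.
Qed.

Lemma cplx_norm_le x : cplx_norm n1 x <= cplx_norm nw x. Proof. exact: lerD. Qed.

Lemma cplx_normD x y : cplx_norm n1 (x + y) <= cplx_norm n1 x + cplx_norm n1 y.
Proof.
apply: (le_trans (lerD (n1D (cre x) (cre y)) (n1D (cim x) (cim y)))).
by rewrite addrACA.
Qed.

Lemma cplx_norm1M x y : cplx_norm n1 (x * y) <= cplx_norm n1 x * cplx_norm n1 y.
Proof.
rewrite /cplx_norm creM cimM.
have := n1D (cre x * cre y) (- (cim x * cim y)); rewrite n1N.
have := n1D (cre x * cim y) (cim x * cre y).
have := n1M (cre x) (cre y); have := n1M (cim x) (cim y).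
have := n1M (cre x) (cim y); have := n1M (cim x) (cre y).
lra.
Qed.

Lemma cplx_normwM x y : cplx_norm nw (x * y) <=
  cplx_norm nw x * cplx_norm n1 y + cplx_norm n1 x * cplx_norm nw y.
Proof.
rewrite /cplx_norm creM cimM.
have := nwD (cre x * cre y) (- (cim x * cim y)); rewrite nwN.
have := nwD (cre x * cim y) (cim x * cre y).
have := nwM (cre x) (cre y); have := nwM (cim x) (cim y).
have := nwM (cre x) (cim y); have := nwM (cim x) (cre y).
lra.
Qed.

Lemma cplx_complete (u : nat -> cplx U) (B r : R) : 0 <= B -> 0 < r -> r < 1 ->
  (forall N, cplx_norm nw (u N.+1 - u N) <= B * r ^+ N) ->
  exists V, forall e, 0 < e -> exists N0, forall N, (N0 <= N)%N -> cplx_norm n1 (V - u N) <= e.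
Proof.
move=> B0 r0 r1 uB.
have [V1 V1P] : exists V, forall e, 0 < e -> exists N0, forall N, (N0 <= N)%N -> n1 (V - cre (u N)) <= e.
  apply: (complete B0 r0 r1) => N; apply: le_trans (uB N).
  by rewrite /cplx_norm creB lerDl.
have [V2 V2P] : exists V, forall e, 0 < e -> exists N0, forall N, (N0 <= N)%N -> n1 (V - cim (u N)) <= e.
  apply: (complete B0 r0 r1) => N; apply: le_trans (uB N).
  by rewrite /cplx_norm cimB lerDr.
exists (Cplx V1 V2) => e e0; have e20 : 0 < e / 2 by rewrite divr_gt0.
have [N1 N1P] := V1P _ e20; have [N2 N2P] := V2P _ e20.
exists (maxn N1 N2) => N; rewrite geq_max => /andP[/N1P h1 /N2P h2].
by rewrite /cplx_norm creB cimB /= [leRHS](splitr e) lerD.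
Qed.

End ComplexificationNorm.

(** * Completeness and truncation in L1 *)

Section Completeness.
Context d (T : measurableType d) (R : realType).
Variable mu : {measure set T -> \bar R}.

(** The series of increments converges absolutely almost everywhere, and its sum
    dominates the sequence. *)
Lemma L1_complete (f : nat -> T -> R) (B r : R) :
  (forall N, mu.-integrable setT (EFin \o f N)) ->
  0 <= B -> 0 < r -> r < 1 ->
  (forall N, \int[mu]_x `|f N.+1 x - f N x| <= B * r ^+ N) ->
  exists g : T -> R, mu.-integrable setT (EFin \o g) /\
    (fun N => \int[mu]_x `|f N x - g x|) @ \oo --> 0.
Proof.
move=> Lf B0 r0 r1 fB.
have mf N : measurable_fun setT (f N).
  by apply/measurable_EFinP; exact: measurable_int (Lf N).
pose h N x : \bar R := `|f N.+1 x - f N x|%:E.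
have mh N : measurable_fun setT (h N).
  by apply/measurable_EFinP; apply: measurableT_comp => //; exact: measurable_funB.
have h0 N x : (0 <= h N x)%E by rewrite lee_fin.
pose H x : \bar R := (\sum_(N <oo) h N x)%E.
have mH : measurable_fun setT H by apply: (ge0_emeasurable_sum (P := xpredT)).
have H0 x : (0 <= H x)%E by exact: nneseries_ge0.
have Lh N : mu.-integrable setT (h N).
  by have := integrable_abse (integrableB measurableT (Lf N.+1) (Lf N)).
have geo : (\sum_(N <oo) (B * r ^+ N)%:E < +oo)%E.
  have : (fun n => (\sum_(0 <= N < n) (B * r ^+ N)%:E)%E) @ \oo --> (B * (1 - r)^-1)%:E.
    rewrite (_ : (fun n => _) = EFin \o series (geometric B r)); last first.
      by apply/funext => n; rewrite /= /series /= -sumEFin.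
    apply: cvg_EFin; first exact: nearW.
    by rewrite (_ : fine \o _ = series (geometric B r))//; apply: cvg_geometric_series; rewrite ger0_norm// ltW.
  by move/cvg_lim => ->//; rewrite ltry.
have Hfin : (\int[mu]_x H x < +oo)%E.
  rewrite integral_nneseries//; apply: le_lt_trans geo; apply: lee_nneseries.
    by move=> N _ _; exact: integral_ge0.
  move=> N _; have := fB N; rewrite -lee_fin; apply: le_trans.
  by rewrite fineK//; exact: integrable_fin_num (Lh N).
have LH : mu.-integrable setT H.
  apply/integrableP; split => //.
  by under eq_integral do rewrite gee0_abs//.
have Hae : {ae mu, forall x, H x \is a fin_num}.
  by apply: ae_mono (integrable_ae measurableT LH) => x; exact.
pose G x : \bar R := (`|f 0%N x|%:E + H x)%E.
have LG : mu.-integrable setT G.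
  by apply: integrableD => //; exact: (integrable_abse (Lf 0%N)).
have part n x : ((\sum_(0 <= k < n) `|f k.+1 x - f k x|)%:E <= H x)%E.
  rewrite -sumEFin; exact: (nneseries_lim_ge (P := xpredT)).
have dom n x : (`|(f n x)%:E| <= G x)%E.
  apply: (@le_trans _ _ (`|f 0%N x| + \sum_(0 <= k < n) `|f k.+1 x - f k x|)%:E); last first.
    by rewrite EFinD; apply: leeD.
  rewrite abse_EFin lee_fin (eq_sum_telescope (fun n => f n x) n).
  apply: (le_trans (ler_normD _ _)); rewrite lerD2l.
  exact: ler_norm_sum.
pose g x := fine (limn_esup (fun n => (f n x)%:E)).
have mg : measurable_fun setT g.
  apply: measurableT_comp => //; apply: measurable_fun_limn_esup => n.
  exact/measurable_EFinP.
have cvg : {ae mu, forall x, setT x -> (fun n => (f n x)%:E) @ \oo --> (g x)%:E}.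
  apply: ae_mono Hae => x Hx _.
  have cn : cvgn [normed series (telescope (fun n => f n x))].
    apply: nondecreasing_is_cvgn.
      apply/nondecreasing_seqP => n; rewrite /= /series /= big_nat_recr//= lerDl//.
    exists (fine (H x)) => _ [n _ <-].
    by rewrite -lee_fin fineK//; exact: (part n x).
  have cf : cvgn (fun n => f n x).
    rewrite (_ : (fun n => f n x) = (fun n => f 0%N x + series (telescope (fun n => f n x)) n)).
      by apply: is_cvgD; [exact: is_cvg_cst|exact: normed_cvg].
    by apply/funext => n; exact: (eq_sum_telescope (fun n => f n x) n).
  have cE : (fun n => (f n x)%:E) @ \oo --> (limn (fun n => f n x))%:E.
    by apply: cvg_EFin; [exact: nearW|exact: cf].
  suff -> : g x = limn (fun n => f n x) by [].
  by rewrite /g limn_esup_lim (cvg_lim _ (cvg_esups cE)).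
have dom' : {ae mu, forall x n, setT x -> (`|(f n x)%:E| <= G x)%E}.
  by apply: aeW => x n _; exact: dom.
have mf' n : measurable_fun setT (fun x => (f n x)%:E) by exact/measurable_EFinP.
have mg' : measurable_fun setT (fun x => (g x)%:E) by exact/measurable_EFinP.
have [Lg conv _] := dominated_convergence measurableT mf' mg' cvg LG dom'.
exists g; split => //.
rewrite (_ : (fun N => _) = fine \o [sequence (\int[mu]_x `|(f n x)%:E - (g x)%:E|)%E]_n).
  exact: (fine_cvg conv).
by apply/funext => n.
Qed.

(** Dominated convergence along the integer thresholds. *)
Lemma L1_truncation (f : T -> R) (e : R) : mu.-integrable setT (EFin \o f) -> 0 < e ->
  exists m : R, \int[mu]_x `|f x - f x * (`|f x| <= m)%R%:R| <= e.
Proof.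
move=> Lf e0.
have mf : measurable_fun setT f by apply/measurable_EFinP; exact: measurable_int Lf.
pose u n x := f x * (`|f x| <= n%:R)%R%:R.
have mu' n : measurable_fun setT (fun x => (u n x)%:E).
  apply/measurable_EFinP; apply: measurable_funM => //.
  apply: (measurableT_comp (f := fun b : bool => b%:R : R)) => //.
  apply: measurable_fun_ler => //; exact: measurableT_comp.
have mf' : measurable_fun setT (EFin \o f) by exact/measurable_EFinP.
have cvg : {ae mu, forall x, setT x -> (fun n => (u n x)%:E) @ \oo --> (EFin \o f) x}.
  apply: aeW => x _; apply: cvg_near_cst.
  near=> n; rewrite /u /= (_ : `|f x| <= n%:R) ?mulr1//.
  by near: n; exact: nbhs_infty_ger.
have LG : mu.-integrable setT (fun x => `|(EFin \o f) x|%E) by exact: integrable_abse.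
have dom : {ae mu, forall x n, setT x -> (`|(u n x)%:E| <= `|(EFin \o f) x|)%E}.
  apply: aeW => x n _; rewrite /u /= lee_fin normrM ler_piMr//.
  by rewrite ger0_norm// lern1 leq_b1.
have [_ conv _] := dominated_convergence measurableT mu' mf' cvg LG dom.
have c0 : (fun n => fine (\int[mu]_x `|(u n x)%:E - (f x)%:E|)%E) @ \oo --> (0 : R).
  exact: (fine_cvg conv).
move/cvgr0_norm_lt : c0 => /(_ _ e0)[n _ /(_ n (leqnn n)) /ltW].
rewrite /= ger0_norm; last by apply: fine_ge0; apply: integral_ge0.
move=> le; exists n%:R; apply: le_trans le; rewrite le_eqVlt; apply/orP; left; apply/eqP.
by congr fine; apply: eq_integral => x _; rewrite /= distrC.
Unshelve. all: by end_near. Qed.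

End Completeness.

(** * Resolvents in the complexification *)

Section ComplexResolvent.
Variables (R : realType) (U : pzRingType) (n1 nw : U -> R).
Hypothesis n1_ge0 : forall x, 0 <= n1 x.
Hypothesis n1D : forall x y, n1 (x + y) <= n1 x + n1 y.
Hypothesis n1N : forall x, n1 (- x) = n1 x.
Hypothesis n1M : forall x y, n1 (x * y) <= n1 x * n1 y.
Hypothesis n1_eq0 : forall x, n1 x = 0 -> x = 0.
Hypothesis nwD : forall x y, nw (x + y) <= nw x + nw y.
Hypothesis nwN : forall x, nw (- x) = nw x.
Hypothesis n1_le_nw : forall x, n1 x <= nw x.
Hypothesis nwM : forall x y, nw (x * y) <= nw x * n1 y + n1 x * nw y.
Hypothesis complete : forall (u : nat -> U) (B r : R), 0 <= B -> 0 < r -> r < 1 ->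
  (forall N, nw (u N.+1 - u N) <= B * r ^+ N) ->
  exists V, forall e, 0 < e -> exists N0, forall N, (N0 <= N)%N -> n1 (V - u N) <= e.

Variable sc : {rmorphism R -> U}.
Hypothesis sc_central : forall c x, sc c * x = x * sc c.
Hypothesis n1_sc : forall c, n1 (sc c) = `|c|.

Variables (J : U -> Prop) (ip : U -> U -> R).
Hypothesis JD : forall b c, J b -> J c -> J (b + c).
Hypothesis JM : forall x b, J b -> J (x * b).
Hypothesis ipC : forall b c, ip b c = ip c b.
Hypothesis ipD : forall b b' c, J b -> J b' -> J c -> ip (b + b') c = ip b c + ip b' c.
Hypothesis ipZ : forall a b c, J b -> J c -> ip (sc a * b) c = a * ip b c.
Hypothesis ip_ge0 : forall b, 0 <= ip b b.

Variables (C0 : R) (P : nat).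
Hypothesis C0_ge0 : 0 <= C0.
Hypothesis interpolation : forall b th s, J b -> 0 < th -> 1 <= s ->
  n1 b <= th * C0 * s ^+ P + ip b b / th + nw b / s.

Local Notation A := (cplx U).
Local Notation n1A := (cplx_norm n1).
Local Notation nwA := (cplx_norm nw).

Definition cplx_sc (r : R) : A := Cplx (sc r) 0.

Let cplx_scB : zmod_morphism cplx_sc.
Proof. by move=> r s; apply: cplx_eq; rewrite /= ?rmorphB// subr0. Qed.

Let cplx_scM : monoid_morphism cplx_sc.
Proof.
split; first by apply: cplx_eq; rewrite /= ?rmorph1.
move=> r s; apply: cplx_eq; rewrite ?creM ?cimM /= ?rmorphM ?mulr0 ?mul0r ?subr0 ?addr0//.
Qed.

HB.instance Definition _ := GRing.isZmodMorphism.Build R A cplx_sc cplx_scB.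
HB.instance Definition _ := GRing.isMonoidMorphism.Build R A cplx_sc cplx_scM.

Lemma cplx_sc_central r (x : A) : cplx_sc r * x = x * cplx_sc r.
Proof.
by apply: cplx_eq; rewrite ?creM ?cimM /= mul0r mulr0 sc_central ?addr0 ?add0r.
Qed.

Lemma cplx_norm_sc r : n1A (cplx_sc r) <= `|r|.
Proof.
have n0 : n1 0 = 0 by rewrite -(rmorph0 sc) n1_sc normr0.
by rewrite /cplx_norm /= n0 addr0 n1_sc.
Qed.

Definition JA (x : A) := J (cre x) /\ J (cim x).
Definition ipA (x y : A) := ip (cre x) (cre y) + ip (cim x) (cim y).

Let JN b : J b -> J (- b). Proof. by rewrite -mulN1r; exact: JM. Qed.

Let ipN b c : J b -> J c -> ip (- b) c = - ip b c.
Proof. by move=> Jb Jc; rewrite -mulN1r -[-1](rmorphN1 sc) ipZ// mulN1r. Qed.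

Let ipDr b c c' : J b -> J c -> J c' -> ip b (c + c') = ip b c + ip b c'.
Proof. by move=> Jb Jc Jc'; rewrite ipC ipD// (ipC c) (ipC c'). Qed.

Let ipNr b c : J b -> J c -> ip b (- c) = - ip b c.
Proof. by move=> Jb Jc; rewrite ipC ipN// ipC. Qed.

Lemma JA_D b c : JA b -> JA c -> JA (b + c).
Proof. by move=> [? ?] [? ?]; split; exact: JD. Qed.

Lemma JA_M x b : JA b -> JA (x * b).
Proof.
move=> [J1 J2]; split; rewrite ?creM ?cimM.
  by apply: JD; [exact: JM|apply: JN; exact: JM].
by apply: JD; exact: JM.
Qed.

Lemma ipA_C b c : ipA b c = ipA c b.
Proof. by rewrite /ipA (ipC (cre b)) (ipC (cim b)). Qed.

Lemma ipA_D b b' c : JA b -> JA b' -> JA c -> ipA (b + b') c = ipA b c + ipA b' c.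
Proof.
move=> [J1 J2] [J1' J2'] [K1 K2].
by rewrite /ipA creD cimD !ipD// addrACA.
Qed.

Lemma ipA_Z r b c : JA b -> JA c -> ipA (cplx_sc r * b) c = r * ipA b c.
Proof.
move=> [J1 J2] [K1 K2]; rewrite /ipA creM cimM /= !mul0r subr0 addr0.
by rewrite !ipZ// mulrDr.
Qed.

Lemma ipA_ge0 b : 0 <= ipA b b.
Proof. by rewrite addr_ge0. Qed.

Lemma JA_interpolation b th s : JA b -> 0 < th -> 1 <= s ->
  n1A b <= th * (2 * C0) * s ^+ P + ipA b b / th + nwA b / s.
Proof.
move=> [J1 J2] th0 s1; rewrite /cplx_norm /ipA.
have := interpolation J1 th0 s1; have := interpolation J2 th0 s1.
rewrite !mulrDl; lra.
Qed.

Variables (a1 a2 : U) (L1 L2 : R).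
Hypotheses (L1_ge0 : 0 <= L1) (L2_ge0 : 0 <= L2).
Hypothesis a1_sym : forall b c, J b -> J c -> ip (a1 * b) c = ip b (a1 * c).
Hypothesis a2_antisym : forall b c, J b -> J c -> ip (a2 * b) c = - ip b (a2 * c).
Hypothesis a1_young : forall b c, J b -> J c -> 2 * ip (a1 * b) c <= L1 * (ip b b + ip c c).
Hypothesis a2_young : forall b c, J b -> J c -> 2 * ip (a2 * b) c <= L2 * (ip b b + ip c c).
Hypothesis a1_approx : forall e, 0 < e -> exists2 g, J g & n1 (a1 - g) <= e.
Hypothesis a2_approx : forall e, 0 < e -> exists2 g, J g & n1 (a2 - g) <= e.

Lemma ipA_self_adjoint b c : JA b -> JA c ->
  ipA (Cplx a1 a2 * b) c = ipA b (Cplx a1 a2 * c).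
Proof.
move=> [Jb1 Jb2] [Jc1 Jc2]; rewrite /ipA !creM !cimM /=.
have [J11 J12 K11 K12] := And4 (JM a1 Jb1) (JM a1 Jb2) (JM a1 Jc1) (JM a1 Jc2).
have [J21 J22 K21 K22] := And4 (JM a2 Jb1) (JM a2 Jb2) (JM a2 Jc1) (JM a2 Jc2).
have [N22 M22] := conj (JN J22) (JN K22).
rewrite !ipD// !ipDr// ipN// ipNr// !a1_sym// !a2_antisym//; ring.
Qed.

Lemma ipA_young b c : JA b -> JA c ->
  2 * ipA (Cplx a1 a2 * b) c <= (L1 + L2) * (ipA b b + ipA c c).
Proof.
move=> [Jb1 Jb2] [Jc1 Jc2]; rewrite /ipA !creM !cimM /=.
have [J11 J12] := conj (JM a1 Jb1) (JM a1 Jb2).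
have [J21 J22] := conj (JM a2 Jb1) (JM a2 Jb2).
have Nc := JN Jc1; have N22 := JN J22.
rewrite !ipD// ipN//.
have h1 := a1_young Jb1 Jc1; have h2 := a1_young Jb2 Jc2.
have h3 := a2_young Jb1 Jc2; have := a2_young Jb2 Nc.
rewrite ipNr// [ip (- _) (- _)]ipN// ipNr// opprK; lra.
Qed.

Lemma JA_approx e : 0 < e -> exists2 b, JA b & n1A (Cplx a1 a2 - b) <= e.
Proof.
move=> e0; have e20 : 0 < e / 2 by rewrite divr_gt0.
have [b1 Jb1 h1] := a1_approx e20; have [b2 Jb2 h2] := a2_approx e20.
exists (Cplx b1 b2); first by split.
by rewrite [e]splitr; exact: lerD.
Qed.

(** The element a1 + i a2 is self-adjoint because a1 is symmetric and a2
    antisymmetric. The four equations are the real and imaginary parts of the two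
    products of its resolvent at alpha + i beta. *)
Theorem complex_resolvent (alpha beta : R) : beta != 0 -> exists v1 v2,
  [/\ (a1 - sc alpha) * v1 - (a2 - sc beta) * v2 = 1,
      (a1 - sc alpha) * v2 + (a2 - sc beta) * v1 = 0,
      v1 * (a1 - sc alpha) - v2 * (a2 - sc beta) = 1 &
      v1 * (a2 - sc beta) + v2 * (a1 - sc alpha) = 0].
Proof.
move=> beta0.
suff [[v1 v2] [Vl Vr]] : exists V : A,
    (Cplx a1 a2 - Cplx (sc alpha) (sc beta)) * V = 1 /\
    V * (Cplx a1 a2 - Cplx (sc alpha) (sc beta)) = 1.
  exists v1, v2; split; [exact: (congr1 (@cre _) Vl)|exact: (congr1 (@cim _) Vl)|
    exact: (congr1 (@cre _) Vr)|exact: (congr1 (@cim _) Vr)].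
have -> : Cplx a1 a2 - Cplx (sc alpha) (sc beta) =
    Cplx a1 a2 - cplx_sc alpha - cplx_sc beta * cplx_i U.
  rewrite -addrA -opprD; congr (_ - _); apply: cplx_eq; rewrite ?creD ?cimD ?creM ?cimM /=;
  by rewrite ?(mulr0, mulr1, mul0r, subr0, addr0, add0r).
have C20 : 0 <= 2 * C0 by rewrite mulr_ge0.
exact: (resolvent (cplx_norm_ge0 n1_ge0) (cplx_normD n1D)
  (cplx_norm1M n1D n1N n1M) (cplx_norm_eq0 n1_ge0 n1_eq0)
  (cplx_norm_le n1_le_nw) (cplx_normwM nwD nwN nwM)
  (cplx_complete n1_ge0 n1_le_nw complete)
  cplx_sc_central cplx_norm_sc JA_D JA_M ipA_C ipA_D ipA_Z ipA_ge0
  C20 JA_interpolation (addr_ge0 L1_ge0 L2_ge0) ipA_self_adjoint ipA_young JA_approx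
  (cplx_i_sqr U) (cplx_i_central (Cplx a1 a2)) alpha beta0).
Qed.

End ComplexResolvent.

(** * The unitization of the real weighted algebra *)

Section WeightedAlgebra.
Variables (R : realType) (G : topologicalGroupType) (K : nat -> set G).
Variable mu : {sigma_finite_measure set (borel G) -> \bar R}.
Hypotheses (hK : locally_elliptic K) (hmu : left_haar mu).
Variable w : borel G -> R.
Hypothesis mw : measurable_fun setT w.
Hypothesis w_ge1 : forall x, 1 <= w x.
Hypothesis w_sub : forall x y : G, w (x * y)%g <= w x + w y.
Implicit Types f g h : borel G -> R.
Local Notation L1 := (L1 mu).
Local Notation norm1 := (norm1 mu).
Local Notation conv := (conv mu).
Local Notation L1_conv := (L1_conv hK hmu).

Definition weighted f : borel G -> R := fun x => f x * w x.
Definition Lw f := L1 f /\ L1 (weighted f).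
Definition normw f := norm1 (weighted f).

Let w_ge0 x : 0 <= w x. Proof. exact: le_trans ler01 (w_ge1 x). Qed.

Lemma Lw_measurable f : Lw f -> measurable_fun setT f.
Proof. by case=> /L1_measurable. Qed.

Lemma LwD f g : Lw f -> Lw g -> Lw (fun x => f x + g x).
Proof.
move=> [Lf Lfw] [Lg Lgw]; split; first exact: L1D.
rewrite (_ : weighted _ = fun x => weighted f x + weighted g x); first exact: L1D.
by apply/funext => x; rewrite /weighted mulrDl.
Qed.

Lemma LwZ c f : Lw f -> Lw (fun x => c * f x).
Proof.
move=> [Lf Lfw]; split; first exact: L1Z.
rewrite (_ : weighted _ = fun x => c * weighted f x); first exact: L1Z.
by apply/funext => x; rewrite /weighted mulrA.
Qed.

Lemma L1_0 : L1 (fun=> 0). Proof. exact: integrable0. Qed.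

Lemma Lw0 : Lw (fun=> 0).
Proof.
split; first exact: L1_0.
rewrite (_ : weighted _ = fun=> 0); first exact: L1_0.
by apply/funext => x; rewrite /weighted mul0r.
Qed.

Lemma norm1_ae f g : measurable_fun setT f -> measurable_fun setT g ->
  {ae mu, forall x, f x = g x} -> norm1 f = norm1 g.
Proof.
move=> mf mg fg; apply: ae_eq_RintegralT; [exact: measurableT_comp|exact: measurableT_comp|].
by apply: ae_mono fg => x ->.
Qed.

Lemma normw_ae f g : Lw f -> Lw g -> {ae mu, forall x, f x = g x} -> normw f = normw g.
Proof.
move=> [_ Lf] [_ Lg] fg; apply: norm1_ae; [exact: L1_measurable Lf|exact: L1_measurable Lg|].
by apply: ae_mono fg => x fgx; rewrite /weighted fgx.
Qed.

Lemma norm1D f g : L1 f -> L1 g -> norm1 (fun x => f x + g x) <= norm1 f + norm1 g.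
Proof.
move=> Lf Lg; rewrite /norm1 -RintegralD//; try exact: L1_abs.
apply: norm1_le; [exact: L1D|apply: L1D; exact: L1_abs|].
by move=> x; exact: ler_normD.
Qed.

Lemma norm1Z c f : L1 f -> norm1 (fun x => c * f x) = `|c| * norm1 f.
Proof.
move=> Lf; rewrite /norm1 -RintegralZl//; last exact: L1_abs.
by apply: eq_Rintegral => x _; rewrite normrM.
Qed.

Lemma normwD f g : Lw f -> Lw g -> normw (fun x => f x + g x) <= normw f + normw g.
Proof.
move=> [_ Lf] [_ Lg]; rewrite /normw.
rewrite (_ : weighted _ = fun x => weighted f x + weighted g x); first exact: norm1D.
by apply/funext => x; rewrite /weighted mulrDl.
Qed.

Lemma normwZ c f : Lw f -> normw (fun x => c * f x) = `|c| * normw f.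
Proof.
move=> [_ Lf]; rewrite /normw.
rewrite (_ : weighted _ = fun x => c * weighted f x); first exact: norm1Z.
by apply/funext => x; rewrite /weighted mulrA.
Qed.

Lemma norm1_le_normw f : Lw f -> norm1 f <= normw f.
Proof.
move=> [Lf Lfw]; apply: norm1_le => //; first exact: L1_abs.
by move=> x; rewrite /weighted normrM ler_peMr// ger0_norm.
Qed.

(** The inequality w (y x) <= w y + w x cuts the weighted integral in two. The bound
    has the form of the Leibniz rule, which is stronger than submultiplicativity and
    is what makes the improvement of growth rates possible. *)
Lemma Lw_conv_bound f g : Lw f -> Lw g ->
  Lw (conv f g) /\ normw (conv f g) <= normw f * norm1 g + norm1 f * normw g.
Proof.
move=> Lwf Lwg; have [[Lf Lfw] [Lg Lgw]] := (Lwf, Lwg).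
pose c x : R := w x * norm1 g + normw g.
have mf := L1_measurable Lf; have mg := L1_measurable Lg.
have gkc (y : G) : (\int[mu]_x `|(g x * w (y * x)%g)%:E| <= (c y)%:E)%E.
  have Lb : L1 (fun x => w y * `|g x| + `|weighted g x|).
    by apply: L1D; [apply: L1Z|]; exact: L1_abs.
  have -> : (c y)%:E = (\int[mu]_x (w y * `|g x| + `|weighted g x|)%:E)%E.
    rewrite -RintegralE// RintegralD//; try exact: L1_abs.
      by rewrite RintegralZl//; exact: L1_abs.
    by apply: L1Z; exact: L1_abs.
  apply: ge0_le_integral => //.
  - apply: measurableT_comp => //; apply/measurable_EFinP; apply: measurable_funM => //.
    exact: measurable_translate.
  - exact: (measurable_int mu Lb).
  - move=> x _; rewrite abse_EFin lee_fin /weighted !normrM.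
    rewrite mulrC -[w y * _ + _]/(w y * _ + _) [_ * `|w x|]mulrC -mulrDl.
    by apply: ler_wpM2r => //; rewrite !ger0_norm.
have Lfc : L1 (fun y => f y * c y).
  have -> : (fun y => f y * c y) = fun y => norm1 g * weighted f y + normw g * f y.
    by apply/funext => y; rewrite /c /weighted; ring.
  by apply: L1D; exact: L1Z.
have [Lcw le] := conv_weight hK hmu mf mg mw gkc Lfc.
split; first by split => //; exact: L1_conv.
apply: (le_trans le).
rewrite (_ : (fun y => f y * c y) = fun y => norm1 g * weighted f y + normw g * f y); last first.
  by apply/funext => y; rewrite /c /weighted; ring.
apply: (le_trans (norm1D (L1Z _ Lfw) (L1Z _ Lf))).
rewrite !norm1Z// !ger0_norm ?norm1_ge0// /normw; lra.
Qed.

Lemma Lw_conv f g : Lw f -> Lw g -> Lw (conv f g).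
Proof. by move=> Lf Lg; have [] := Lw_conv_bound Lf Lg. Qed.

(** Classes modulo null sets are represented by chosen members, so that Leibniz
    equality is equality of classes and ring structures apply. *)
Definition canon f := xget (fun=> 0) [set h | Lw h /\ {ae mu, forall x, f x = h x}].

Lemma Lw_canon f : Lw (canon f).
Proof.
rewrite /canon; case: xgetP => [h _ []//|_]; exact: Lw0.
Qed.

Lemma ae_canon f : Lw f -> {ae mu, forall x, canon f x = f x}.
Proof.
move=> Lf; have : Lw (canon f) /\ {ae mu, forall x, f x = canon f x}.
  suff : [set h | Lw h /\ {ae mu, forall x, f x = h x}] (canon f) by [].
  by apply: xgetPex; exists f; split => //; exact: aeW.
by case=> _; apply: ae_mono => x ->.
Qed.

Lemma eq_canon f g : {ae mu, forall x, f x = g x} -> canon f = canon g.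
Proof.
move=> fg; rewrite /canon; congr xget; apply/seteqP; split=> h [Lh fh]; split => //.
  by apply: ae_mono2 fg fh => x -> ->.
by apply: ae_mono2 fg fh => x -> ->.
Qed.

Record unitz := Unitz {
  ucst : R ;
  ufun : borel G -> R ;
  ufun_canon : canon ufun = ufun
}.

(** Outside Lw, canon f is not almost everywhere equal to f; applying canon twice
    gives a fixed point of canon for every f. *)
Definition mkU c f : unitz :=
  @Unitz c (canon (canon f)) (eq_canon (ae_canon (Lw_canon f))).

HB.instance Definition _ := gen_eqMixin unitz.
HB.instance Definition _ := gen_choiceMixin unitz.

Lemma unitz_eq (a b : unitz) : ucst a = ucst b ->
  {ae mu, forall x, ufun a x = ufun b x} -> a = b.
Proof.
case: a b => [c f cf] [d g cg] /= -> /eq_canon fg.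
have E : f = g by rewrite -cf -cg.
by subst g; congr Unitz; exact: Prop_irrelevance.
Qed.

Lemma LwU (a : unitz) : Lw (ufun a).
Proof. by rewrite -(ufun_canon a); exact: Lw_canon. Qed.

Lemma ufun_mkU c f : Lw f -> {ae mu, forall x, ufun (mkU c f) x = f x}.
Proof.
move=> Lf; apply: ae_mono2 (ae_canon (Lw_canon f)) (ae_canon Lf).
by move=> x /= -> ->.
Qed.

Implicit Types a b : unitz.

Definition uzero := mkU 0 (fun=> 0).
Definition uone := mkU 1 (fun=> 0).
Definition uopp a := mkU (- ucst a) (fun x => - 1 * ufun a x).
Definition uadd a b := mkU (ucst a + ucst b) (fun x => ufun a x + ufun b x).
Definition umulfun a b : borel G -> R := fun x =>
  ucst a * ufun b x + ucst b * ufun a x + conv (ufun a) (ufun b) x.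
Definition umul a b := mkU (ucst a * ucst b) (umulfun a b).

Lemma ufun0 : {ae mu, forall x, ufun uzero x = 0}.
Proof. exact: ufun_mkU Lw0. Qed.
Lemma ufun1 : {ae mu, forall x, ufun uone x = 0}.
Proof. exact: ufun_mkU Lw0. Qed.
Lemma ufunN a : {ae mu, forall x, ufun (uopp a) x = - ufun a x}.
Proof. by apply: ae_mono (ufun_mkU (- ucst a) (LwZ (-1) (LwU a))) => x ->; rewrite mulN1r. Qed.
Lemma ufunD a b : {ae mu, forall x, ufun (uadd a b) x = ufun a x + ufun b x}.
Proof. exact: ufun_mkU (LwD (LwU a) (LwU b)). Qed.
Lemma Lw_umulfun a b : Lw (umulfun a b).
Proof.
by apply: LwD; [apply: LwD; exact: LwZ (LwU _)|exact: Lw_conv (LwU _) (LwU _)].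
Qed.
Lemma ufunM a b : {ae mu, forall x, ufun (umul a b) x = umulfun a b x}.
Proof. exact: ufun_mkU (Lw_umulfun a b). Qed.

#[local] Instance ae_mu_filter : Filter (nbhs (almost_everywhere mu)) :=
  ae_filter_ringOfSetsType mu.

Fact uaddA : associative uadd.
Proof.
move=> a b c; apply: unitz_eq; first exact: addrA.
have h1 := ufunD a (uadd b c); have h2 := ufunD (uadd a b) c.
have h3 := ufunD a b; have h4 := ufunD b c.
near=> x; rewrite (near h1 x)// (near h2 x)// (near h3 x)// (near h4 x)//.
exact: addrA.
Unshelve. all: by end_near. Qed.

Fact uaddC : commutative uadd.
Proof.
move=> a b; apply: unitz_eq; first exact: addrC.
have h1 := ufunD a b; have h2 := ufunD b a.
near=> x; rewrite (near h1 x)// (near h2 x)//; exact: addrC.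
Unshelve. all: by end_near. Qed.

Fact uadd0 : left_id uzero uadd.
Proof.
move=> a; apply: unitz_eq; first exact: add0r.
have h1 := ufunD uzero a; have h2 := ufun0.
near=> x; rewrite (near h1 x)// (near h2 x)//; exact: add0r.
Unshelve. all: by end_near. Qed.

Fact uaddN : left_inverse uzero uopp uadd.
Proof.
move=> a; apply: unitz_eq; first exact: addNr.
have h1 := ufunD (uopp a) a; have h2 := ufun0; have h3 := ufunN a.
near=> x; rewrite (near h1 x)// (near h2 x)// (near h3 x)//; exact: addNr.
Unshelve. all: by end_near. Qed.

HB.instance Definition _ :=
  GRing.isZmodule.Build unitz uaddA uaddC uadd0 uaddN.

Lemma conv_ufun_ae f f' g g' : Lw f -> Lw g -> Lw f' -> Lw g' ->
  {ae mu, forall x, f x = f' x} -> {ae mu, forall x, g x = g' x} ->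
  conv f g = conv f' g'.
Proof. by move=> ? ? ? ?; apply: (conv_ae hK hmu); exact: Lw_measurable. Qed.

Fact umulA : associative umul.
Proof.
move=> a b c; apply: unitz_eq; first exact: mulrA.
have [[La Lb Lc] Lab Lbc] : [/\ [/\ Lw (ufun a), Lw (ufun b) & Lw (ufun c)],
    Lw (conv (ufun a) (ufun b)) & Lw (conv (ufun b) (ufun c))].
  by split; [split; exact: LwU|apply: Lw_conv; exact: LwU|apply: Lw_conv; exact: LwU].
have Lin (p q : R) f g h : Lw f -> Lw g -> Lw h -> Lw (fun x => p * f x + q * g x + h x).
  by move=> *; apply: LwD => //; apply: LwD; exact: LwZ.
have h1 := ufunM a (umul b c); have h2 := ufunM (umul a b) c.
have h3 := ufunM a b; have h4 := ufunM b c.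
have e1 : conv (ufun a) (ufun (umul b c)) = conv (ufun a) (umulfun b c).
  apply: conv_ufun_ae => //; [exact: LwU|exact: Lw_umulfun|exact: aeW].
have e2 : conv (ufun (umul a b)) (ufun c) = conv (umulfun a b) (ufun c).
  apply: conv_ufun_ae => //; [exact: LwU|exact: Lw_umulfun|exact: aeW].
have [[L1a _] [L1b _] [L1c _]] := And3 La Lb Lc.
have r1 := convDr hK hmu L1a (L1D (L1Z (ucst b) L1c) (L1Z (ucst c) L1b)) (Lbc.1).
have r2 := convDr hK hmu L1a (L1Z (ucst b) L1c) (L1Z (ucst c) L1b).
have r3 := convZr hK hmu (ucst b) L1a L1c.
have r4 := convZr hK hmu (ucst c) L1a L1b.
have l1 := convDl hK hmu (L1D (L1Z (ucst a) L1b) (L1Z (ucst b) L1a)) (Lab.1) L1c.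
have l2 := convDl hK hmu (L1Z (ucst a) L1b) (L1Z (ucst b) L1a) L1c.
have l3 := convZl hK hmu (ucst a) L1b L1c.
have l4 := convZl hK hmu (ucst b) L1a L1c.
have as1 := convA hK hmu L1a L1b L1c.
near=> x; rewrite (near h1 x)// (near h2 x)// /umulfun e1 e2 (near h3 x)// (near h4 x)//.
rewrite /umulfun (near r1 x)// (near r2 x)// (near r3 x)// (near r4 x)//.
rewrite (near l1 x)// (near l2 x)// (near l3 x)// (near l4 x)// (near as1 x)//=; ring.
Unshelve. all: by end_near. Qed.

Fact umul1 : left_id uone umul.
Proof.
move=> a; apply: unitz_eq; first exact: mul1r.
have h1 := ufunM uone a; have h2 := ufun1.
have e : conv (ufun uone) (ufun a) = conv (fun=> 0) (ufun a).
  by apply: conv_ufun_ae => //; [exact: LwU|exact: LwU|exact: Lw0|exact: LwU|exact: aeW].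
near=> x; rewrite (near h1 x)// /umulfun e (near h2 x)// conv0l /=; ring.
Unshelve. all: by end_near. Qed.

Fact umulr1 : right_id uone umul.
Proof.
move=> a; apply: unitz_eq; first exact: mulr1.
have h1 := ufunM a uone; have h2 := ufun1.
have e : conv (ufun a) (ufun uone) = conv (ufun a) (fun=> 0).
  by apply: conv_ufun_ae => //; [exact: LwU|exact: LwU|exact: LwU|exact: Lw0|exact: aeW].
near=> x; rewrite (near h1 x)// /umulfun e (near h2 x)// conv0r /=; ring.
Unshelve. all: by end_near. Qed.

Fact umulDl : left_distributive umul uadd.
Proof.
move=> a b c; apply: unitz_eq; first exact: mulrDl.
have h1 := ufunM (uadd a b) c; have h2 := ufunD (umul a c) (umul b c).
have h3 := ufunM a c; have h4 := ufunM b c; have h5 := ufunD a b.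
have e : conv (ufun (uadd a b)) (ufun c) = conv (fun x => ufun a x + ufun b x) (ufun c).
  by apply: conv_ufun_ae => //; [exact: LwU|exact: LwU|apply: LwD; exact: LwU|exact: LwU|exact: aeW].
have l := convDl hK hmu (LwU a).1 (LwU b).1 (LwU c).1.
near=> x; rewrite (near h1 x)// (near h2 x)// (near h3 x)// (near h4 x)//.
rewrite /umulfun e (near h5 x)// (near l x)//=; ring.
Unshelve. all: by end_near. Qed.

Fact umulDr : right_distributive umul uadd.
Proof.
move=> a b c; apply: unitz_eq; first exact: mulrDr.
have h1 := ufunM a (uadd b c); have h2 := ufunD (umul a b) (umul a c).
have h3 := ufunM a b; have h4 := ufunM a c; have h5 := ufunD b c.
have e : conv (ufun a) (ufun (uadd b c)) = conv (ufun a) (fun x => ufun b x + ufun c x).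
  by apply: conv_ufun_ae => //; [exact: LwU|exact: LwU|exact: LwU|apply: LwD; exact: LwU|exact: aeW].
have l := convDr hK hmu (LwU a).1 (LwU b).1 (LwU c).1.
near=> x; rewrite (near h1 x)// (near h2 x)// (near h3 x)// (near h4 x)//.
rewrite /umulfun e (near h5 x)// (near l x)//=; ring.
Unshelve. all: by end_near. Qed.

HB.instance Definition _ := GRing.Zmodule_isPzRing.Build unitz
  umulA umul1 umulr1 umulDl umulDr.

Lemma ucstD a b : ucst (a + b) = ucst a + ucst b. Proof. by []. Qed.
Lemma ucstN a : ucst (- a) = - ucst a. Proof. by []. Qed.
Lemma ucstM a b : ucst (a * b) = ucst a * ucst b. Proof. by []. Qed.

Definition n1U a := `|ucst a| + norm1 (ufun a).
Definition nwU a := `|ucst a| + normw (ufun a).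

Let mU a : measurable_fun setT (ufun a). Proof. exact: Lw_measurable (LwU a). Qed.
Let LU a : L1 (ufun a). Proof. exact: (LwU a).1. Qed.

Lemma n1U_ge0 a : 0 <= n1U a.
Proof. by rewrite addr_ge0// norm1_ge0. Qed.

Lemma n1U_eq0 a : n1U a = 0 -> a = 0.
Proof.
move/eqP; rewrite paddr_eq0 ?norm1_ge0// normr_eq0 => /andP[/eqP c0 /eqP f0].
apply: unitz_eq => //; have h1 := norm1_eq0 (LU a) f0; have h2 := ufun0.
near=> x; rewrite (near h1 x)// (near h2 x)//.
Unshelve. all: by end_near. Qed.

Lemma n1U_le_nwU a : n1U a <= nwU a.
Proof. by rewrite lerD2l norm1_le_normw//; exact: LwU. Qed.

Lemma n1U_D a b : n1U (a + b) <= n1U a + n1U b.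
Proof.
rewrite /n1U addrACA; apply: lerD; first exact: ler_normD.
rewrite (norm1_ae (mU _) _ (ufunD a b)); last exact: measurable_funD.
exact: norm1D.
Qed.

Lemma nwU_D a b : nwU (a + b) <= nwU a + nwU b.
Proof.
rewrite /nwU addrACA; apply: lerD; first exact: ler_normD.
rewrite (normw_ae (LwU _) _ (ufunD a b)); last exact: LwD (LwU a) (LwU b).
exact: normwD (LwU a) (LwU b).
Qed.

Lemma ufunN1 a : {ae mu, forall x, ufun (- a) x = -1 * ufun a x}.
Proof. by apply: ae_mono (ufunN a) => x ->; rewrite mulN1r. Qed.

Lemma n1U_N a : n1U (- a) = n1U a.
Proof.
rewrite /n1U ucstN normrN (norm1_ae (mU _) _ (ufunN1 a)); last exact: measurable_funM.
by rewrite norm1Z// normrN1 mul1r.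
Qed.

Lemma nwU_N a : nwU (- a) = nwU a.
Proof.
rewrite /nwU ucstN normrN (normw_ae (LwU _) _ (ufunN1 a)); last exact: LwZ (LwU a).
by rewrite normwZ ?normrN1 ?mul1r//; exact: LwU.
Qed.

Lemma n1U_M a b : n1U (a * b) <= n1U a * n1U b.
Proof.
rewrite /n1U ucstM normrM (norm1_ae (mU _) _ (ufunM a b)); last exact: Lw_measurable (Lw_umulfun a b).
have Lab := L1_conv (LU a) (LU b).
have := norm1D (L1D (L1Z (ucst a) (LU b)) (L1Z (ucst b) (LU a))) Lab.
have := norm1D (L1Z (ucst a) (LU b)) (L1Z (ucst b) (LU a)).
rewrite !norm1Z//; have := norm1_conv hK hmu (LU a) (LU b).
rewrite -/(umulfun a b); lra.
Qed.

Lemma nwU_M a b : nwU (a * b) <= nwU a * n1U b + n1U a * nwU b.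
Proof.
rewrite /nwU /n1U ucstM normrM (normw_ae (LwU _) _ (ufunM a b)); last exact: Lw_umulfun.
have Lab := Lw_conv (LwU a) (LwU b).
have := normwD (LwD (LwZ (ucst a) (LwU b)) (LwZ (ucst b) (LwU a))) Lab.
have := normwD (LwZ (ucst a) (LwU b)) (LwZ (ucst b) (LwU a)).
rewrite !normwZ; try exact: LwU.
have [_] := Lw_conv_bound (LwU a) (LwU b).
rewrite -/(umulfun a b).
have := mulr_ge0 (normr_ge0 (ucst b)) (norm1_ge0 mu (ufun a)).
have := mulr_ge0 (normr_ge0 (ucst a)) (norm1_ge0 mu (ufun b)).
have := mulr_ge0 (normr_ge0 (ucst a)) (normr_ge0 (ucst b)).
have := mulr_ge0 (normr_ge0 (ucst b)) (norm1_ge0 mu (weighted (ufun a))).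
have := mulr_ge0 (normr_ge0 (ucst a)) (norm1_ge0 mu (weighted (ufun b))).
rewrite -/(normw (ufun a)) -/(normw (ufun b)); lra.
Qed.

Lemma cauchy_geometric (c : nat -> R) (B r : R) : 0 <= B -> 0 < r -> r < 1 ->
  (forall N, `|c N.+1 - c N| <= B * r ^+ N) -> cvgn c.
Proof.
move=> B0 r0 r1 cB.
rewrite (_ : c = (fun n => c 0%N + series (telescope c) n)); last first.
  by apply/funext => n; exact: (eq_sum_telescope c n).
apply: is_cvgD; first exact: is_cvg_cst.
apply: normed_cvg; apply: (series_le_cvg (v_ := geometric B r)).
- by move=> n; exact: normr_ge0.
- by move=> n; apply: mulr_ge0 => //; apply: exprn_ge0; exact: ltW.
- exact: cB.
- by apply: is_cvg_geometric_series; rewrite ger0_norm// ltW.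
Qed.

(** Functions are multiplied by w, the limit is taken in L1, and divided by w. *)
Lemma unitz_complete (u : nat -> unitz) (B r : R) : 0 <= B -> 0 < r -> r < 1 ->
  (forall N, nwU (u N.+1 - u N) <= B * r ^+ N) ->
  exists V, forall e, 0 < e -> exists N0, forall N, (N0 <= N)%N -> n1U (V - u N) <= e.
Proof.
move=> B0 r0 r1 uB.
have cc : cvgn (fun N => ucst (u N)).
  apply: (cauchy_geometric B0 r0 r1) => N; apply: le_trans (uB N).
  by rewrite lerDl norm1_ge0.
have Lwu N : mu.-integrable setT (EFin \o weighted (ufun (u N))) by exact: (LwU (u N)).2.
have fB N : \int[mu]_x `|weighted (ufun (u N.+1)) x - weighted (ufun (u N)) x| <= B * r ^+ N.
  apply: le_trans (uB N); rewrite le_eqVlt; apply/orP.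
  have : \int[mu]_x `|weighted (ufun (u N.+1)) x - weighted (ufun (u N)) x| = normw (ufun (u N.+1 - u N)).
    have h1 := ufunD (u N.+1) (- u N); have h2 := ufunN (u N).
    apply: ae_eq_RintegralT.
    - apply: measurableT_comp => //; apply: measurable_funB; exact: measurable_funM.
    - by apply: measurableT_comp => //; exact: measurable_funM.
    near=> x; rewrite /weighted (near h1 x)// (near h2 x)// mulrBl//.
  move=> ->; apply/orP; rewrite -le_eqVlt lerDr//.
have [h [Lh hcvg]] := L1_complete Lwu B0 r0 r1 fB.
pose g x := h x / w x.
have w0 x : w x != 0 by rewrite gt_eqF// (lt_le_trans ltr01).
have gw : weighted g = h by apply/funext => x; rewrite /weighted divfK.
have mg : measurable_fun setT g.
  apply: measurable_funM; first exact: L1_measurable Lh.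
  rewrite (_ : (fun x => _) = fun x => w x `^ (-1)); last by apply/funext => x; rewrite powR_inv1.
  exact: (@measurableT_comp _ _ _ _ _ _ (@powR R ^~ (-1)) _ w).
have Lg : Lw g.
  have Lgw : L1 (weighted g) by rewrite gw.
  split => //; apply: (L1_dominated mg (g := fun x => `|weighted g x|)); last exact: L1_abs.
  by move=> x; rewrite /weighted /= [leRHS]normrM ler_peMr// ger0_norm.
exists (mkU (limn (fun N => ucst (u N))) g) => e e0.
have e20 : 0 < e / 2 by rewrite divr_gt0.
have /cvgrPdist_le /(_ _ e20)[N1 _ N1P] : (fun N => ucst (u N)) @ \oo --> limn (fun N => ucst (u N)).
  exact: cc.
move/cvgr0_norm_lt : hcvg => /(_ _ e20)[N2 _ N2P].
exists (maxn N1 N2) => N; rewrite geq_max => /andP[/N1P h1 /N2P /ltW h2].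
rewrite [e]splitr /n1U; apply: lerD => //.
apply: le_trans h2; rewrite ger0_norm; last exact: Rintegral_ge0.
set V := mkU _ g.
apply: (le_trans (norm1_le_normw (LwU _))); rewrite le_eqVlt; apply/orP; left; apply/eqP.
have k1 := ufunD V (- u N); have k2 := ufunN (u N); have k3 := ufun_mkU (limn (fun N => ucst (u N))) Lg.
apply: ae_eq_RintegralT.
- by apply: measurableT_comp => //; exact: measurable_funM.
- apply: measurableT_comp => //; apply: measurable_funB; first exact: measurable_funM.
  exact: L1_measurable Lh.
near=> x; rewrite /weighted (near k1 x)// (near k2 x)// (near k3 x)// distrC -gw /weighted mulrBl//.
Unshelve. all: by end_near. Qed.

Definition usc (r : R) : unitz := mkU r (fun=> 0).

Lemma ufun_usc r : {ae mu, forall x, ufun (usc r) x = 0}.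
Proof. exact: ufun_mkU Lw0. Qed.

Lemma ufun_uscM r a : {ae mu, forall x, ufun (usc r * a) x = r * ufun a x}.
Proof.
have h1 := ufunM (usc r) a; have h2 := ufun_usc r.
have e : conv (ufun (usc r)) (ufun a) = conv (fun=> 0) (ufun a).
  by apply: conv_ufun_ae => //; [exact: LwU|exact: LwU|exact: Lw0|exact: LwU|exact: aeW].
near=> x; rewrite (near h1 x)// /umulfun e (near h2 x)// conv0l /=; ring.
Unshelve. all: by end_near. Qed.

Lemma usc_central r a : usc r * a = a * usc r.
Proof.
have h0 := ufun_uscM r a; have h1 := ufunM a (usc r); have h2 := ufun_usc r.
have e : conv (ufun a) (ufun (usc r)) = conv (ufun a) (fun=> 0).
  by apply: conv_ufun_ae => //; [exact: LwU|exact: LwU|exact: LwU|exact: Lw0|exact: aeW].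
apply: unitz_eq; first exact: mulrC.
near=> x; rewrite (near h0 x)// (near h1 x)// /umulfun e (near h2 x)// conv0r /=; ring.
Unshelve. all: by end_near. Qed.

Lemma uscB r s : usc (r - s) = usc r - usc s.
Proof.
have h1 := ufunD (usc r) (- usc s); have h2 := ufunN (usc s).
have h3 := ufun_usc r; have h4 := ufun_usc s; have h5 := ufun_usc (r - s).
apply: unitz_eq => //.
near=> x; rewrite (near h1 x)// (near h2 x)// (near h3 x)// (near h4 x)// (near h5 x)// subr0//.
Unshelve. all: by end_near. Qed.

Lemma uscM r s : usc (r * s) = usc r * usc s.
Proof.
have h1 := ufun_uscM r (usc s); have h4 := ufun_usc s; have h5 := ufun_usc (r * s).
apply: unitz_eq => //.
near=> x; rewrite (near h1 x)// (near h4 x)// (near h5 x)// mulr0//.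
Unshelve. all: by end_near. Qed.

Lemma n1U_usc r : n1U (usc r) = `|r|.
Proof.
rewrite /n1U (norm1_ae (mU _) (measurable_cst _) (ufun_usc r)).
by rewrite norm1_0 addr0.
Qed.

(** Classes of bounded functions. They form a left ideal on which the L2 inner
    product ipU is finite. *)
Definition JU a := ucst a = 0 /\ exists g B,
  [/\ Lw g, forall x, `|g x| <= B & {ae mu, forall x, ufun a x = g x}].
Definition ipU a b := \int[mu]_x (ufun a x * ufun b x).

Lemma JU_D a b : JU a -> JU b -> JU (a + b).
Proof.
move=> [a0 [g [A [Lg gA ag]]]] [b0 [h [B [Lh hB bh]]]]; split; first by rewrite ucstD a0 b0 addr0.
exists (fun x => g x + h x), (A + B); split; first exact: LwD.
  by move=> x; apply: (le_trans (ler_normD _ _)); exact: lerD.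
have h1 := ufunD a b; near=> x; rewrite (near h1 x)// (near ag x)// (near bh x)//.
Unshelve. all: by end_near. Qed.

Lemma JU_M a b : JU b -> JU (a * b).
Proof.
move=> [b0 [h [B [Lh hB bh]]]]; split; first by rewrite ucstM b0 mulr0.
have h1 := ufunM a b.
have e : conv (ufun a) (ufun b) = conv (ufun a) h.
  by apply: conv_ufun_ae => //; [exact: LwU|exact: LwU|exact: LwU|exact: aeW].
exists (fun x => ucst a * h x + conv (ufun a) h x), (`|ucst a| * B + B * norm1 (ufun a)); split.
- by apply: LwD; [exact: LwZ|exact: Lw_conv (LwU a) Lh].
- move=> x; apply: (le_trans (ler_normD _ _)); rewrite normrM; apply: lerD.
    exact: ler_wpM2l.
  exact: (conv_bounded hK hmu x (LU a) (Lw_measurable Lh) hB).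
- near=> x; rewrite (near h1 x)// /umulfun e b0 mul0r addr0 (near bh x)//.
Unshelve. all: by end_near. Qed.

Lemma ipU_rep a b g h : Lw g -> Lw h -> {ae mu, forall x, ufun a x = g x} ->
  {ae mu, forall x, ufun b x = h x} -> ipU a b = \int[mu]_x (g x * h x).
Proof.
move=> Lg Lh ag bh; apply: ae_eq_RintegralT.
- exact: measurable_funM.
- by apply: measurable_funM; [exact: Lw_measurable Lg|exact: Lw_measurable Lh].
- by near=> x; rewrite (near ag x)// (near bh x)//.
Unshelve. all: by end_near. Qed.

Lemma ipU_C a b : ipU a b = ipU b a.
Proof. by apply: eq_Rintegral => x _; rewrite mulrC. Qed.

Lemma ipU_ge0 a : 0 <= ipU a a.
Proof. by apply: Rintegral_ge0 => x _; rewrite -expr2 sqr_ge0. Qed.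

Lemma JU_L1 a b : JU a -> JU b -> L1 (fun x => ufun a x * ufun b x).
Proof.
move=> _ [b0 [h [B [Lh hB bh]]]].
apply: (L1_ae (f := fun x => ufun a x * h x)); first exact: measurable_funM.
  by near=> x; rewrite (near bh x).
by apply: (L1_bounded (b := B)) => //; exact: Lw_measurable.
Unshelve. all: by end_near. Qed.

Lemma ipU_D a b c : JU a -> JU b -> JU c -> ipU (a + b) c = ipU a c + ipU b c.
Proof.
move=> Ja Jb Jc; rewrite /ipU -RintegralD//; try exact: JU_L1.
have h1 := ufunD a b; apply: ae_eq_RintegralT; first exact: measurable_funM.
  by apply: measurable_funD; exact: measurable_funM.
by near=> x; rewrite (near h1 x)// mulrDl.
Unshelve. all: by end_near. Qed.

Lemma ipU_Z r a c : JU a -> JU c -> ipU (usc r * a) c = r * ipU a c.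
Proof.
move=> Ja Jc; rewrite /ipU -RintegralZl//; last exact: JU_L1.
have h1 := ufun_uscM r a; apply: ae_eq_RintegralT; first exact: measurable_funM.
  by apply: measurable_funM => //; exact: measurable_funM.
by near=> x; rewrite (near h1 x)// mulrA.
Unshelve. all: by end_near. Qed.

Lemma ufun_M0 a b h : ucst a = 0 -> ucst b = 0 -> Lw h ->
  {ae mu, forall x, ufun b x = h x} -> {ae mu, forall x, ufun (a * b) x = conv (ufun a) h x}.
Proof.
move=> a0 b0 Lh bh; have h1 := ufunM a b.
have e : conv (ufun a) (ufun b) = conv (ufun a) h.
  by apply: conv_ufun_ae => //; [exact: LwU|exact: LwU|exact: LwU|exact: aeW].
by near=> x; rewrite (near h1 x)// /umulfun e a0 b0 !mul0r !add0r.
Unshelve. all: by end_near. Qed.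

(** The factor eps is 1 for the real part of a self-adjoint function and -1 for
    its imaginary part. *)
Lemma ipU_adjoint eps a b c : ucst a = 0 ->
  {ae mu, forall x, reflect (ufun a) x = eps * ufun a x} -> JU b -> JU c ->
  ipU (a * b) c = eps * ipU b (a * c).
Proof.
move=> a0 ra [b0 [g [A [Lg gA bg]]]] [c0 [h [B [Lh hB ch]]]].
pose M := Num.max A B.
have gM x : `|g x| <= M by apply: (le_trans (gA x)); rewrite le_max lexx.
have hM x : `|h x| <= M by apply: (le_trans (hB x)); rewrite le_max lexx orbT.
have Lag := Lw_conv (LwU a) Lg; have Lah := Lw_conv (LwU a) Lh.
rewrite (ipU_rep Lag Lh (ufun_M0 a0 b0 Lg bg) ch).
rewrite (ipU_rep Lg Lah bg (ufun_M0 a0 c0 Lh ch)).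
rewrite (conv_adjoint hK hmu (LU a) Lg.1 Lh.1 gM hM).
have -> : conv (reflect (ufun a)) h = conv (fun x => eps * ufun a x) h.
  apply: (conv_ae hK hmu) => //; last exact: aeW.
  - exact: L1_measurable (L1_reflect hK hmu (LU a)).
  - exact: Lw_measurable.
  - exact: measurable_funM.
  - exact: Lw_measurable.
have z := convZl hK hmu eps (LU a) Lh.1.
rewrite -RintegralZl//; last first.
  have -> : (EFin \o (fun x => g x * conv (ufun a) h x)) = (EFin \o (fun x => conv (ufun a) h x * g x)).
    by apply/funext => x /=; rewrite mulrC.
  apply: (L1_bounded (b := M)) => //; [exact: Lah.1|exact: Lw_measurable].
apply: ae_eq_RintegralT.
- apply: measurable_funM; first exact: Lw_measurable.
  apply: (measurable_conv hK hmu); [exact: measurable_funM|exact: Lw_measurable].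
- apply: measurable_funM => //; apply: measurable_funM; exact: Lw_measurable.
by near=> x; rewrite (near z x)// mulrCA.
Unshelve. all: by end_near. Qed.

Lemma ipU_young a b c : ucst a = 0 -> JU b -> JU c ->
  2 * ipU (a * b) c <= norm1 (ufun a) * (ipU b b + ipU c c).
Proof.
move=> a0 [b0 [g [A [Lg gA bg]]]] [c0 [h [B [Lh hB ch]]]].
pose M := Num.max A B.
have gM x : `|g x| <= M by apply: (le_trans (gA x)); rewrite le_max lexx.
have hM x : `|h x| <= M by apply: (le_trans (hB x)); rewrite le_max lexx orbT.
have Lag := Lw_conv (LwU a) Lg.
rewrite (ipU_rep Lag Lh (ufun_M0 a0 b0 Lg bg) ch) (ipU_rep Lg Lg bg bg) (ipU_rep Lh Lh ch ch).
exact: (conv_young hK hmu (LU a) Lg.1 Lh.1 gM hM).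
Qed.

Lemma JU_approx a e : ucst a = 0 -> 0 < e -> exists2 b, JU b & n1U (a - b) <= e.
Proof.
move=> a0 e0; have [m mP] := L1_truncation (LU a) e0.
pose g x := ufun a x * (`|ufun a x| <= m)%R%:R.
have mg : measurable_fun setT g.
  apply: measurable_funM => //.
  apply: (measurableT_comp (f := fun b : bool => b%:R : R)) => //.
  by apply: measurable_fun_ler => //; exact: measurableT_comp.
have ga x : `|g x| <= `|ufun a x|.
  by rewrite /g normrM ler_piMr// ger0_norm// lern1 leq_b1.
have Lg : Lw g.
  split; first by apply: (L1_dominated mg ga); exact: L1_abs.
  apply: (L1_dominated (g := fun x => `|weighted (ufun a) x|)).
  - exact: measurable_funM.
  - by move=> x; rewrite /weighted /= normrM [leRHS]normrM; apply: ler_wpM2r => //; exact: ga.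
  - by apply: L1_abs; exact: (LwU a).2.
exists (mkU 0 g).
  split => //; exists g, `|m|; split => //; last exact: ufun_mkU.
  move=> x; rewrite /g; case: (leP `|ufun a x| m) => h; last by rewrite mulr0 normr0.
  by rewrite mulr1; apply: (le_trans h); rewrite ler_norm.
rewrite /n1U ucstD ucstN a0 subr0 normr0 add0r; apply: le_trans mP.
have h1 := ufunD a (- mkU 0 g); have h2 := ufunN (mkU 0 g); have h3 := ufun_mkU 0 Lg.
rewrite le_eqVlt; apply/orP; left; apply/eqP; apply: ae_eq_RintegralT.
- exact: measurableT_comp.
- by apply: measurableT_comp => //; exact: measurable_funB.
by near=> x; rewrite (near h1 x)// (near h2 x)// (near h3 x).
Unshelve. all: by end_near. Qed.

Variables (C0 : R) (P : nat).
Hypothesis C0_ge0 : 0 <= C0.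
Hypothesis growth : forall s, 1 <= s -> (mu [set x | w x <= s]%R <= (C0 * s ^+ P)%:E)%E.

(** Where w <= s, the bound |f| <= th + f^2 / th is integrated over a set of measure
    at most C0 * s ^+ P; elsewhere |f| <= |f| w / s. *)
Lemma JU_interpolation b th s : JU b -> 0 < th -> 1 <= s ->
  n1U b <= th * C0 * s ^+ P + ipU b b / th + nwU b / s.
Proof.
move=> Jb th0 s1; have [b0 _] := Jb; rewrite /n1U /nwU b0 normr0 !add0r.
have s0 : 0 < s by rewrite (lt_le_trans ltr01).
pose U : set (borel G) := [set x | w x <= s]%R.
have mU' : measurable U.
  rewrite -[U]setTI; have := mw measurableT (measurable_itv `]-oo, s]%R).
  by rewrite set_itvNyc.
have Ufin : (mu U < +oo)%E by rewrite (le_lt_trans (growth s1))// ltry.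
have LI : L1 (\1_U).
  apply: L1P; first exact: measurable_indic.
  under eq_integral do rewrite gee0_abs ?lee_fin//.
  by rewrite integral_indic// setIT.
have L2 : L1 (fun x => ufun b x * ufun b x) by exact: JU_L1.
have Lb := LU b; have Lbw := (LwU b).2.
apply: (@le_trans _ _ (\int[mu]_x (th * \1_U x + th^-1 * (ufun b x * ufun b x) + s^-1 * `|weighted (ufun b) x|))).
  apply: norm1_le => //.
    by apply: L1D; [apply: L1D; exact: L1Z|apply: L1Z; exact: L1_abs].
  move=> x; set f := ufun b x.
  have f2 : 0 <= th^-1 * (f * f) by apply: mulr_ge0; [rewrite invr_ge0 ltW|rewrite -expr2 sqr_ge0].
  have wf : 0 <= s^-1 * `|weighted (ufun b) x| by apply: mulr_ge0 => //; rewrite invr_ge0 ltW.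
  have [xU|xU] := leP (w x) s.
    rewrite indicE mem_set// mulr1.
    have : `|f| <= th + th^-1 * (f * f).
      rewrite -(ler_pM2l th0) mulrDr mulVKf ?gt_eqF// -[f * f]expr2 -[f ^+ 2]real_normK ?num_real//.
      by have := sqr_ge0 (th - `|f|); have := sqr_ge0 `|f|; have := sqr_ge0 th; rewrite !expr2; nra.
    lra.
  rewrite indicE memNset; last by rewrite /U /= => h; move: xU; rewrite ltNge h.
  rewrite mulr0 add0r; apply: (@le_trans _ _ (s^-1 * `|weighted (ufun b) x|)); last by rewrite lerDr.
  rewrite /weighted normrM -/f mulrCA ler_peMr// ger0_norm//.
  by rewrite mulrC ler_pdivlMr// mul1r ltW.
have LwN : L1 (fun x => `|weighted (ufun b) x|) by exact: L1_abs.
rewrite !RintegralD//; try by [exact: L1Z|apply: L1D; exact: L1Z].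
rewrite !RintegralZl//; rewrite /ipU [X in _ <= _ + X + _]mulrC [X in _ <= _ + X]mulrC.
rewrite -/(normw (ufun b)) -/(norm1 (weighted (ufun b))) lerD2r lerD2r -mulrA; apply: ler_wpM2l; first exact: ltW.
rewrite /Rintegral integral_indic// setIT -lee_fin fineK ?ge0_fin_numE//.
exact: growth.
Qed.

Let usc_zmod : zmod_morphism usc. Proof. exact: uscB. Qed.
Let usc_monoid : monoid_morphism usc. Proof. by split; [|exact: uscM]. Qed.

HB.instance Definition _ := GRing.isZmodMorphism.Build R unitz usc usc_zmod.
HB.instance Definition _ := GRing.isMonoidMorphism.Build R unitz usc usc_monoid.

Lemma ufun_shiftMl f r v : Lw f -> {ae mu, forall x, ufun ((mkU 0 f - usc r) * v) x =
  ucst v * f x + conv f (ufun v) x - r * ufun v x}.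
Proof.
move=> Lf; rewrite mulrBl.
have h0 := ufun_mkU 0 Lf; have h1 := ufunD (mkU 0 f * v) (- (usc r * v)).
have h2 := ufunN (usc r * v); have h3 := ufun_uscM r v; have h4 := ufunM (mkU 0 f) v.
have e : conv (ufun (mkU 0 f)) (ufun v) = conv f (ufun v).
  by apply: conv_ufun_ae => //; [exact: LwU|exact: LwU|exact: LwU|exact: aeW].
near=> x; rewrite (near h1 x)// (near h2 x)// (near h3 x)// (near h4 x)// /umulfun e (near h0 x)//=.
by rewrite mul0r add0r.
Unshelve. all: by end_near. Qed.

Lemma ufun_shiftMr f r v : Lw f -> {ae mu, forall x, ufun (v * (mkU 0 f - usc r)) x =
  ucst v * f x + conv (ufun v) f x - r * ufun v x}.
Proof.
move=> Lf; rewrite mulrBr -usc_central.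
have h0 := ufun_mkU 0 Lf; have h1 := ufunD (v * mkU 0 f) (- (usc r * v)).
have h2 := ufunN (usc r * v); have h3 := ufun_uscM r v; have h4 := ufunM v (mkU 0 f).
have e : conv (ufun v) (ufun (mkU 0 f)) = conv (ufun v) f.
  by apply: conv_ufun_ae => //; [exact: LwU|exact: LwU|exact: LwU|exact: aeW].
near=> x; rewrite (near h1 x)// (near h2 x)// (near h3 x)// (near h4 x)// /umulfun e (near h0 x)//=.
by rewrite mul0r addr0.
Unshelve. all: by end_near. Qed.

Lemma reflect_mkU eps f : Lw f -> {ae mu, forall x, reflect f x = eps * f x} ->
  {ae mu, forall x, reflect (ufun (mkU 0 f)) x = eps * ufun (mkU 0 f) x}.
Proof.
move=> Lf rf; have h1 := ufun_mkU 0 Lf.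
have h2 := measure_preserving_ae (measure_preserving_invg hK hmu) h1.
near=> x; rewrite (near h1 x)// -(near rf x)// /reflect; exact: (near h2 x).
Unshelve. all: by end_near. Qed.

Lemma ufun_sum0 a b : a + b = 0 -> {ae mu, forall x, ufun a x + ufun b x = 0}.
Proof.
move=> ab; have h1 := ufunD a b; have h2 := ufun0.
apply: ae_mono2 h1 h2 => x h1 h2; apply: (etrans (esym h1)); apply: etrans h2.
by congr (ufun _ x).
Qed.

Lemma ufun_sub1 a b : a - b = 1 -> {ae mu, forall x, ufun a x - ufun b x = 0}.
Proof.
move=> ab; have h1 := ufunD a (- b); have h3 := ufunN b; have h2 := ufun1.
apply: (@filterS3 _ _ ae_mu_filter _ _ _ _ _ h1 h2 h3) => x {}h1 {}h2 {}h3.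
rewrite -[- ufun b x]h3 -[LHS]h1; apply: etrans h2.
by congr (ufun _ x).
Qed.

(** The conclusion of complex_resolvent for f1 + i f2, with the inverse written as a
    scalar c1 + i c2 plus a function g1 + i g2, read on functions. *)
Theorem quasi_inverse f1 f2 (alpha beta : R) : Lw f1 -> Lw f2 ->
  {ae mu, forall x, reflect f1 x = f1 x} ->
  {ae mu, forall x, reflect f2 x = - f2 x} -> beta != 0 ->
  exists c1 c2 g1 g2, [/\ Lw g1 /\ Lw g2,
    alpha * c1 - beta * c2 = -1 /\ alpha * c2 + beta * c1 = 0,
    {ae mu, forall x, c1 * f1 x - c2 * f2 x + (conv f1 g1 x - conv f2 g2 x) =
      alpha * g1 x - beta * g2 x /\
      c2 * f1 x + c1 * f2 x + (conv f1 g2 x + conv f2 g1 x) =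
      alpha * g2 x + beta * g1 x} &
    {ae mu, forall x, c1 * f1 x - c2 * f2 x + (conv g1 f1 x - conv g2 f2 x) =
      alpha * g1 x - beta * g2 x /\
      c2 * f1 x + c1 * f2 x + (conv g1 f2 x + conv g2 f1 x) =
      alpha * g2 x + beta * g1 x}].
Proof.
move=> Lf1 Lf2 rf1 rf2 beta0.
pose a1 := mkU 0 f1; pose a2 := mkU 0 f2.
have c1 : ucst a1 = 0 by []. have c2 : ucst a2 = 0 by [].
have ra1 : {ae mu, forall x, reflect (ufun a1) x = 1 * ufun a1 x}.
  by apply: reflect_mkU => //; apply: ae_mono rf1 => x ->; rewrite mul1r.
have ra2 : {ae mu, forall x, reflect (ufun a2) x = -1 * ufun a2 x}.
  by apply: reflect_mkU => //; apply: ae_mono rf2 => x ->; rewrite mulN1r.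
have sym1 b c : JU b -> JU c -> ipU (a1 * b) c = ipU b (a1 * c).
  by move=> Jb Jc; rewrite (ipU_adjoint c1 ra1 Jb Jc) mul1r.
have sym2 b c : JU b -> JU c -> ipU (a2 * b) c = - ipU b (a2 * c).
  by move=> Jb Jc; rewrite (ipU_adjoint c2 ra2 Jb Jc) mulN1r.
have [v1 [v2 [e1 e2 e3 e4]]] := complex_resolvent n1U_ge0 n1U_D n1U_N n1U_M n1U_eq0
  nwU_D nwU_N n1U_le_nwU nwU_M unitz_complete usc_central n1U_usc JU_D JU_M
  ipU_C ipU_D ipU_Z ipU_ge0 C0_ge0 JU_interpolation
  (norm1_ge0 mu (ufun a1)) (norm1_ge0 mu (ufun a2)) sym1 sym2
  (fun b c => ipU_young c1) (fun b c => ipU_young c2)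
  (fun e => JU_approx c1) (fun e => JU_approx c2) alpha beta0.
have lin1 (p1 p2 a b F1 F2 g1 g2 x y : R) :
    p1 * F1 + x - a * g1 - (p2 * F2 + y - b * g2) = 0 ->
    p1 * F1 - p2 * F2 + (x - y) = a * g1 - b * g2 by lra.
have lin2 (p1 p2 a b F1 F2 g1 g2 x y : R) :
    p2 * F1 + x - a * g2 + (p1 * F2 + y - b * g1) = 0 ->
    p2 * F1 + p1 * F2 + (x + y) = a * g2 + b * g1 by lra.
have lin3 (p1 p2 a b F1 F2 g1 g2 x y : R) :
    p1 * F2 + x - b * g1 + (p2 * F1 + y - a * g2) = 0 ->
    p2 * F1 + p1 * F2 + (x + y) = a * g2 + b * g1 by lra.
exists (ucst v1), (ucst v2), (ufun v1), (ufun v2); split.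
- by split; exact: LwU.
- have k1 : (0 - alpha) * ucst v1 - (0 - beta) * ucst v2 = 1 := congr1 ucst e1.
  have k2 : (0 - alpha) * ucst v2 + (0 - beta) * ucst v1 = 0 := congr1 ucst e2.
  by move: (ucst v1) (ucst v2) k1 k2 => p1 p2 k1 k2; split; lra.
- have l11 := ufun_shiftMl alpha v1 Lf1; have l12 := ufun_shiftMl alpha v2 Lf1.
  have l21 := ufun_shiftMl beta v1 Lf2; have l22 := ufun_shiftMl beta v2 Lf2.
  have d1 := ufun_sub1 e1; have d2 := ufun_sum0 e2.
  apply: (@filterS _ _ ae_mu_filter _ _ _ (filterI (filterI l11 (filterI l12 (filterI l21 l22))) (filterI d1 d2))).
  move=> x [[E11 [E12 [E21 E22]]] [D1 D2]].
  have Q1 := etrans (esym (congr2 (fun p q : R => p - q) E11 E22)) D1.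
  have Q2 := etrans (esym (congr2 (fun p q : R => p + q) E12 E21)) D2.
  by split; [exact: (lin1 _ _ _ _ _ _ _ _ _ _ Q1)|exact: (lin2 _ _ _ _ _ _ _ _ _ _ Q2)].
- have l11 := ufun_shiftMr alpha v1 Lf1; have l12 := ufun_shiftMr alpha v2 Lf1.
  have l21 := ufun_shiftMr beta v1 Lf2; have l22 := ufun_shiftMr beta v2 Lf2.
  have d1 := ufun_sub1 e3; have d2 := ufun_sum0 e4.
  apply: (@filterS _ _ ae_mu_filter _ _ _ (filterI (filterI l11 (filterI l12 (filterI l21 l22))) (filterI d1 d2))).
  move=> x [[E11 [E12 [E21 E22]]] [D1 D2]].
  have Q1 := etrans (esym (congr2 (fun p q : R => p - q) E11 E22)) D1.
  have Q2 := etrans (esym (congr2 (fun p q : R => p + q) E21 E12)) D2.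
  by split; [exact: (lin1 _ _ _ _ _ _ _ _ _ _ Q1)|exact: (lin3 _ _ _ _ _ _ _ _ _ _ Q2)].
Qed.

End WeightedAlgebra.

(** * The weight of a locally elliptic group *)

Section Omega.
Variables (R : realType) (G : topologicalGroupType) (K : nat -> set G) (a : nat -> R).
Hypothesis hK : locally_elliptic K.
Hypothesis a_ge1 : forall i, 1 <= a i.
Hypothesis a_nd : forall i j, (i <= j)%N -> a i <= a j.
Local Notation w := (omega K a).

Lemma first_level (x : G) : exists n, K n x /\ forall i, (i < n)%N -> ~ K i x.
Proof.
have : exists n, `[< K n x >].
  have [n _ Kx] : (\bigcup_i K i) x by rewrite (le_cover hK).
  by exists n; apply/asboolP.
move=> h; have [n /asboolP Kn nmin] := find_ex_minn h.
exists n; split => // i lt Ki; have /asboolP/nmin := Ki.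
by rewrite leqNgt lt.
Qed.

Lemma omega_first (x : G) n : K n x -> (forall i, (i < n)%N -> ~ K i x) -> w x = a n.
Proof.
move=> Kn nK; rewrite /omega.
have term i : (0 < i)%N -> a i * \1_(K i `\` K i.-1) x = if i == n then a n else 0.
  move=> i0; rewrite indicE; have [E|ni] := eqVneq i n.
    subst i; rewrite mem_set ?mulr1//; split => //; apply: nK.
    by rewrite ltn_predL.
  rewrite memNset ?mulr0// => -[Ki nKi].
  have [lt|lt|eq] := ltngtP i n; [exact: nK lt Ki| |by rewrite eq eqxx in ni].
  apply: nKi; apply: (level_mono hK) Kn.
  by rewrite -ltnS prednK.
have [n0|n0] := posnP n.
  subst n; rewrite indicE mem_set// mulr1.
  rewrite (_ : (fun m => _) = fun=> 0); first by rewrite lim_cst ?addr0.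
  apply/funext => m; rewrite big_nat big1// => i /andP[i0 _].
  by rewrite term// gtn_eqF.
rewrite indicE memNset ?mulr0 ?add0r; last exact: nK.
apply/cvg_lim => //; apply: cvg_near_cst; near=> m.
have nm : (n < m)%N by near: m; exact: nbhs_infty_gt.
rewrite (bigD1_seq n) ?mem_index_iota ?n0 ?nm ?iota_uniq//=.
rewrite term// eqxx big1_seq ?addr0// => i /andP[ni]; rewrite mem_index_iota => /andP[i0 _].
by rewrite term// (negbTE ni).
Unshelve. all: by end_near. Qed.

Lemma omega_le (x : G) n : K n x -> w x <= a n.
Proof.
move=> Kn; have [m [Km mK]] := first_level x.
rewrite (omega_first Km mK); apply: a_nd; rewrite leqNgt; apply/negP => /mK.
exact.
Qed.

Lemma omega_ge1 (x : G) : 1 <= w x.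
Proof. by have [m [Km mK]] := first_level x; rewrite (omega_first Km mK). Qed.

(** The larger of the two levels is a subgroup that contains both points, so that
    the weight of the product is at most the maximum of the weights. *)
Lemma omega_subadditive (x y : G) : w (x * y)%g <= w x + w y.
Proof.
have [m [Km mK]] := first_level x; have [n [Kn nK]] := first_level y.
rewrite (omega_first Km mK) (omega_first Kn nK).
have am := a_ge1 m; have an := a_ge1 n.
have [mn|/ltnW nm] := leqP m n.
  apply: (@le_trans _ _ (a n)); last lra.
  by apply: omega_le; apply: (level_mul hK) => //; exact: (level_mono hK mn).
apply: (@le_trans _ _ (a m)); last lra.
by apply: omega_le; apply: (level_mul hK) => //; exact: (level_mono hK nm).
Qed.

Lemma omega_sublevel (s : R) :
  [set x | w x <= s]%R = \bigcup_(i in [set i | a i <= s]%R) K i.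
Proof.
apply/seteqP; split=> [x /= wx|x [i /= ais Ki]].
  have [m [Km mK]] := first_level x.
  by exists m => //=; rewrite -(omega_first Km mK).
exact: le_trans (omega_le Ki) ais.
Qed.

Let measurableK n : measurable (K n : set (borel G)).
Proof. by apply: open_measurable_borel; exact: le_open hK n. Qed.

Lemma measurable_omega_sublevel (s : R) :
  measurable ([set x | w x <= s]%R : set (borel G)).
Proof.
rewrite omega_sublevel; apply: bigcup_measurable => i _; exact: measurableK.
Qed.

Lemma measurable_omega : measurable_fun setT (w : borel G -> R).
Proof.
apply: (measurability _ (RGenOInfty.measurableE R)).
move=> _ [_ [s ->] <-]; rewrite setTI.
rewrite (_ : _ @^-1` _ = ~` [set x | w x <= s]%R).
  by apply: measurableC; exact: measurable_omega_sublevel.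
by apply/seteqP; split=> x /=; rewrite in_itv/= andbT ltNge => /negP.
Qed.

Variable mu : {measure set (borel G) -> \bar R}.

(** Chebyshev's inequality: on the part of a slice where the weight is at most s, the
    term of the series is at least the measure times s `^ (- p). The exponent is then
    rounded up to an integer. *)
Lemma omega_growth (p : R) : 0 < p ->
  (mu (K 0%N) * ((a 0%N `^ p)^-1)%:E +
     \sum_(1 <= i <oo) (mu (K i `\` K i.-1) * ((a i `^ p)^-1)%:E) < +oo)%E ->
  exists (C0 : R) (P : nat), 0 <= C0 /\
    forall s, 1 <= s -> (mu [set x | w x <= s]%R <= (C0 * s ^+ P)%:E)%E.
Proof.
move=> p0; set S := (_ + _)%E => Sfin.
pose D := seqD K.
have mD i : measurable (D i : set (borel G)).
  by case: i => [|i] //=; exact: measurableD.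
have ndK : nondecreasing_seq (K : nat -> set (borel G)).
  by move=> i j ij; apply/subsetPset; exact: (level_mono hK).
have t0 i : (0 <= mu (D i) * ((a i `^ p)^-1)%:E)%E.
  by rewrite mule_ge0// lee_fin invr_ge0 powR_ge0.
have SE : S = (\sum_(i <oo) (mu (D i) * ((a i `^ p)^-1)%:E))%E.
  rewrite (@nneseries_split _ _ 0%N 1%N)//.
  rewrite big_nat1 /S add0n; congr (_ + _)%E.
  apply: congr_lim; apply/funext => n; apply: eq_big_nat => i /andP[i0 _].
  by case: i i0.
have S0 : (0 <= S)%E by rewrite SE; apply: nneseries_ge0 => i _ _; exact: t0.
have Snum : S \is a fin_num by rewrite ge0_fin_numE.
exists (fine S), (Num.truncn p).+1; split; first exact: fine_ge0.
move=> s s1; set U := [set x | _].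
have mU : measurable (U : set (borel G)) by exact: measurable_omega_sublevel.
have s0 : 0 <= s by exact: le_trans ler01 s1.
have UE : U = \bigcup_i (U `&` D i) :> set (borel G).
  by rewrite -setI_bigcupr eq_bigcup_seqD (le_cover hK) setIT.
rewrite UE measure_semi_bigcup; last 3 first.
- by move=> i; exact: measurableI.
- by apply: trivIset_setIl; exact: trivIset_seqD.
- by apply: bigcup_measurable => i _; exact: measurableI.
have bound i : (mu (U `&` D i) <= (s `^ p)%:E * (mu (D i) * ((a i `^ p)^-1)%:E))%E.
  have ap : 0 < a i `^ p by rewrite powR_gt0// (lt_le_trans ltr01).
  have [ais|ais] := leP (a i) s.
    rewrite muleCA -EFinM; apply: (@le_trans _ _ (mu (D i))).
      by apply: le_measure; rewrite ?inE//; exact: measurableI.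
    rewrite -[leLHS]mule1; apply: lee_wpmul2l => //.
    rewrite lee_fin ler_pdivlMr// mul1r; apply: ge0_ler_powR => //; first exact: ltW.
    by rewrite nnegrE (le_trans ler01).
  rewrite (_ : U `&` D i = set0) ?measure0.
    by rewrite mule_ge0// lee_fin powR_ge0.
  rewrite -subset0 => x [/= wx Dx]; move: wx; apply/negP; rewrite -ltNge.
  apply: (lt_le_trans ais).
  have [m [Km mK]] := first_level x; rewrite (omega_first Km mK); apply: a_nd.
  rewrite leqNgt; apply/negP => mi.
  case: i mi Dx {ais ap} => [//|i] mi [_] /=; apply; exact: (level_mono hK (mi : (m <= i)%N) Km).
apply: (@le_trans _ _ ((s `^ p)%:E * S)%E).
  rewrite SE -nneseriesZl//.
  by apply: lee_nneseries => // i _; exact: bound.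
rewrite -[S in leLHS](fineK Snum) -EFinM lee_fin mulrC; apply: ler_wpM2l; first exact: fine_ge0.
rewrite -powR_mulrn//; apply: ler_powR => //.
by apply: ltW; exact: (real_truncnS_gt (num_real p)).
Qed.

End Omega.

(** * Complex-valued functions and the spectrum *)

Section ComplexValued.
Variables (R : realType) (G : topologicalGroupType) (K : nat -> set G).
Variable mu : {sigma_finite_measure set (borel G) -> \bar R}.
Hypotheses (hK : locally_elliptic K) (hmu : left_haar mu).
Local Notation C := R[i].
Local Notation Re := complex.Re.
Local Notation Im := complex.Im.
Implicit Types f g h : G -> C.
Local Notation CI := (cintegrable mu).
Local Notation cint := (cintegral mu).
Local Notation convC := (convolution mu).
Local Notation conv := (conv mu).

Lemma complexP (x y : C) : Re x = Re y -> Im x = Im y -> x = y.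
Proof. by case: x y => [a b] [c d] /= -> ->. Qed.

Lemma ReD (x y : C) : Re (x + y) = Re x + Re y. Proof. by case: x y => [a b] [c d]. Qed.
Lemma ImD (x y : C) : Im (x + y) = Im x + Im y. Proof. by case: x y => [a b] [c d]. Qed.
Lemma ReM (x y : C) : Re (x * y) = Re x * Re y - Im x * Im y.
Proof. by case: x y => [a b] [c d]. Qed.
Lemma ImM (x y : C) : Im (x * y) = Re x * Im y + Im x * Re y.
Proof. by case: x y => [a b] [c d]. Qed.

Lemma L1_cintegrable f (u v : borel G -> R) : L1 mu u -> L1 mu v ->
  (forall x, Re (f x) = u x) -> (forall x, Im (f x) = v x) -> CI f.
Proof.
move=> Lu Lv fu fv; split.
  by rewrite (_ : (fun x => _) = EFin \o u)//; apply/funext => x /=; rewrite fu.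
by rewrite (_ : (fun x => _) = EFin \o v)//; apply/funext => x /=; rewrite fv.
Qed.

Lemma cintegrableD f g : CI f -> CI g -> CI (fun x => f x + g x).
Proof.
move=> [f1 f2] [g1 g2]; apply: L1_cintegrable (L1D f1 g1) (L1D f2 g2) _ _ => x;
  by rewrite ?ReD ?ImD.
Qed.

Lemma cintegrableZ c f : CI f -> CI (fun x => c * f x).
Proof.
move=> [f1 f2].
apply: L1_cintegrable (L1B (L1Z (Re c) f1) (L1Z (Im c) f2))
  (L1D (L1Z (Re c) f2) (L1Z (Im c) f1)) _ _ => x; by rewrite ?ReM ?ImM.
Qed.

Lemma cintegralD f g : CI f -> CI g -> cint (fun x => f x + g x) = cint f + cint g.
Proof.
move=> [f1 f2] [g1 g2]; apply: complexP; rewrite ?ReD ?ImD /= -RintegralD//;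
  by apply: eq_Rintegral => x _; rewrite ?ReD ?ImD.
Qed.

Lemma cintegralZ c f : CI f -> cint (fun x => c * f x) = c * cint f.
Proof.
move=> [f1 f2]; apply: complexP; rewrite ?ReM ?ImM /=.
  rewrite -RintegralZl// -[Im c * _]RintegralZl// -RintegralB//; try exact: L1Z.
  by apply: eq_Rintegral => x _; rewrite ReM.
rewrite -RintegralZl// -[Im c * _]RintegralZl// -RintegralD//; try exact: L1Z.
by apply: eq_Rintegral => x _; rewrite ImM.
Qed.

#[local] Instance ae_mu_filterC : Filter (nbhs (almost_everywhere mu)) :=
  ae_filter_ringOfSetsType mu.

Lemma ae_cintegrable_kernel f g : CI f -> CI g ->
  {ae mu, forall x : borel G, CI (fun y => f y * g (y^-1 * x)%g)}.
Proof.
move=> [f1 f2] [g1 g2].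
have k11 := ae_L1_kernel hK hmu f1 g1; have k12 := ae_L1_kernel hK hmu f1 g2.
have k21 := ae_L1_kernel hK hmu f2 g1; have k22 := ae_L1_kernel hK hmu f2 g2.
apply: (@filterS _ _ ae_mu_filterC _ _ _ (filterI (filterI k11 k12) (filterI k21 k22))).
move=> x [[e11 e12] [e21 e22]].
by apply: L1_cintegrable (L1B e11 e22) (L1D e12 e21) _ _ => y; rewrite ?ReM ?ImM.
Qed.

Lemma convolution_Re_Im f g : CI f -> CI g -> {ae mu, forall x : borel G,
  Re (convC f g x) = conv (fun x : G => Re (f x)) (fun x : G => Re (g x)) x
                     - conv (fun x : G => Im (f x)) (fun x : G => Im (g x)) x /\
  Im (convC f g x) = conv (fun x : G => Re (f x)) (fun x : G => Im (g x)) x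
                     + conv (fun x : G => Im (f x)) (fun x : G => Re (g x)) x}.
Proof.
move=> [f1 f2] [g1 g2].
have k11 := ae_L1_kernel hK hmu f1 g1; have k12 := ae_L1_kernel hK hmu f1 g2.
have k21 := ae_L1_kernel hK hmu f2 g1; have k22 := ae_L1_kernel hK hmu f2 g2.
apply: (@filterS _ _ ae_mu_filterC _ _ _ (filterI (filterI k11 k12) (filterI k21 k22))).
move=> x [[e11 e12] [e21 e22]]; split.
  rewrite /convolution /= -(RintegralB measurableT e11 e22).
  by apply: eq_Rintegral => y _; rewrite ReM.
rewrite /convolution /= -(RintegralD measurableT e12 e21).
by apply: eq_Rintegral => y _; rewrite ImM.
Qed.

(** Bilinearity may fail at the points where one of the kernels is not integrable. *)
Lemma convolution_comb (p q r s : C) f f' g g' : CI f -> CI f' -> CI g -> CI g' ->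
  {ae mu, forall x : borel G,
    convC (fun y => p * f y + q * f' y) (fun y => r * g y + s * g' y) x =
    p * r * convC f g x + p * s * convC f g' x +
    (q * r * convC f' g x + q * s * convC f' g' x)}.
Proof.
move=> If If' Ig Ig'.
have k1 := ae_cintegrable_kernel If Ig; have k2 := ae_cintegrable_kernel If Ig'.
have k3 := ae_cintegrable_kernel If' Ig; have k4 := ae_cintegrable_kernel If' Ig'.
apply: (@filterS _ _ ae_mu_filterC _ _ _ (filterI (filterI k1 k2) (filterI k3 k4))).
move=> x [[e1 e2] [e3 e4]].
rewrite /convolution -!cintegralZ// -!cintegralD//;
  try by [exact: cintegrableZ|apply: cintegrableD; exact: cintegrableZ].
by congr cintegral; apply/funext => y; ring.
Qed.

Lemma convolutionNN f g : convC (fun x => - f x) (fun x => - g x) = convC f g.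
Proof.
by apply/funext => x; congr cintegral; apply/funext => y; rewrite mulrNN.
Qed.

Variable w : borel G -> R.
Hypothesis mw : measurable_fun setT w.
Hypothesis w_ge1 : forall x, 1 <= w x.
Hypothesis w_sub : forall x y : G, w (x * y)%g <= w x + w y.
Variables (C0 : R) (P : nat).
Hypothesis C0_ge0 : 0 <= C0.
Hypothesis growth : forall s, 1 <= s -> (mu [set x | w x <= s]%R <= (C0 * s ^+ P)%:E)%E.

Local Notation A := (weightedL1 mu (w : G -> R)).

Lemma ReMw (z : C) (r : R) : Re (z * r%:C%C) = Re z * r.
Proof. by rewrite ReM /= mulr0 subr0. Qed.
Lemma ImMw (z : C) (r : R) : Im (z * r%:C%C) = Im z * r.
Proof. by rewrite ImM /= mulr0 add0r. Qed.

Lemma domP f : dom A f ->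
  Lw mu w (fun x : G => Re (f x)) /\ Lw mu w (fun x : G => Im (f x)).
Proof.
move=> [[f1 f2] [fw1 fw2]]; split; split => //.
  by apply: eq_integrable fw1 => // x _; rewrite /= ReMw.
by apply: eq_integrable fw2 => // x _; rewrite /= ImMw.
Qed.

Lemma dom_Lw f (u v : borel G -> R) : Lw mu w u -> Lw mu w v ->
  (forall x, Re (f x) = u x) -> (forall x, Im (f x) = v x) -> dom A f.
Proof.
move=> [u1 u2] [v1 v2] fu fv; split; first exact: L1_cintegrable u1 v1 fu fv.
by apply: L1_cintegrable u2 v2 _ _ => x; rewrite ?ReMw ?ImMw ?fu ?fv.
Qed.

Lemma dom_comb (p q : C) f g : dom A f -> dom A g -> dom A (fun x => p * f x + q * g x).
Proof.
move=> [If Ifw] [Ig Igw]; split.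
  by apply: cintegrableD; exact: cintegrableZ.
rewrite (_ : (fun x => _) = fun x => p * (f x * (w x)%:C%C) + q * (g x * (w x)%:C%C)).
  by apply: cintegrableD; exact: cintegrableZ.
by apply/funext => x; rewrite mulrDl !mulrA.
Qed.

(** As f is self-adjoint, its real part is symmetric under inversion and its
    imaginary part antisymmetric. The inverse of l - f is then - (c + g). *)
Lemma quasi_inverseC f (l : C) : dom A f -> same (s := A) (star (s := A) f) f -> Im l != 0 ->
  exists c g, [/\ dom A g, l * c = -1,
    {ae mu, forall x : borel G, c * f x + convC f g x = l * g x} &
    {ae mu, forall x : borel G, c * f x + convC g f x = l * g x}].
Proof.
move=> fA fs l0; have [Lf1 Lf2] := domP fA.
have r1 : {ae mu, forall x, reflect (fun x : G => Re (f x)) x = Re (f x)}.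
  by apply: ae_mono fs => x /= <-; rewrite /involution /reflect; case: (f _).
have r2 : {ae mu, forall x, reflect (fun x : G => Im (f x)) x = - Im (f x)}.
  by apply: ae_mono fs => x /= <-; rewrite /involution /reflect; case: (f _) => ? ? /=; rewrite opprK.
have [c1 [c2 [g1 [g2 [[Lg1 Lg2] [k1 k2] El Er]]]]] :=
  quasi_inverse hK hmu mw w_ge1 w_sub C0_ge0 growth (Re l) Lf1 Lf2 r1 r2 l0.
pose g x : C := Complex (g1 x) (g2 x).
have gA : dom A g by exact: dom_Lw Lg1 Lg2 _ _.
exists (Complex c1 c2), g; split => //.
- by apply: complexP; rewrite ?ReM ?ImM /= ?k1 ?k2 ?oppr0.
- have E := convolution_Re_Im fA.1 gA.1.
  apply: ae_mono2 E El => x [ERe EIm] [E1 E2].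
  apply: complexP; rewrite ?ReD ?ImD ?ReM ?ImM.
    by rewrite ERe /= -E1.
  rewrite EIm /= -E2; ring.
- have E := convolution_Re_Im gA.1 fA.1.
  apply: ae_mono2 E Er => x [ERe EIm] [E1 E2].
  apply: complexP; rewrite ?ReD ?ImD ?ReM ?ImM.
    by rewrite ERe /= -E1.
  rewrite EIm /= -E2; ring.
Qed.

(** For non-real l, the inverse of l - f in the unitization is (- c, - g); in an
    algebra with unit e, that of l e - f is - (c e + g). *)
Theorem weightedL1_hermitian : hermitian_algebra A.
Proof.
move=> f fA fs l lsp; apply: contrapT => lnr.
have l0 : Im l != 0.
  apply/eqP => l0; apply: lnr => /=; rewrite realE !lecE /= l0 eqxx /=.
  exact: le_total.
have [c [g [gA lc El Er]]] := quasi_inverseC fA fs l0.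
case: lsp => [[e [[eA eU] ninv]]|[_ ninv]]; apply: ninv.
- have [_ ee] := eU e eA; have [eg ge] := eU g gA; have [ef fe] := eU f fA.
  pose v : G -> C := fun x => - c * e x + - 1 * g x.
  have uE : l *: e - f = (fun x => l * e x + - 1 * f x) :> (G -> C).
    by apply/funext => x; rewrite mulN1r.
  exists v; split; first exact: dom_comb.
  + have K0 := convolution_comb l (- 1) (- c) (- 1) eA.1 fA.1 eA.1 gA.1.
    rewrite /same /mul /= uE.
    apply: (@filterS _ _ ae_mu_filterC _ _ _ (filterI (filterI K0 El) (filterI ee (filterI eg fe)))).
    move=> x [[-> E1] [E2 [E3 E4]]]; rewrite /mul /= in E2 E3 E4.
    rewrite E2 E3 E4; have -> : convC f g x = l * g x - c * f x by rewrite -E1 addrAC subrr add0r.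
    have -> : l * - c = 1 by rewrite mulrN lc opprK.
    ring.
  + have K0 := convolution_comb (- c) (- 1) l (- 1) eA.1 gA.1 eA.1 fA.1.
    rewrite /same /mul /= uE.
    apply: (@filterS _ _ ae_mu_filterC _ _ _ (filterI (filterI K0 Er) (filterI ee (filterI ge ef)))).
    move=> x [[-> E1] [E2 [E3 E4]]]; rewrite /mul /= in E2 E3 E4.
    rewrite E2 E3 E4; have -> : convC g f x = l * g x - c * f x by rewrite -E1 addrAC subrr add0r.
    have -> : - c * l = 1 by rewrite mulrC mulrN lc opprK.
    ring.
- have uE : (l *: (0 : A) - f : A) = (fun x => - f x) :> (G -> C).
    by apply/funext => x; rewrite /= scaler0 add0r.
  exists (- c, (fun x => - g x) : A); split.
  + have -> : (fun x => - g x) = fun x => - 1 * g x + 0 * g x.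
      by apply/funext => x; rewrite mulN1r mul0r addr0.
    exact: dom_comb.
  + split.
      change ((l * 1 - 0) * - c = 1 :> C).
      by rewrite mulr1 subr0 mulrN lc opprK.
    apply: ae_mono El => x E.
    rewrite /= uE /mul /= convolutionNN.
    change ((l * 1 - 0) * - g x + - c * - f x + convC f g x = 0 :> C).
    by rewrite mulr1 subr0 mulrN mulrNN -addrA E addNr.
  + split.
      change (- c * (l * 1 - 0) = 1 :> C).
      by rewrite mulr1 subr0 mulNr mulrC lc opprK.
    apply: ae_mono Er => x E.
    rewrite /= uE /mul /= convolutionNN.
    change (- c * - f x + (l * 1 - 0) * - g x + convC g f x = 0 :> C).
    by rewrite mulr1 subr0 mulrNN mulrN addrAC E subrr.
Qed.

End ComplexValued.

Lemma left_haar_sigma_finite (R : realType) (G : topologicalGroupType)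
    (K : nat -> set G) (mu : {measure set (borel G) -> \bar R}) :
  locally_elliptic K -> left_haar mu -> sigma_finite setT mu.
Proof.
move=> hK hmu; exists K; first by rewrite (le_cover hK).
move=> n; split; first exact: (open_measurable_borel (le_open hK n)).
by apply: (haar_compact_fin hmu); exact: le_compact hK n.
Qed.

Theorem corollary4p6 (R : realType) (G : topologicalGroupType)
    (K : nat -> set G) (mu : {measure set (borel G) -> \bar R}) (a : nat -> R)
    (hK : locally_elliptic K) (hmu : left_haar mu)
    (a_ge1 : forall i, 1 <= a i)
    (a_nd : forall i j, (i <= j)%N -> a i <= a j)
    (hsum : exists p : R, 0 < p /\
      (mu (K 0%N) * ((a 0%N `^ p)^-1)%:E +
       \sum_(1 <= i <oo) (mu (K i `\` K i.-1) * ((a i `^ p)^-1)%:E)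
         < +oo)%E) :
  hermitian_algebra (weightedL1 mu (omega K a)).
Proof.
have sf := left_haar_sigma_finite hK hmu.
have [p [p0 sumfin]] := hsum.
have [C0 [P [C0_ge0 growth]]] := omega_growth hK a_ge1 a_nd p0 sumfin.
(* mu as a sigma-finite measure, as iterated integrals require *)
pose H1 := isSFinite.Build _ _ _ _ (sfinite_measure_sigma_finite sf).
pose H2 := isSigmaFinite.Build _ _ _ _ sf.
pose nu := HB.pack_for (SigmaFiniteMeasure.type (borel G) R) (Measure.sort mu) H1 H2.
have nuE : mu = nu by exact: eq_measure.
rewrite nuE in hmu growth *.
apply: (weightedL1_hermitian hK hmu _ _ _ C0_ge0 growth).
- exact: measurable_omega.
- exact: omega_ge1.
- exact: omega_subadditive.
Qed.
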